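(* Let $\alpha\in[1,2]$ and let $u_0\in H^\alpha_{\mathrm{per}}(I)$ be real-valued. For each $N\in\mathbb{N}$ let $u_N$ be the semi-discrete Fourier spectral Galerkin approximation of the fractional Benjamin-Bona-Mahony (fBBM) equation $$u_t+u_x+uu_x+\mathcal{D}^\alpha u_t=0,\qquad u(x,0)=u_0(x),$$ that is, $u_N(\cdot,t)\in V_N$, $u_N(\cdot,0)=P_Nu_0$ and $$\bigl((u_N)_t,\phi\bigr)+\bigl((u_N)_t,\mathcal{D}^\alpha\phi\bigr)=\bigl(u_N+\tfrac12u_N^2,\phi_x\bigr)\qquad\text{for all }\phi\in V_N,\ t\ge 0.$$ Then there exist a time $\bar T>0$, independent of $N$, and a constant $C=C(\|u_0\|_\alpha)>0$, independent of $N$, such that for all $N$ and all $t\in[0,\bar T]$ $$\|u_N(t)\|\le C,\qquad \|u_N(t)\|_\alpha\le C,\qquad \|(u_N)_t(t)\|_\alpha\le C.$$ Furthermore, as $N\to\infty$, the sequence $(u_N)$ converges in $C^1([0,\bar T];H^\alpha_{\mathrm{per}}(I))$ to the unique solution of the fBBM equation with initial datum $u_0$.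
   Context: $I=[-\pi,\pi]$; functions are $2\pi$-periodic in $x$. $(u,v)=\int_{-\pi}^{\pi}u\overline v\,dx$ and $\|u\|=(u,u)^{1/2}$. Fourier coefficients: $\hat u(k)=\frac1{2\pi}\int_I u(x)e^{-ikx}\,dx$, $k\in\mathbb{Z}$. For $r\ge0$, $H^r_{\mathrm{per}}(I)$ is the space of periodic functions with finite norm $\|u\|_r=\bigl(\sum_{k\in\mathbb{Z}}(1+|k|^2)^r|\hat u(k)|^2\bigr)^{1/2}$. The fractional Laplacian $\mathcal{D}^\alpha$ is the Fourier multiplier $\widehat{\mathcal{D}^\alpha u}(k)=|k|^\alpha\hat u(k)$. $V_N=\operatorname{span}\{e^{ikx}:-N\le k\le N\}$, and $P_N$ is the $L^2$-orthogonal projection onto $V_N$, $P_N\xi=\sum_{|k|\le N}\hat\xi(k)e^{ikx}$. The scheme is an ODE system for the Fourier coefficients of $u_N$, which has a unique global solution. A solution of the fBBM equation on $[0,\bar T]$ is a function in $C^1([0,\bar T];H^\alpha_{\mathrm{per}}(I))$ satisfying the equation as an identity in $L^2$ together with the initial condition. *)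

(* Defs.v *)
From HB Require Import structures.
From mathcomp Require Import all_boot all_order all_algebra.
From mathcomp Require Import complex.
From mathcomp Require Import all_classical all_reals all_analysis.

Set Implicit Arguments.
Unset Strict Implicit.
Unset Printing Implicit Defensive.

Import Order.TTheory GRing.Theory Num.Theory.
Import numFieldNormedType.Exports.

Local Open Scope classical_set_scope.
Local Open Scope complex_scope.
Local Open Scope ring_scope.

Section Defs.
Context {R : realType}.
Implicit Types (u v w phi : R -> R[i]) (c : int -> R[i]) (k : int) (N : nat).

Definition Iper : set R := `[- pi, pi].

Notation mu := (@lebesgue_measure R).

(* [normc z] is the modulus as an element of R; the library norm `|z| of
   R[i] takes its values in R[i] itself. *)
Definition normc (z : R[i]) : R := ComplexField.Normc.normc z.

(* Meaningful when both parts of u are integrable on Iper, which is the case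
   wherever it is used below. *)
Definition cintegral u : R[i] :=
  (\int[mu]_(x in Iper) complex.Re (u x)) +i* (\int[mu]_(x in Iper) complex.Im (u x)).

Definition inner u v : R[i] := cintegral (fun x => u x * (v x)^*%C).

(* (u, u)^(1/2) as an extended real, so that it is +oo outside L^2. *)
Definition L2norm u : \bar R :=
  ((\int[mu]_(x in Iper) (normc (u x) ^+ 2)%:E) `^ 2^-1)%E.

Definition periodic {T : Type} (f : R -> T) := forall x, f (x + 2 * pi) = f x.

Definition L2per u :=
  [/\ periodic u,
      measurable_fun Iper (fun x => complex.Re (u x)),
      measurable_fun Iper (fun x => complex.Im (u x)) &
      (L2norm u < +oo)%E].

(* Elements of L^2 and H^r are represented by functions; the equality of the
   classes they represent is: *)
Definition eq_L2 u v := {ae mu, forall x, Iper x -> u x = v x}.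

Definition expi k : R -> R[i] :=
  fun x => cos (k%:~R * x) +i* sin (k%:~R * x).

Definition fourier u k : R[i] :=
  ((2 * pi)^-1)%:C * cintegral (fun x => u x * expi (- k) x).

Definition Hnorm (r : R) u : \bar R :=
  ((\esum_(k in [set: int])
      ((1 + `|k%:~R| ^+ 2) `^ r * normc (fourier u k) ^+ 2)%:E) `^ 2^-1)%E.

Definition Hper (r : R) u := L2per u /\ (Hnorm r u < +oo)%E.

(* \sum_(|k| <= N) c k e^{ikx} *)
Definition trigpoly N c : R -> R[i] := fun x =>
  \sum_(i < N.*2.+1) c (i%:Z - N%:Z) * expi (i%:Z - N%:Z) x.

Definition VN N : set (R -> R[i]) := [set u | exists c, u = trigpoly N c].

Definition PN N u : R -> R[i] := trigpoly N (fourier u).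

(* w = D^alpha u *)
Definition is_fracLap (alpha : R) u w :=
  L2per w /\ forall k, fourier w k = (`|k%:~R| `^ alpha)%:C * fourier u k.

(* classical derivative in x *)
Definition dx phi : R -> R[i] := fun x =>
  (derive1 (fun y => complex.Re (phi y)) x) +i*
  (derive1 (fun y => complex.Im (phi y)) x).

(* w = u_x in the weak (periodic distributional) sense *)
Definition is_weak_dx u w :=
  L2per w /\
  forall psi : R -> R, periodic psi ->
    (forall x, derivable psi x 1) -> continuous (derive1 psi) ->
    cintegral (fun x => u x * (derive1 psi x)%:C)
    = - cintegral (fun x => w x * (psi x)%:C).

(* a'(t) = l, the increments being taken inside D (one-sided at end points) *)
Definition has_deriv_in (D : set R) (a : R -> R[i]) (t : R) (l : R[i]) :=
  normc (((s - t)^-1)%:C * (a s - a t) - l) @[s --> within D t^'] --> (0 : R).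

(* u is in C^1([0, T]; H^r_per), with time derivative ut *)
Definition C1Hper (r T : R) (u ut : R -> R -> R[i]) :=
  forall t : R, t \in `[0, T] ->
  [/\ Hper r (u t), Hper r (ut t),
      Hnorm r (fun x => ((s - t)^-1)%:C * (u s x - u t x) - ut t x)
        @[s --> within `[0, T] t^'] --> 0%E &
      Hnorm r (fun x => ut s x - ut t x)
        @[s --> within `[0, T] (nbhs t)] --> 0%E].

Definition C1norm (r T : R) (u ut : R -> R -> R[i]) : \bar R :=
  (ereal_sup [set Hnorm r (u t) | t in `[0%R, T]] +
   ereal_sup [set Hnorm r (ut t) | t in `[0%R, T]])%E.

Definition cvg_C1Hper (r T : R) (uN uNt : nat -> R -> R -> R[i])
    (u ut : R -> R -> R[i]) :=
  [/\ forall N, C1Hper r T (uN N) (uNt N), C1Hper r T u ut &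
      C1norm r T (fun t x => uN N t x - u t x) (fun t x => uNt N t x - ut t x)
        @[N --> \oo] --> 0%E].

(* u is the Galerkin approximation of order N, with time derivative ut; the
   scheme is an ODE system for the Fourier coefficients of u, so the time
   derivative is taken coefficientwise. *)
Definition is_galerkin (alpha : R) (u0 : R -> R[i]) N
    (u ut : R -> R -> R[i]) :=
  u 0 = PN N u0 /\
  forall t : R, 0 <= t ->
  [/\ VN N (u t), VN N (ut t),
      forall k, has_deriv_in `[0, +oo[
                  (fun s => fourier (u s) k) t (fourier (ut t) k) &
      forall phi Dphi, VN N phi -> is_fracLap alpha phi Dphi ->
        inner (ut t) phi + inner (ut t) Dphi
        = inner (fun x => u t x + 2^-1 * u t x ^+ 2) (dx phi)].

(* u solves the fBBM equation on [0, T], with time derivative ut *)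
Definition is_fBBM_solution (alpha T : R) (u0 : R -> R[i])
    (u ut : R -> R -> R[i]) :=
  [/\ C1Hper alpha T u ut,
      eq_L2 (u 0) u0 &
      forall t : R, t \in `[0, T] ->
        exists ux Dut : R -> R[i],
        [/\ is_weak_dx (u t) ux, is_fracLap alpha (ut t) Dut &
            eq_L2 (fun x => ut t x + ux x + u t x * ux x + Dut x) (fun=> 0)]].

End Defs.

(* Main.v *)
(* On the Fourier side both the fBBM equation and its Galerkin truncation read
   c_t(k) = NL(u)(k), where c(k) are the Fourier coefficients of u,
     NL(u)(k) = - ik / (1 + |k|^alpha) (c(k) + (u^2)^(k) / 2),
   and |k| <= N in the Galerkin case. As alpha >= 1, H^alpha consists of absolutely convergent
   Fourier series and is an algebra, and |k| <= 1 + |k|^alpha; hence NL is bounded and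
   Lipschitz on the balls of H^alpha. This bounds the Galerkin solutions in H^alpha up to a
   time T independent of N. A product of two functions with frequencies at most n has
   frequencies at most 2n, so NL controls the modes of u above 2n by those above n; for small
   T this makes the tails of u_N small uniformly in N, and then (u_N) is a Cauchy sequence.
   The limit has Taylor remainder O(|s-t|^2) in H^alpha, uniformly in t, hence is C^1. The
   Riesz-Fischer theorem provides u_x and D^alpha u_t as L^2 functions, and the injectivity
   of the Fourier transform on L^1 turns identities between coefficients into almost
   everywhere identities. Uniqueness follows from the local Lipschitz property of NL. *)
Require Import Defs.
From mathcomp Require Import all_boot all_order all_algebra.
From mathcomp Require Import complex.
From mathcomp Require Import all_classical all_reals all_analysis.
From mathcomp Require Import measurable_realfun zify ring lra.
Set Implicit Arguments.
Unset Strict Implicit.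
Unset Printing Implicit Defensive.
Import Order.TTheory GRing.Theory Num.Theory.
Import numFieldNormedType.Exports.
Local Open Scope classical_set_scope.
Local Open Scope complex_scope.
Local Open Scope ring_scope.

(** * Complex numbers and sequences *)

(** The life span [Tlife r] and the constant depend on [r], the H^alpha norm of the datum, through
    explicit formulas, so both are fixed before any Galerkin solution is considered. No integral of
    a Banach-valued function occurs: time integration is replaced by a mean value inequality
    ([Yb_mean_value]), and norms by bounds on finite sums of modes ([Yb]), which survive
    coefficientwise limits ([Yb_closed]). The obstacle is that u_N and u_M obey different
    truncations of the equation, so that the Lipschitz bound of the nonlinearity says nothing on
    their difference between the two cut-offs. As u_0 has no smoothness beyond H^alpha, no rate in N
    can be traded against a weaker norm; the tails must be small in H^alpha itself. With L the
    Lipschitz constant, L T <= 1/4 makes each induction, the one on tails and the one on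
    differences, halve its bound at every step, which takes the place of Gronwall's inequality.
    Uniqueness cannot rely on a small T: a competing solution on the same interval may be large
    compared with the datum. There the contraction comes from an exponential weight in time. *)

Section ComplexModulus.
Context {R : realType}.
Implicit Types (z w : R[i]) (x : R).

Lemma normcE z : normc z = Num.sqrt (complex.Re z ^+ 2 + complex.Im z ^+ 2).
Proof. by case: z. Qed.

Lemma sqr_normcE z : normc z ^+ 2 = complex.Re z ^+ 2 + complex.Im z ^+ 2.
Proof. by rewrite normcE sqr_sqrtr // addr_ge0 ?sqr_ge0. Qed.

Lemma normc_ge0 z : 0 <= normc z.
Proof. by rewrite normcE sqrtr_ge0. Qed.

Lemma normcD z w : normc (z + w) <= normc z + normc w.
Proof. exact: le_normcD. Qed.

Lemma normcN z : normc (- z) = normc z.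
Proof. by rewrite !normcE !raddfN /= !sqrrN. Qed.

Lemma normcB z w : normc (z - w) <= normc z + normc w.
Proof. by rewrite -(normcN w) normcD. Qed.

Lemma normcBC z w : normc (z - w) = normc (w - z).
Proof. by rewrite -normcN opprB. Qed.

Lemma normcM z w : normc (z * w) = normc z * normc w.
Proof. exact: ComplexField.Normc.normcM. Qed.

Lemma normcR x : normc x%:C = `|x|.
Proof. by rewrite normcE /= expr0n /= addr0 sqrtr_sqr. Qed.

Lemma normc0 : normc (0 : R[i]) = 0.
Proof. by rewrite (normcR 0) normr0. Qed.

Lemma normc_eq0 z : normc z = 0 -> z = 0.
Proof. exact: ComplexField.Normc.eq0_normc. Qed.

Lemma normcJ z : normc (z^*)%C = normc z.
Proof. by case: z => a b; rewrite !normcE /= sqrrN. Qed.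

Lemma normc_Re z : `|complex.Re z| <= normc z.
Proof. by rewrite normcE -sqrtr_sqr ler_wsqrtr // lerDl sqr_ge0. Qed.

Lemma normc_Im z : `|complex.Im z| <= normc z.
Proof. by rewrite normcE -sqrtr_sqr ler_wsqrtr // lerDr sqr_ge0. Qed.

Lemma normc_ReIm z : normc z <= `|complex.Re z| + `|complex.Im z|.
Proof.
rewrite {1}[z]complexE -(normcR (complex.Re z)).
apply: (le_trans (normcD _ _)); rewrite lerD2l normcM normcR.
by rewrite normcE /= expr0n /= add0r expr1n sqrtr1 mul1r.
Qed.

Lemma normc_sum (J : Type) (s : seq J) (P : pred J) (F : J -> R[i]) :
  normc (\sum_(i <- s | P i) F i) <= \sum_(i <- s | P i) normc (F i).
Proof.
apply: (big_ind2 (fun z x => normc z <= x)) => [|z x w y zx wy|//].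
  by rewrite normc0.
exact: le_trans (normcD _ _) (lerD zx wy).
Qed.

Lemma ler_dist_normc z w : `|normc z - normc w| <= normc (z - w).
Proof.
rewrite ler_norml lerBlDr lerNl opprB lerBlDr; apply/andP; split.
  by rewrite normcBC; have := normcD (w - z) z; rewrite subrK.
by have := normcD (z - w) w; rewrite subrK.
Qed.

Lemma cReD z w : complex.Re (z + w) = complex.Re z + complex.Re w.
Proof. by case: z; case: w. Qed.
Lemma cImD z w : complex.Im (z + w) = complex.Im z + complex.Im w.
Proof. by case: z; case: w. Qed.
Lemma cReM z w :
  complex.Re (z * w) = complex.Re z * complex.Re w - complex.Im z * complex.Im w.
Proof. by case: z; case: w. Qed.
Lemma cImM z w :
  complex.Im (z * w) = complex.Re z * complex.Im w + complex.Im z * complex.Re w.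
Proof. by case: z; case: w. Qed.
Lemma complexP z w : complex.Re z = complex.Re w -> complex.Im z = complex.Im w -> z = w.
Proof. by case: z; case: w => a b c d /= -> ->. Qed.

End ComplexModulus.

Section ComplexLimits.
Context {R : realType}.
Implicit Types (a b : nat -> R[i]) (l m : R[i]).

(** Measuring the distance by the real-valued [normc] makes the squeeze, order and limit theorems
    for real sequences directly available. *)
Definition ccvg a l := normc (a n - l) @[n --> \oo] --> (0 : R).

Lemma ccvgP a l : ccvg a l <->
  (complex.Re (a n) @[n --> \oo] --> complex.Re l) /\
  (complex.Im (a n) @[n --> \oo] --> complex.Im l).
Proof.
split=> [al|[rl il]].
- have sq (f : R[i] -> R) : (forall z w, f (z + w) = f z + f w) ->
      (forall z, `|f z| <= normc z) -> f (a n) @[n --> \oo] --> f l.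
    move=> fD fle.
    have f0 : f 0 = 0.
      by apply/eqP; rewrite -normr_le0 (le_trans (fle _))// normc0.
    apply/subr_cvg0; apply/norm_cvg0P.
    apply: (squeeze_cvgr _ (cvg_cst 0) al); near=> n => /=.
    rewrite normr_ge0 /=; apply: le_trans (fle _).
    rewrite fD; have -> : f (- l) = - f l; last by [].
    by apply/eqP; rewrite -subr_eq0 opprK -fD addNr f0.
  by split; apply: sq; [exact: cReD|exact: normc_Re|exact: cImD|exact: normc_Im].
- have h : `|complex.Re (a n) - complex.Re l| + `|complex.Im (a n) - complex.Im l|
      @[n --> \oo] --> (0 : R).
    rewrite -[0]addr0; apply: cvgD; apply/norm_cvg0P; exact/subr_cvg0.
  apply: (squeeze_cvgr _ (cvg_cst 0) h); near=> n => /=.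
  rewrite normc_ge0 /= (le_trans (normc_ReIm _)) //.
  by case: (a n) => ? ?; case: (l).
Unshelve. all: by end_near. Qed.

Lemma ccvg_ext a b l : (forall n, a n = b n) -> ccvg a l -> ccvg b l.
Proof. by move=> /funext ->. Qed.

Lemma ccvg_cst l : ccvg (fun=> l) l.
Proof. by rewrite /ccvg subrr normc0; exact: cvg_cst. Qed.

Lemma ccvgD a b l m : ccvg a l -> ccvg b m -> ccvg (fun n => a n + b n) (l + m).
Proof.
move=> /ccvgP[rl il] /ccvgP[rm im]; apply/ccvgP; rewrite cReD cImD.
by split; under eq_fun do rewrite ?cReD ?cImD; exact: cvgD.
Qed.

Lemma ccvgM a b l m : ccvg a l -> ccvg b m -> ccvg (fun n => a n * b n) (l * m).
Proof.
move=> /ccvgP[rl il] /ccvgP[rm im]; apply/ccvgP; rewrite cReM cImM.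
split; under eq_fun do rewrite ?cReM ?cImM.
  by apply: cvgB; exact: cvgM.
by apply: cvgD; exact: cvgM.
Qed.

Lemma ccvgZ a l c : ccvg a l -> ccvg (fun n => c * a n) (c * l).
Proof. exact/ccvgM/ccvg_cst. Qed.

Lemma ccvgB a b l m : ccvg a l -> ccvg b m -> ccvg (fun n => a n - b n) (l - m).
Proof.
move=> al bm; apply: ccvgD => //; rewrite -mulN1r.
by apply: ccvg_ext (ccvgZ (-1) bm) => n; rewrite mulN1r.
Qed.

Lemma ccvg_unique a l m : ccvg a l -> ccvg a m -> l = m.
Proof.
move=> /ccvgP[rl il] /ccvgP[rm im].
by apply: complexP; [exact: cvg_unique rl rm|exact: cvg_unique il im].
Qed.

Lemma ccvg_normc a l : ccvg a l -> normc (a n) @[n --> \oo] --> normc l.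
Proof.
move=> al; apply/subr_cvg0; apply/norm_cvg0P.
apply: (squeeze_cvgr _ (cvg_cst 0) al); near=> n => /=.
by rewrite normr_ge0 /= ler_dist_normc.
Unshelve. all: by end_near. Qed.

Lemma ccvg_sub a l (g : nat -> nat) : g n @[n --> \oo] --> \oo ->
  ccvg a l -> ccvg (a \o g) l.
Proof. by move=> goo al; exact: (cvg_comp _ _ goo al). Qed.

Lemma ccvg_cauchy a : (forall e, 0 < e -> exists n, forall p q,
  (n <= p)%N -> (n <= q)%N -> normc (a p - a q) <= e) -> exists l, ccvg a l.
Proof.
move=> ca.
have cf (f : R[i] -> R) : (forall z w, f (z - w) = f z - f w) ->
    (forall z, `|f z| <= normc z) -> cvg (f (a n) @[n --> \oo]).
  move=> fB fle; apply/cauchy_cvgP/cauchy_exP => e e0.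
  have [|n hn] := ca (e / 2); first by rewrite divr_gt0.
  exists (f (a n)); exists n => // p /= np.
  rewrite /ball /= -fB; apply: le_lt_trans (fle _) _.
  apply: le_lt_trans (hn _ _ (leqnn n) np) _.
  by rewrite ltr_pdivrMr // mulr_natr mulr2n ltrDl.
have cR := cf (@complex.Re R) _ normc_Re.
have cI := cf (@complex.Im R) _ normc_Im.
exists (lim (complex.Re (a n) @[n --> \oo]) +i* lim (complex.Im (a n) @[n --> \oo])).
by apply/ccvgP; split; [apply: cR|apply: cI] => -[? ?] [? ?].
Qed.

Lemma ccvg_le a l (w : R[i]) e :
  (exists n, forall p, (n <= p)%N -> normc (a p - w) <= e) -> ccvg a l ->
  normc (l - w) <= e.
Proof.
move=> [n hn] al.
have h : ccvg (fun n => a n - w) (l - w) by exact: ccvgB (ccvg_cst _).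
apply: (cvgr_to_le (ccvg_normc h)).
by exists n => // p /= np; exact: hn.
Qed.

End ComplexLimits.

(** * Integration over a period *)

Section Integration.
Context {R : realType}.
Implicit Types (u v : R -> R[i]) (f g : R -> R) (c : R[i]).
Local Notation mu := (@lebesgue_measure R).
Local Notation Iper := (@Iper R).

Local Notation mfun := (measurable_fun (T := measurableTypeR R) Iper).

Lemma measurable_Iper : measurable (Iper : set (measurableTypeR R)).
Proof. exact: measurable_itv. Qed.
Hint Resolve measurable_Iper : core.

Lemma mu_Iper : mu Iper = (2 * pi)%:E.
Proof.
rewrite /Defs.Iper lebesgue_measure_itv /= lte_fin ifT.
  by rewrite -EFinB opprK mulr2n mulrDl mul1r.
by have := pi_gt0 R; lra.
Qed.

Lemma eq_mfun f g : (forall x, f x = g x) -> mfun g -> mfun f.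
Proof. by move=> /funext ->. Qed.

Lemma mfunD f g : mfun f -> mfun g -> mfun (fun x => f x + g x).
Proof. by move=> mf mg; apply: (measurable_funD mf mg). Qed.

Lemma mfunB f g : mfun f -> mfun g -> mfun (fun x => f x - g x).
Proof. by move=> mf mg; apply: (measurable_funB mf mg). Qed.

Lemma mfunM f g : mfun f -> mfun g -> mfun (fun x => f x * g x).
Proof. by move=> mf mg; apply: (measurable_funM mf mg). Qed.

Lemma mfun_continuous f g : continuous g -> mfun f -> mfun (fun x => g (f x)).
Proof.
by move=> cg mf; apply: (measurableT_comp (continuous_measurable_fun cg) mf).
Qed.

Lemma ae_imp (P Q : R -> Prop) : (forall x, P x -> Q x) ->
  {ae mu, forall x, P x} -> {ae mu, forall x, Q x}.
Proof.
by move=> PQ; apply: filterS; first exact: (ae_filter_ringOfSetsType mu).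
Qed.

Lemma ae_imp2 (P Q S : R -> Prop) : (forall x, P x -> Q x -> S x) ->
  {ae mu, forall x, P x} -> {ae mu, forall x, Q x} -> {ae mu, forall x, S x}.
Proof.
by move=> PQ; apply: filterS2; first exact: (ae_filter_ringOfSetsType mu).
Qed.

Definition Lint f := mu.-integrable Iper (EFin \o f).

Definition cmeas u := mfun (fun x => complex.Re (u x)) /\
  mfun (fun x => complex.Im (u x)).

Definition cint u := Lint (fun x => complex.Re (u x)) /\
  Lint (fun x => complex.Im (u x)).

Lemma eq_Lint f g : (forall x, f x = g x) -> Lint g -> Lint f.
Proof. by move=> /funext ->. Qed.

Lemma eq_cmeas u v : (forall x, u x = v x) -> cmeas v -> cmeas u.
Proof. by move=> /funext ->. Qed.

Lemma eq_cint u v : (forall x, u x = v x) -> cint v -> cint u.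
Proof. by move=> /funext ->. Qed.

Lemma Lint_cst r : Lint (fun=> r).
Proof.
apply: (@measurable_bounded_integrable _ _ _ mu (fun=> r) Iper) => //.
  exact: (eq_ind_r (fun z => (z < +oo)%E) (ltry (2 * pi)) mu_Iper).
by exists `|r|; split; rewrite ?num_real // => M rM x _ /=; exact: ltW.
Qed.

Lemma Lint_meas f : Lint f -> mfun f.
Proof. by move=> /measurable_int /measurable_EFinP. Qed.

Lemma LintD f g : Lint f -> Lint g -> Lint (fun x => f x + g x).
Proof. by move=> Lf Lg; exact: (integrableD measurable_Iper Lf Lg). Qed.

Lemma LintZ r f : Lint f -> Lint (fun x => r * f x).
Proof. by move=> Lf; exact: (integrableZl measurable_Iper r Lf). Qed.

Lemma Lint_dom f g : mfun f -> Lint g ->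
  (forall x, Iper x -> `|f x| <= g x) -> Lint f.
Proof.
move=> mf Lg fg; apply: (le_integrable _ _ _ Lg) => //.
  exact/measurable_EFinP.
by move=> x Ix /=; rewrite lee_fin; apply: le_trans (fg _ Ix) (ler_norm _).
Qed.

Lemma cmeasM u v : cmeas u -> cmeas v -> cmeas (fun x => u x * v x).
Proof.
move=> [? ?] [? ?]; split.
  by apply: (eq_mfun (fun x => cReM (u x) (v x))); apply: mfunB; exact: mfunM.
by apply: (eq_mfun (fun x => cImM (u x) (v x))); apply: mfunD; exact: mfunM.
Qed.

Lemma cmeasD u v : cmeas u -> cmeas v -> cmeas (fun x => u x + v x).
Proof.
move=> [? ?] [? ?]; split.
  by apply: (eq_mfun (fun x => cReD (u x) (v x))); exact: mfunD.
by apply: (eq_mfun (fun x => cImD (u x) (v x))); exact: mfunD.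
Qed.

Lemma cmeas_cst c : cmeas (fun=> c).
Proof. by split; exact: measurable_cst. Qed.

Lemma cmeas_sum (J : Type) (s : seq J) (F : J -> R -> R[i]) :
  (forall j, cmeas (F j)) -> cmeas (fun x => \sum_(j <- s) F j x).
Proof.
move=> LF; elim: s => [|j s IH].
  by apply: (@eq_cmeas _ (fun=> 0)) => [x|]; [rewrite big_nil|exact: cmeas_cst].
apply: (@eq_cmeas _ (fun x => F j x + \sum_(i <- s) F i x)) => [x|].
  by rewrite big_cons.
exact: cmeasD.
Qed.

Lemma cmeas_normc u : cmeas u -> mfun (fun x => normc (u x)).
Proof.
move=> [mr mi]; apply: (eq_mfun (fun x => normcE (u x))).
apply: mfun_continuous; first exact: sqrt_continuous.
by apply: mfunD; exact: mfunM.
Qed.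

Lemma cint_meas u : cint u -> cmeas u.
Proof. by move=> [/Lint_meas ? /Lint_meas ?]. Qed.

Lemma cint_dom u g : cmeas u -> Lint g ->
  (forall x, Iper x -> normc (u x) <= g x) -> cint u.
Proof.
move=> [mr mi] Lg ug; split; apply: (Lint_dom _ Lg) => // x Ix;
  by apply: le_trans (ug _ Ix); rewrite ?normc_Re ?normc_Im.
Qed.

Lemma cint_normc u : cint u -> Lint (fun x => normc (u x)).
Proof.
move=> cu; have [Lr Li] := cu.
apply: (@Lint_dom _ (fun x => `|complex.Re (u x)| + `|complex.Im (u x)|)).
- exact: cmeas_normc (cint_meas cu).
- by apply: LintD; exact: integrable_norm.
- by move=> x _; rewrite ger0_norm ?normc_ge0 // normc_ReIm.
Qed.

Lemma cintM_bounded u v B : cint u -> cmeas v ->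
  (forall x, Iper x -> normc (v x) <= B) -> cint (fun x => u x * v x).
Proof.
move=> cu mv vB; apply: (@cint_dom _ (fun x => B * normc (u x))).
- exact: cmeasM (cint_meas cu) mv.
- exact: LintZ (cint_normc cu).
- by move=> x Ix; rewrite normcM mulrC ler_wpM2r ?normc_ge0 ?vB.
Qed.

Lemma cint_cst c : cint (fun=> c).
Proof. by split; exact: Lint_cst. Qed.

Lemma cintD u v : cint u -> cint v -> cint (fun x => u x + v x).
Proof.
move=> [? ?] [? ?]; split.
  by apply: (eq_Lint (fun x => cReD (u x) (v x))); exact: LintD.
by apply: (eq_Lint (fun x => cImD (u x) (v x))); exact: LintD.
Qed.

Lemma cintZ c u : cint u -> cint (fun x => c * u x).
Proof.
move=> cu; apply: (eq_cint (fun x => mulrC c (u x))).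
by apply: (@cintM_bounded _ _ (normc c)) => //; exact: cmeas_cst.
Qed.

Lemma cintB u v : cint u -> cint v -> cint (fun x => u x - v x).
Proof.
move=> cu cv; apply: cintD => //.
by apply: (eq_cint (fun x => esym (mulN1r (v x)))); exact: cintZ.
Qed.

Lemma cint_sum (J : Type) (s : seq J) (F : J -> R -> R[i]) :
  (forall j, cint (F j)) -> cint (fun x => \sum_(j <- s) F j x).
Proof.
move=> LF; elim: s => [|j s IH].
  by apply: (@eq_cint _ (fun=> 0)) => [x|]; [rewrite big_nil|exact: cint_cst].
apply: (@eq_cint _ (fun x => F j x + \sum_(i <- s) F i x)) => [x|].
  by rewrite big_cons.
exact: cintD.
Qed.

Lemma cintegralD u v : cint u -> cint v ->
  cintegral (fun x => u x + v x) = cintegral u + cintegral v.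
Proof.
move=> [? ?] [? ?]; rewrite /cintegral; apply: complexP => /=.
  by under eq_Rintegral do rewrite cReD; rewrite RintegralD.
by under eq_Rintegral do rewrite cImD; rewrite RintegralD.
Qed.

Lemma cintegralZ c u : cint u ->
  cintegral (fun x => c * u x) = c * cintegral u.
Proof.
move=> [? ?]; rewrite /cintegral; apply: complexP => /=; rewrite ?cReM ?cImM /=.
  under eq_Rintegral do rewrite cReM.
  by rewrite RintegralB ?RintegralZl //; exact: LintZ.
under eq_Rintegral do rewrite cImM.
by rewrite RintegralD ?RintegralZl //; exact: LintZ.
Qed.

Lemma cintegralB u v : cint u -> cint v ->
  cintegral (fun x => u x - v x) = cintegral u - cintegral v.
Proof.
move=> cu cv; have /= := cintegralD cu (cintZ (-1) cv).
rewrite cintegralZ // mulN1r => <-; congr cintegral.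
by apply/funext => x; rewrite mulN1r.
Qed.

Lemma cintegral0 : cintegral (fun=> 0 : R[i]) = 0 :> R[i].
Proof. by have := cintegralZ 0 (cint_cst 0); rewrite !mul0r. Qed.

Lemma cintegral_sum (J : Type) (s : seq J) (F : J -> R -> R[i]) :
  (forall j, cint (F j)) ->
  cintegral (fun x => \sum_(j <- s) F j x) = \sum_(j <- s) cintegral (F j).
Proof.
move=> LF; elim: s => [|j s IH].
  rewrite big_nil -[RHS]cintegral0; congr cintegral.
  by apply/funext => x; rewrite big_nil.
rewrite (_ : (fun x => _) = fun x => F j x + \sum_(i <- s) F i x); last first.
  by apply/funext => x; rewrite big_cons.
by rewrite cintegralD ?IH ?big_cons //; exact: cint_sum.
Qed.

Lemma eq_ae_cintegral u v : cmeas u -> cmeas v -> eq_L2 u v ->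
  cintegral u = cintegral v.
Proof.
move=> [? ?] [? ?] uv; rewrite /cintegral; congr Complex;
 (congr fine; apply: ae_eq_integral => //;
  [exact/measurable_EFinP|exact/measurable_EFinP|
   by apply: ae_imp uv => x /= h Ix; rewrite h]).
Qed.

Lemma dominated_cintegral (F : nat -> R -> R[i]) u g :
  (forall n, cmeas (F n)) -> cmeas u -> Lint g ->
  (forall n x, Iper x -> normc (F n x) <= g x) ->
  {ae mu, forall x, Iper x -> ccvg (F^~ x) (u x)} ->
  cint u /\ ccvg (fun n => cintegral (F n)) (cintegral u).
Proof.
move=> mF mu' Lg Fg Fu.
(* [P] stands for the real or the imaginary part; real dominated convergence is run once for
   both. *)
have key (P : R[i] -> R) : (forall n, mfun (fun x => P (F n x))) ->
    mfun (fun x => P (u x)) -> (forall z, `|P z| <= normc z) ->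
    (forall a l, ccvg a l -> P (a n) @[n --> \oo] --> P l) ->
    Lint (fun x => P (u x)) /\
    \int[mu]_(x in Iper) P (F n x) @[n --> \oo] --> \int[mu]_(x in Iper) P (u x).
  move=> mPF mPu Pn Pc.
  have Fu' : {ae mu, forall x, Iper x ->
      (P (F n x))%:E @[n --> \oo] --> (P (u x))%:E}.
    apply: ae_imp Fu => x h Ix; apply: cvg_EFin; first exact: nearW.
    exact: Pc (h Ix).
  have Fg' : {ae mu, forall x n, Iper x -> (`|(P (F n x))%:E| <= (g x)%:E)%E}.
    apply: aeW => x n Ix; rewrite lee_fin.
    exact: le_trans (Pn (F n x)) (Fg n x Ix).
  have [Lu _ cvgu] := @dominated_convergence _ _ _ mu Iper measurable_Iper
    (fun n x => (P (F n x))%:E) (fun x => (P (u x))%:E) (EFin \o g)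
    (fun n => (measurable_EFinP _ _).2 (mPF n)) ((measurable_EFinP _ _).2 mPu)
    Fu' Lg Fg'.
  split=> //.
  apply: fine_cvg; rewrite fineK; last exact: integrable_fin_num.
  exact: cvgu.
have [Lr cr] := key (@complex.Re R) (fun n => (mF n).1) mu'.1 (@normc_Re _)
  (fun a l al => ((ccvgP _ _).1 al).1).
have [Li ci] := key (@complex.Im R) (fun n => (mF n).2) mu'.2 (@normc_Im _)
  (fun a l al => ((ccvgP _ _).1 al).2).
by split; [split|apply/ccvgP; split].
Qed.

End Integration.

(** * Square-integrable functions over a period, and the exponentials *)

Section FourierBasics.
Context {R : realType}.
Implicit Types (u v : R -> R[i]) (f g : R -> R) (c : R[i]) (k : int).
Local Notation mu := (@lebesgue_measure R).
Local Notation Iper := (@Iper R).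
Local Notation mfun := (measurable_fun (T := measurableTypeR R) Iper).

Local Notation periodic := (@Defs.periodic R _).

(** Stating square integrability as real integrability, without periodicity, lets the closure
    properties follow by domination; [L2perP] links it to [L2per]. *)
Definition csq u := cmeas u /\ Lint (fun x => normc (u x) ^+ 2).

Lemma L2norm_ltP u : cmeas u ->
  (L2norm u < +oo)%E <-> Lint (fun x => normc (u x) ^+ 2).
Proof.
move=> mu'.
have J0 : (0 <= \int[mu]_(x in Iper) (normc (u x) ^+ 2)%:E)%E.
  by apply: integral_ge0 => x _; rewrite lee_fin sqr_ge0.
have mn : mfun (fun x => normc (u x) ^+ 2).
  by have mn := cmeas_normc mu'; apply: mfunM.
have E : (\int[mu]_(x in Iper) `|(normc (u x) ^+ 2)%:E| =
    \int[mu]_(x in Iper) (normc (u x) ^+ 2)%:E)%E.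
  by apply: eq_integral => x _; rewrite gee0_abs // lee_fin sqr_ge0.
have h20 : 2^-1 != 0 :> R by rewrite invr_eq0.
split=> [Lu|/integrableP[_]].
- apply/integrableP; split; first exact/measurable_EFinP.
  by rewrite E; exact: lty_poweRy h20 Lu.
- by rewrite E => Lu; exact: poweR_lty.
Qed.

Lemma L2perP u : L2per u <-> periodic u /\ csq u.
Proof.
split=> [[pu mr mi Lu]|[pu [[mr mi] Lu]]].
  have mu' : cmeas u by split.
  by split=> //; split=> //; apply/L2norm_ltP.
by split=> //; apply/L2norm_ltP.
Qed.

Lemma L2norm_le u (B : R) : csq u -> 0 <= B ->
  \int[mu]_(x in Iper) (normc (u x) ^+ 2) <= B ^+ 2 -> (L2norm u <= B%:E)%E.
Proof.
move=> [mu' Lu] B0 uB; rewrite /L2norm.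
rewrite -[X in (X `^ _)%E]fineK; last exact: (integrable_fin_num measurable_Iper Lu).
rewrite poweR_EFin lee_fin.
have -> : B = (B ^+ 2) `^ 2^-1.
  by rewrite powR12_sqrt ?sqr_ge0 // sqrtr_sqr ger0_norm.
apply: ge0_ler_powR; rewrite ?nnegrE ?invr_ge0 ?sqr_ge0 //.
by apply: Rintegral_ge0 => x _; exact: sqr_ge0.
Qed.

Lemma csq_cint u : csq u -> cint u.
Proof.
move=> [mu' Lu]; apply: (cint_dom mu' (LintD (Lint_cst 1) Lu)) => x _.
by have := sqr_ge0 (normc (u x) - 1); nra.
Qed.

Lemma csqD u v : csq u -> csq v -> csq (fun x => u x + v x).
Proof.
move=> [mu' Lu] [mv Lv]; split; first exact: cmeasD.
apply: (Lint_dom _ (LintZ 2 (LintD Lu Lv))).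
  by have m := cmeas_normc (cmeasD mu' mv); exact: mfunM.
move=> x _; rewrite ger0_norm ?sqr_ge0 //.
have := normcD (u x) (v x); have := normc_ge0 (u x + v x).
have := sqr_ge0 (normc (u x) - normc (v x)).
by move: (normc _) (normc _) (normc _) => a b d; nra.
Qed.

Lemma csqM_bounded u v B : csq u -> cmeas v ->
  (forall x, Iper x -> normc (v x) <= B) -> csq (fun x => u x * v x).
Proof.
move=> [mu' Lu] mv vB; split; first exact: cmeasM.
apply: (Lint_dom _ (LintZ (B ^+ 2) Lu)).
  by have m := cmeas_normc (cmeasM mu' mv); exact: mfunM.
move=> x Ix; rewrite ger0_norm ?sqr_ge0 // normcM exprMn mulrC.
by rewrite ler_wpM2r ?sqr_ge0 // lerXn2r ?nnegrE ?normc_ge0 ?vB // (le_trans _ (vB _ Ix)) ?normc_ge0.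
Qed.

Lemma csq_cst c : csq (fun=> c).
Proof. by split; [exact: cmeas_cst|exact: Lint_cst]. Qed.

Lemma eq_csq u v : (forall x, u x = v x) -> csq v -> csq u.
Proof. by move=> /funext ->. Qed.

Lemma csqZ c u : csq u -> csq (fun x => c * u x).
Proof.
move=> cu; apply: (eq_csq (fun x => mulrC c (u x))).
by apply: (@csqM_bounded _ _ (normc c)) => //; exact: cmeas_cst.
Qed.

Lemma csqB u v : csq u -> csq v -> csq (fun x => u x - v x).
Proof.
move=> cu cv; apply: csqD => //.
by apply: (eq_csq (fun x => esym (mulN1r (v x)))); exact: csqZ.
Qed.

Lemma csq_sum (J : Type) (s : seq J) (F : J -> R -> R[i]) :
  (forall j, csq (F j)) -> csq (fun x => \sum_(j <- s) F j x).
Proof.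
move=> LF; elim: s => [|j s IH].
  by apply: (@eq_csq _ (fun=> 0)) => [x|]; [rewrite big_nil|exact: csq_cst].
apply: (@eq_csq _ (fun x => F j x + \sum_(i <- s) F i x)) => [x|].
  by rewrite big_cons.
exact: csqD.
Qed.

Lemma csqM_cint u v : csq u -> csq v -> cint (fun x => u x * v x).
Proof.
move=> [mu' Lu] [mv Lv].
apply: (cint_dom (cmeasM mu' mv) (LintD Lu Lv)) => x _; rewrite normcM.
have := sqr_ge0 (normc (u x) - normc (v x)).
by have := normc_ge0 (u x); have := normc_ge0 (v x); nra.
Qed.

Lemma L2perD u v : L2per u -> L2per v -> L2per (fun x => u x + v x).
Proof.
move=> /L2perP[pu cu] /L2perP[pv cv]; apply/L2perP.
by split; [move=> x; rewrite pu pv|exact: csqD].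
Qed.

Lemma L2perB u v : L2per u -> L2per v -> L2per (fun x => u x - v x).
Proof.
move=> /L2perP[pu cu] /L2perP[pv cv]; apply/L2perP.
by split; [move=> x; rewrite pu pv|exact: csqB].
Qed.

Lemma L2perZ c u : L2per u -> L2per (fun x => c * u x).
Proof.
move=> /L2perP[pu cu]; apply/L2perP.
by split; [move=> x; rewrite pu|exact: csqZ].
Qed.

Lemma L2per_csq u : L2per u -> csq u.
Proof. by move=> /L2perP[]. Qed.

Lemma L2per_cint u : L2per u -> cint u.
Proof. by move=> /L2per_csq /csq_cint. Qed.

Lemma expi0 x : expi 0 x = 1 :> R[i].
Proof. by rewrite /expi mul0r cos0 sin0. Qed.

Lemma expiD (j k : int) (x : R) : expi (j + k) x = expi j x * expi k x.
Proof.
by rewrite /expi intrD mulrDl cosD sinD; apply: complexP => /=; rewrite // addrC.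
Qed.

Lemma expiJ k (x : R) : (expi k x)^*%C = expi (- k) x.
Proof. by rewrite /expi intrN mulNr cosN sinN. Qed.

Lemma normc_expi k (x : R) : normc (expi k x) = 1.
Proof. by rewrite normcE /= cos2Dsin2 sqrtr1. Qed.

Lemma expi_periodic k : periodic (@expi R k).
Proof.
have e1 (x : R) : expi 1 (x + 2 * pi) = expi 1 x.
  by rewrite /expi !mul1r mulr_natl mulr2n addrA !cosDpi !sinDpi !opprK.
have en (n : nat) (x : R) : expi n%:Z (x + 2 * pi) = expi n%:Z x.
  by elim: n => [|n IH]; rewrite ?expi0 // -addn1 PoszD !expiD IH e1.
move=> x; case: k => n; first exact: en.
by rewrite NegzE -!expiJ en.
Qed.

Lemma is_derive_mulr (r x : R) : is_derive x 1 (fun y => r * y) r.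
Proof.
have H : is_derive x 1 (r \*: id) (r *: 1) by exact: is_deriveZ.
by move: H; rewrite /GRing.scale /= mulr1.
Qed.

Lemma is_derive_cosk (r x : R) :
  is_derive x 1 (fun y => cos (r * y)) (- r * sin (r * x)).
Proof.
have -> : - r * sin (r * x) = - sin (r * x) * r by ring.
exact: (is_derive1_comp (f := cos) (is_derive_cos _) (is_derive_mulr r x)).
Qed.

Lemma is_derive_sink (r x : R) :
  is_derive x 1 (fun y => sin (r * y)) (r * cos (r * x)).
Proof.
rewrite mulrC.
exact: (is_derive1_comp (f := sin) (is_derive_sin _) (is_derive_mulr r x)).
Qed.

End FourierBasics.

(** * Fourier coefficients and trigonometric polynomials *)

Section Orthogonality.
Context {R : realType}.
Implicit Types (u v : R -> R[i]) (f g : R -> R) (k : int).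
Local Notation mu := (@lebesgue_measure R).
Local Notation Iper := (@Iper R).
Local Notation mfun := (measurable_fun (T := measurableTypeR R) Iper).
Local Notation periodic := (@Defs.periodic R _).

Lemma cts_is_derive f (df : R -> R) : (forall x : R, is_derive x (1 : R) f (df x)) ->
  continuous f.
Proof.
move=> fdf x; apply/differentiable_continuous/derivable1_diffP.
by have [] := fdf x.
Qed.

Lemma Rintegral_derivative f (df : R -> R) :
  (forall x : R, is_derive x (1 : R) f (df x)) -> continuous df ->
  \int[mu]_(x in Iper) df x = f pi - f (- pi).
Proof.
move=> fdf cdf; have pi0 := pi_gt0 R.
have cf := cts_is_derive fdf.
rewrite /Rintegral /Defs.Iper (@continuous_FTC2 _ df f) //; first lra.
- exact: continuous_subspaceT.
- split=> [x _| |]; first by have [] := fdf x.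
  + exact: cvg_at_right_filter (cf _).
  + exact: cvg_at_left_filter (cf _).
- by move=> x _; rewrite derive1E; have [] := fdf x.
Qed.

Lemma continuous_cmeas u : continuous (fun x => complex.Re (u x)) ->
  continuous (fun x => complex.Im (u x)) -> cmeas u.
Proof.
by move=> cr ci; split; apply: measurable_funTS; exact: continuous_measurable_fun.
Qed.

Lemma cts_coskx (r : R) : continuous (fun x : R => cos (r * x)).
Proof. exact: cts_is_derive (is_derive_cosk r). Qed.

Lemma cts_sinkx (r : R) : continuous (fun x : R => sin (r * x)).
Proof. exact: cts_is_derive (is_derive_sink r). Qed.

Lemma cmeas_expi k : cmeas (@expi R k).
Proof. by apply: continuous_cmeas => /=; [exact: cts_coskx|exact: cts_sinkx]. Qed.

Lemma csq_expi k : csq (@expi R k).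
Proof.
apply: (@eq_csq _ _ (fun x => 1 * expi k x)) => [x|]; first by rewrite mul1r.
apply: (@csqM_bounded _ _ _ 1); [exact: csq_cst|exact: cmeas_expi|].
by move=> x _; rewrite normc_expi.
Qed.

Lemma expi_pi k : expi k (- pi) = expi k pi :> R[i].
Proof.
by rewrite -[in RHS](_ : - pi + 2 * pi = pi :> R) ?expi_periodic //; ring.
Qed.

Lemma cintegral_expi k :
  cintegral (@expi R k) = if k == 0 then (2 * pi)%:C else 0.
Proof.
case: eqP => [->|/eqP k0].
  rewrite (_ : expi 0 = fun=> 1); last by apply/funext => x; exact: expi0.
  rewrite /cintegral /=; apply: complexP => /=.
    rewrite Rintegral_cst; last exact: measurable_Iper.
    by rewrite [X in fine X]mu_Iper mul1r.
  rewrite Rintegral_cst; last exact: measurable_Iper.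
  by rewrite mul0r.
have r0 : (k%:~R : R) != 0 by rewrite intr_eq0.
have [] := expi_pi k; set r := k%:~R in r0 * => hc hs.
have h1 := @Rintegral_derivative _ _ (is_derive_sink r).
have h2 := @Rintegral_derivative _ _ (is_derive_cosk r).
rewrite /cintegral; apply: complexP => /=.
  (* After multiplication by r = k the integrand is the derivative of sin(r x), which takes equal
     values at both ends of the period. *)
  apply: (mulfI r0); rewrite mulr0 -RintegralZl; last 2 first.
  - exact: measurable_Iper.
  - by have [] := csq_cint (csq_expi k).
  rewrite h1 ?hs ?subrr //.
  by move=> x; apply: cvgM; [exact: cvg_cst|exact: cts_coskx].
apply: (@mulfI _ (- r)); first by rewrite oppr_eq0.
rewrite mulr0 -RintegralZl; last 2 first.
- exact: measurable_Iper.
- by have [] := csq_cint (csq_expi k).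
rewrite h2 ?hc ?subrr //.
by move=> x; apply: cvgM; [exact: cvg_cst|exact: cts_sinkx].
Qed.

(** A duplicate-free list of integers, instead of shifted ordinals, so that sums of modes can be
    split, permuted and compared with sums over arbitrary lists. *)
Definition zr (N : nat) : seq int := [seq i%:Z - N%:Z | i <- iota 0 N.*2.+1].

Lemma zr_uniq N : uniq (zr N).
Proof.
rewrite map_inj_uniq ?iota_uniq // => i j /eqP.
by rewrite (inj_eq (addIr _)) => /eqP [].
Qed.

Lemma mem_zr N k : (k \in zr N) = (`|k| <= N)%N.
Proof.
apply/mapP/idP => [[m]|kN].
  by rewrite mem_iota /= add0n -addnn => mN ->; lia.
exists (absz (k + N%:Z)%R); last by lia.
by rewrite mem_iota -addnn; lia.
Qed.

Lemma trigpolyE N (c : int -> R[i]) x :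
  trigpoly N c x = \sum_(k <- zr N) c k * expi k x.
Proof.
rewrite /trigpoly big_map.
rewrite -(big_mkord xpredT (fun i => c (i%:Z - N%:Z) * expi (i%:Z - N%:Z) x)).
by rewrite /index_iota subn0.
Qed.

Lemma csq_trigpoly N (c : int -> R[i]) : csq (trigpoly N c).
Proof.
apply: (eq_csq (trigpolyE N c)); apply: csq_sum => k.
exact/csqZ/csq_expi.
Qed.

Lemma trigpoly_periodic N (c : int -> R[i]) : periodic (trigpoly N c).
Proof.
by move=> x; rewrite !trigpolyE; apply: eq_bigr => k _; rewrite expi_periodic.
Qed.

Lemma L2per_trigpoly N (c : int -> R[i]) : L2per (trigpoly N c).
Proof. by apply/L2perP; split; [exact: trigpoly_periodic|exact: csq_trigpoly]. Qed.

Lemma cint_expiM u k : cint u -> cint (fun x => u x * expi k x).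
Proof.
move=> cu; apply: (@cintM_bounded _ _ _ 1) => //; first exact: cmeas_expi.
by move=> x _; rewrite normc_expi.
Qed.

Lemma eq_ae_fourier u v k : cmeas u -> cmeas v -> eq_L2 u v ->
  fourier u k = fourier v k.
Proof.
move=> mu' mv uv; congr (_ * _); apply: eq_ae_cintegral.
- exact/cmeasM/cmeas_expi.
- exact/cmeasM/cmeas_expi.
- by apply: ae_imp uv => x h /h ->.
Qed.

Lemma fourierD u v k : cint u -> cint v ->
  fourier (fun x => u x + v x) k = fourier u k + fourier v k.
Proof.
move=> cu cv; rewrite /fourier -mulrDr -cintegralD; [|exact: cint_expiM..].
by congr (_ * cintegral _); apply/funext => x; rewrite mulrDl.
Qed.

Lemma fourierB u v k : cint u -> cint v ->
  fourier (fun x => u x - v x) k = fourier u k - fourier v k.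
Proof.
move=> cu cv; rewrite /fourier -mulrBr -cintegralB; [|exact: cint_expiM..].
by congr (_ * cintegral _); apply/funext => x; rewrite mulrBl.
Qed.

Lemma fourierZ a u k : cint u -> fourier (fun x => a * u x) k = a * fourier u k.
Proof.
move=> cu; rewrite /fourier mulrCA -[in RHS]cintegralZ; last exact: cint_expiM.
by congr (_ * cintegral _); apply/funext => x; rewrite mulrA.
Qed.

Lemma fourier_sum (J : Type) (s : seq J) (F : J -> R -> R[i]) k :
  (forall j, cint (F j)) ->
  fourier (fun x => \sum_(j <- s) F j x) k = \sum_(j <- s) fourier (F j) k.
Proof.
move=> cF; rewrite /fourier -mulr_sumr -cintegral_sum; last first.
  by move=> j; exact: cint_expiM.
by congr (_ * cintegral _); apply/funext => x; rewrite mulr_suml.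
Qed.

Lemma twopi_neq0 : (2 * pi : R) != 0.
Proof. by have := pi_gt0 R; lra. Qed.

Lemma fourier_expi (j k : int) : fourier (@expi R j) k = if j == k then 1 else 0.
Proof.
rewrite /fourier (_ : (fun x => _) = expi (j - k)); last first.
  by apply/funext => x; rewrite expiD.
rewrite cintegral_expi subr_eq0; case: eqP => _; last by rewrite mulr0.
by rewrite -rmorphM /= mulVf ?twopi_neq0.
Qed.

Lemma fourier_trigpoly N (c : int -> R[i]) k :
  fourier (trigpoly N c) k = if (`|k| <= N)%N then c k else 0.
Proof.
rewrite (_ : trigpoly N c = fun x => \sum_(j <- zr N) c j * expi j x); last first.
  by apply/funext => x; rewrite trigpolyE.
rewrite fourier_sum => [|j]; last exact/cintZ/csq_cint/csq_expi.
under eq_bigr => j _.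
  rewrite fourierZ; last exact/csq_cint/csq_expi.
  rewrite fourier_expi; over.
rewrite -mem_zr; case: ifP => kN.
  rewrite (bigD1_seq k) ?zr_uniq //= eqxx mulr1 big1 ?addr0 // => j /negbTE ->.
  by rewrite mulr0.
rewrite big_seq big1 // => j jN; case: eqP => [jk|]; last by rewrite mulr0.
by rewrite -jk jN in kN.
Qed.

Lemma cintegral_fourier u k :
  cintegral (fun x => u x * expi (- k) x) = (2 * pi)%:C * fourier u k.
Proof. by rewrite /fourier mulrA -rmorphM /= mulfV ?twopi_neq0 ?mul1r. Qed.

End Orthogonality.

(** * An integrable function is determined by its Fourier coefficients *)

Section FourierUniqueness.
Context {R : realType}.
Implicit Types (u v : R -> R[i]) (f g : R -> R) (k : int).
Local Notation mu := (@lebesgue_measure R).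
Local Notation Iper := (@Iper R).
Local Notation mfun := (measurable_fun (T := measurableTypeR R) Iper).

(** Trigonometric polynomials without a degree bound. Frequencies may repeat in the list, so sums
    and products need no normalization. *)
Definition espan u := exists s : seq (R[i] * int),
  forall x, u x = \sum_(p <- s) p.1 * expi p.2 x.

Lemma espan_expi k : espan (@expi R k).
Proof. by exists [:: (1, k)] => x; rewrite big_seq1 /= mul1r. Qed.

Lemma espan_cst a : espan (fun=> a).
Proof. by exists [:: (a, 0)] => x; rewrite big_seq1 expi0 mulr1. Qed.

Lemma espanD u v : espan u -> espan v -> espan (fun x => u x + v x).
Proof. by move=> [s us] [t vt]; exists (s ++ t) => x; rewrite us vt big_cat. Qed.

Lemma espanM u v : espan u -> espan v -> espan (fun x => u x * v x).
Proof.
move=> [s us] [t vt].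
exists [seq (p.1 * q.1, p.2 + q.2) | p <- s, q <- t] => x.
rewrite us vt big_allpairs_dep mulr_suml; apply: eq_bigr => p _.
by rewrite mulr_sumr; apply: eq_bigr => q _ /=; rewrite expiD mulrACA.
Qed.

Lemma eq_espan u v : (forall x, u x = v x) -> espan v -> espan u.
Proof. by move=> /funext ->. Qed.

Lemma espanX u n : espan u -> espan (fun x => u x ^+ n).
Proof.
move=> eu; elim: n => [|n IH].
  exact: eq_espan (fun x => expr0 (u x)) (espan_cst 1).
exact: eq_espan (fun x => exprS (u x) n) (espanM eu IH).
Qed.

Lemma espanZ a u : espan u -> espan (fun x => a * u x).
Proof. exact/espanM/espan_cst. Qed.

Lemma espanB u v : espan u -> espan v -> espan (fun x => u x - v x).
Proof.
move=> eu ev; apply: espanD => //.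
exact: eq_espan (fun x => esym (mulN1r (v x))) (espanZ _ ev).
Qed.

Lemma espan_cos : espan (fun x : R => (cos x)%:C).
Proof.
apply: (@eq_espan _ (fun x => (2^-1)%:C * (expi 1 x + expi (-1) x))).
  move=> x; rewrite /expi mul1r mulN1r cosN sinN.
  by apply: complexP; rewrite ?cReM ?cImM /=; lra.
by apply/espanZ/espanD; exact: espan_expi.
Qed.

Lemma espan_sin : espan (fun x : R => (sin x)%:C).
Proof.
apply: (@eq_espan _ (fun x => (0 -i* 2^-1) * (expi 1 x - expi (-1) x))).
  move=> x; rewrite /expi mul1r mulN1r cosN sinN.
  by apply: complexP; rewrite ?cReM ?cImM /=; lra.
by apply/espanZ/espanB; exact: espan_expi.
Qed.

Lemma cintegral_espan u v : cint u -> (forall k, fourier u k = 0) -> espan v ->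
  cintegral (fun x => u x * v x) = 0.
Proof.
move=> cu u0 [s vs].
rewrite (_ : (fun x => _) = fun x => \sum_(p <- s) p.1 * (u x * expi p.2 x)).
  rewrite cintegral_sum => [|p]; last exact/cintZ/cint_expiM.
  apply: big1 => p _; rewrite cintegralZ; last exact: cint_expiM.
  by rewrite -[p.2]opprK cintegral_fourier u0 !mulr0.
apply/funext => x; rewrite vs mulr_sumr; apply: eq_bigr => p _.
by rewrite mulrCA.
Qed.

Lemma bernoulli_le (z : R) m : 0 <= z <= 1 -> 1 - m%:R * z <= (1 - z) ^+ m.
Proof.
move=> z01; elim: m => [|m IH]; first by rewrite mul0r subr0 expr0.
rewrite exprS; apply: le_trans (ler_wpM2l _ IH); last lra.
by rewrite -natr1; have : (0 : R) <= m%:R by []; move: (m%:R) => a; nra.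
Qed.

Lemma bernoulli_ge (z : R) m : 0 <= z -> 1 + m%:R * z <= (1 + z) ^+ m.
Proof.
move=> z01; elim: m => [|m IH]; first by rewrite mul0r addr0 expr0.
rewrite exprS; apply: le_trans (ler_wpM2l _ IH); last lra.
by rewrite -natr1; have : (0 : R) <= m%:R by []; move: (m%:R) => a; nra.
Qed.

(* the polynomials of Brosowski and Deutsch: on [0, 1] they converge boundedly to the
   indicator of [0, 1/2[, except at 1/2 *)
Definition bdpoly n (y : R) := (1 - y ^+ n) ^+ (2 ^ n).

Lemma bdpoly_itv n y : 0 <= y <= 1 -> 0 <= bdpoly n y <= 1.
Proof.
move=> /andP[y0 y1]; have yn0 : 0 <= y ^+ n by exact: exprn_ge0.
have yn1 : y ^+ n <= 1 by exact: exprn_ile1.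
by rewrite exprn_ge0 ?exprn_ile1 //; lra.
Qed.

(** Bernoulli's inequality gives 1 - (2y)^n <= (1 - y^n)^(2^n) <= 1, and 2y < 1. *)
Lemma bdpoly_lt y : 0 <= y < 2^-1 -> bdpoly n y @[n --> \oo] --> (1 : R).
Proof.
move=> /andP[y0 y1].
have h : (1 - (2 * y) ^+ n) @[n --> \oo] --> (1 - 0 : R).
  apply: cvgB; first exact: cvg_cst.
  by apply: cvg_expr; rewrite ger0_norm; lra.
rewrite subr0 in h; apply: (@squeeze_cvgr _ _ _ _ (fun n => 1 - (2 * y) ^+ n) (fun=> 1)); [|exact: h|exact: cvg_cst]; near=> n.
have y01 : 0 <= y <= 1 by lra.
have /andP[_ ->] := bdpoly_itv n y01.
rewrite andbT exprMn -natrX; apply: bernoulli_le.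
by rewrite exprn_ge0 ?exprn_ile1 //; lra.
Unshelve. all: by end_near. Qed.

(** Since (1 - y^n)(1 + y^n) <= 1, the polynomial is at most (1 + y^n)^(-2^n), which by Bernoulli's
    inequality is at most (2y)^(-n), and 2y > 1. *)
Lemma bdpoly_gt y : 2^-1 < y <= 1 -> bdpoly n y @[n --> \oo] --> (0 : R).
Proof.
move=> /andP[y0 y1].
have h : ((2 * y)^-1 ^+ n) @[n --> \oo] --> (0 : R).
  apply: cvg_expr; rewrite ger0_norm ?invr_ge0; last lra.
  by rewrite invf_lt1; lra.
apply: (@squeeze_cvgr _ _ _ _ (fun=> 0) (fun n => (2 * y)^-1 ^+ n)); [|exact: cvg_cst|exact: h]; near=> n.
have y01 : 0 <= y <= 1 by lra.
have /andP[-> _] := bdpoly_itv n y01.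
have yn0 : 0 <= y ^+ n by apply: exprn_ge0; lra.
have yn1 : y ^+ n <= 1 by apply: exprn_ile1; lra.
have b0 : 0 < (2 * y) ^+ n by apply: exprn_gt0; lra.
rewrite /= exprVn -[leRHS]mul1r ler_pdivlMr //.
apply: (@le_trans _ _ (bdpoly n y * (1 + y ^+ n) ^+ (2 ^ n))).
  apply: ler_wpM2l; first by apply: exprn_ge0; lra.
  apply: le_trans (bernoulli_ge _ _) => //.
  by rewrite natrX exprMn; lra.
rewrite /bdpoly -exprMn; apply: exprn_ile1; nra.
Unshelve. all: by end_near. Qed.

Lemma ae_neq (a : R) : {ae mu, forall x, x != a}.
Proof.
exists [set a]; split.
- exact: measurable_set1.
- exact: lebesgue_measure_set1.
- by move=> x /= /negP; rewrite negbK => /eqP.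
Qed.

(* t |-> sin (x/2) - sin (t - x/2) = 2 cos (t/2) sin ((x-t)/2) is positive on
   ]-pi, x[ and negative on ]x, pi[ *)
Definition arc (x t : R) := (sin (x / 2) - sin (t - x / 2) + 2) / 4.

Lemma arcE x t : arc x t = (cos (t / 2) * sin ((x - t) / 2) + 1) / 2.
Proof.
rewrite /arc (_ : x / 2 = t / 2 + (x - t) / 2); last by lra.
rewrite (_ : t - (t / 2 + (x - t) / 2) = t / 2 - (x - t) / 2); last by lra.
by rewrite sinD sinB; lra.
Qed.

Lemma arc_itv x t : 0 <= arc x t <= 1.
Proof.
have := sin_geN1 (x / 2); have := sin_le1 (x / 2).
have := sin_geN1 (t - x / 2); have := sin_le1 (t - x / 2).
by rewrite /arc; lra.
Qed.

Lemma arc_gt x t : - pi < t < x -> x < pi -> 2^-1 < arc x t.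
Proof.
move=> tx xpi; rewrite arcE.
have c0 : 0 < cos (t / 2) by apply: cos_gt0_pihalf; lra.
have s0 : 0 < sin ((x - t) / 2) by apply: sin_gt0_pi; lra.
by have := mulr_gt0 c0 s0; lra.
Qed.

Lemma arc_lt x t : x < t < pi -> - pi < x -> arc x t < 2^-1.
Proof.
move=> tx xpi; rewrite arcE.
have c0 : 0 < cos (t / 2) by apply: cos_gt0_pihalf; lra.
have s0 : 0 < sin ((t - x) / 2) by apply: sin_gt0_pi; lra.
rewrite (_ : (x - t) / 2 = - ((t - x) / 2)) ?sinN; last lra.
by have := mulr_gt0 c0 s0; lra.
Qed.

(** The half angle x/2 enters only as a parameter; in t the function has frequencies -1, 0 and 1.
    This is why [arc] is written with sin(t - x/2) and not as the product of half-angle functions of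
    t. *)
Lemma espan_arc x : espan (fun t => (arc x t)%:C).
Proof.
apply: (@eq_espan _ (fun t => (sin (x / 2) / 4 + 2^-1)%:C
   - ((cos (x / 2) / 4)%:C * (sin t)%:C - (sin (x / 2) / 4)%:C * (cos t)%:C))).
  move=> t; rewrite -!rmorphM -!rmorphB; congr (_%:C).
  by rewrite /arc sinB; lra.
apply: espanB; first exact: espan_cst.
by apply: espanB; apply: espanZ; [exact: espan_sin|exact: espan_cos].
Qed.

Lemma espan_bdarc n x : espan (fun t => (1 - bdpoly n (arc x t))%:C).
Proof.
apply: (@eq_espan _ (fun t => 1 - (1 - (arc x t)%:C ^+ n) ^+ (2 ^ n))).
  by move=> t; rewrite /bdpoly !(rmorphB, rmorphXn, rmorph1).
apply: espanB; first exact: espan_cst.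
apply: espanX; apply: espanB; first exact: espan_cst.
exact/espanX/espan_arc.
Qed.

Lemma espan_cmeas u : espan u -> cmeas u.
Proof.
move=> [s us]; apply: (eq_cmeas us); apply: cmeas_sum => p.
by apply: cmeasM; [exact: cmeas_cst|exact: cmeas_expi].
Qed.

(** The trigonometric polynomials [1 - bdpoly n (arc x t)] lie in [0, 1] and converge to the
    indicator of t < x except at x, pi and -pi. The integral of u against each of them is 0, and |u|
    dominates. *)
Lemma cintegral_Nyx u x : cint u -> (forall k, fourier u k = 0) ->
  - pi < x < pi ->
  cintegral (fun t => u t * (\1_(`]-oo, x]) t)%:C) = 0.
Proof.
move=> cu u0 /andP[xl xr].
have mI : cmeas (fun t : R => ((\1_(`]-oo, x]) t : R))%:C).
  split; first exact: measurable_indic.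
  exact: measurable_cst.
pose F n t := u t * (1 - bdpoly n (arc x t))%:C.
have [|||||_ cF] := @dominated_cintegral _ F
    (fun t => u t * (\1_(`]-oo, x]) t)%:C) (fun t => normc (u t)).
- move=> n; apply: cmeasM; first exact: cint_meas.
  exact/espan_cmeas/espan_bdarc.
- by apply: cmeasM => //; exact: cint_meas.
- exact: cint_normc.
- move=> n t _; rewrite normcM ler_piMr ?normc_ge0 // normcR.
  have /andP[b0 b1] := bdpoly_itv n (arc_itv x t).
  by rewrite ger0_norm; lra.
- apply: (ae_imp2 (P := fun t => t != x) (Q := fun t => (t != pi) && (t != - pi))).
  + move=> t tx /andP[tpi tNpi]; rewrite /Defs.Iper /= in_itv /= => /andP[t1 t2].
    have {}tpi : t < pi by rewrite lt_neqAle tpi.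
    have {}tNpi : - pi < t by rewrite lt_neqAle eq_sym tNpi.
    apply: ccvgM; first exact: ccvg_cst.
    apply/ccvgP; split; last exact: cvg_cst.
    rewrite /= indicE mem_setE in_itv /=.
    have /andP[a0 a1] := arc_itv x t.
    case: (ltrgtP t x) tx => // tx _.
      rewrite /= -[X in _ --> X]subr0; apply: cvgB; first exact: cvg_cst.
      by apply: bdpoly_gt; rewrite arc_gt // tNpi.
    rewrite /= -[X in _ --> X](subrr 1); apply: cvgB; first exact: cvg_cst.
    by apply: bdpoly_lt; rewrite a0 arc_lt // tx.
  + exact: ae_neq.
  + apply: (ae_imp2 (P := fun t => t != pi) (Q := fun t => t != - pi));
      [by move=> t -> -> |exact: ae_neq|exact: ae_neq].
have F0 n : cintegral (F n) = 0 by apply: cintegral_espan => //; exact: espan_bdarc.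
apply: ccvg_unique cF _; apply: ccvg_ext (ccvg_cst 0) => n; by rewrite F0.
Qed.

(** Lebesgue differentiation: the primitive of f extended by 0 vanishes near each interior point,
    hence so does its derivative, which is f almost everywhere. *)
Lemma ae_eq0_of_primitive f : Lint f ->
  (forall x, - pi < x < pi -> \int[mu]_(t in Iper) (f t * \1_(`]-oo, x]) t) = 0) ->
  {ae mu, forall x, Iper x -> f x = 0}.
Proof.
move=> Lf f0.
pose g := f \_ Iper.
have Lg : mu.-integrable setT (EFin \o g).
  by rewrite /g -restrict_EFin; apply/(integrable_mkcond _ measurable_Iper).
have Fg := @FTC1Ny R g.
have Fg0 x : - pi < x < pi -> \int[mu]_(t in `]-oo, x]) g t = 0.
  move=> hx; rewrite /g -Rintegral_mkcondr Rintegral_mkcondl.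
  rewrite -[RHS](f0 x hx); apply: eq_Rintegral => t _.
  by rewrite /patch indicE; case: ifP => tx; rewrite ?mulr1 ?mulr0.
have {}Fg := Fg _ (open_integrable_locally openT Lg).
have {}Fg : {ae mu, forall x, derivable (fun x : R => \int[mu]_(t in `]-oo, x]) g t) x 1 /\
    derive1 (fun x : R => \int[mu]_(t in `]-oo, x]) g t) x = g x}.
  apply: Fg => y; apply: (integrableS _ _ _ Lg) => //; exact: measurable_itv.
apply: (ae_imp2 (Q := fun t => (t != pi) && (t != - pi)) _ Fg); last first.
  apply: (ae_imp2 (P := fun t => t != pi) (Q := fun t => t != - pi));
    [by move=> t -> -> |exact: ae_neq|exact: ae_neq].
move=> x [_ dF] /andP[xpi xNpi]; rewrite /Defs.Iper /= in_itv /= => /andP[x1 x2].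
have {}xpi : x < pi by rewrite lt_neqAle xpi.
have {}xNpi : - pi < x by rewrite lt_neqAle eq_sym xNpi.
have -> : f x = g x.
  by rewrite /g /patch ifT // inE /Defs.Iper /= in_itv /= x1.
rewrite -dF derive1E (@near_eq_derive _ _ _ _ (fun=> 0)) ?derive_cst //.
near=> y; apply: Fg0; apply/andP; split; near: y.
  exact: lt_nbhsr.
exact: lt_nbhsl.
Unshelve. all: by end_near. Qed.

Theorem fourier_eq0 u : cint u -> (forall k, fourier u k = 0) ->
  {ae mu, forall x, Iper x -> u x = 0}.
Proof.
move=> cu u0; have [Lr Li] := cu.
have key x : - pi < x < pi ->
    \int[mu]_(t in Iper) (complex.Re (u t) * \1_(`]-oo, x]) t) = 0 /\
    \int[mu]_(t in Iper) (complex.Im (u t) * \1_(`]-oo, x]) t) = 0.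
  move=> hx; have [hr hi] := cintegral_Nyx cu u0 hx.
  split; [rewrite -[RHS]hr|rewrite -[RHS]hi]; apply: eq_Rintegral => t _;
    by rewrite ?cReM ?cImM /=; ring.
have hr := ae_eq0_of_primitive Lr (fun x hx => (key x hx).1).
have hi := ae_eq0_of_primitive Li (fun x hx => (key x hx).2).
by apply: (ae_imp2 _ hr hi) => x h1 h2 Ix; apply: complexP; [exact: h1|exact: h2].
Qed.

Theorem fourier_inj u v : cint u -> cint v ->
  (forall k, fourier u k = fourier v k) -> eq_L2 u v.
Proof.
move=> cu cv uv; have := @fourier_eq0 (fun x => u x - v x) (cintB cu cv).
have h k : fourier (fun x => u x - v x) k = 0 by rewrite fourierB // uv subrr.
by move=> /(_ h); apply: ae_imp => x /[apply] /eqP; rewrite subr_eq0 => /eqP.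
Qed.

End FourierUniqueness.

(** * Absolutely convergent Fourier series *)

Section UnconditionalSums.
Context {R : realType}.
Implicit Types (a b : int -> R) (c : int -> R[i]) (s : seq int).

(** For a nonnegative family this says that its sum is at most [B], without forming an infinite sum
    or fixing an order of summation. *)
Definition sumb a (B : R) := forall s, uniq s -> \sum_(k <- s) a k <= B.

Definition tail a n (e : R) :=
  forall s, uniq s -> (forall k, k \in s -> (n < `|k|)%N) -> \sum_(k <- s) a k <= e.

Lemma sumb_ge0 a B : sumb a B -> 0 <= B.
Proof. by move=> /(_ [::] isT); rewrite big_nil. Qed.

Lemma sumb_le a b B : (forall k, a k <= b k) -> sumb b B -> sumb a B.
Proof. by move=> ab h s us; apply: le_trans (h _ us); exact: ler_sum. Qed.

(** A list whose sum is within e of the supremum of all finite sums leaves at most e to any list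
    disjoint from it. *)
Lemma sumb_tail a B : (forall k, 0 <= a k) -> sumb a B ->
  forall e, 0 < e -> exists n, tail a n e.
Proof.
move=> a0 aB e e0.
pose E := [set \sum_(k <- s) a k | s in [set s : seq int | uniq s]].
have hE : has_sup E.
  split; first by exists (\sum_(k <- [::]) a k); exists [::].
  by exists B => _ [s us <-]; exact: aB.
have [_ [s us <-] hs] := sup_adherent e0 hE.
exists (\max_(k <- s) `|k|%N)%N => t ut ht.
have : \sum_(k <- s ++ t) a k <= sup E.
  apply: sup_upper_bound => //; exists (s ++ t) => //=.
  rewrite cat_uniq us ut andbT /=; apply/hasPn => k kt; apply/negP => ks.
  have := ht _ kt; rewrite ltnNge => /negP; apply.
  exact: (@leq_bigmax_seq _ _ xpredT (fun i : int => absz i) k ks isT).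
by rewrite big_cat /= => h; lra.
Qed.

Lemma tail_leq a m n e : (m <= n)%N -> tail a m e -> tail a n e.
Proof. by move=> mn h s us hs; apply: h => // k /hs; exact: leq_ltn_trans. Qed.

Lemma sum_zr_split (V : zmodType) (F : int -> V) n s : uniq s -> {subset zr n <= s} ->
  \sum_(k <- s) F k =
  \sum_(k <- zr n) F k + \sum_(k <- [seq k <- s | (n < `|k|)%N]) F k.
Proof.
move=> us zs; rewrite (bigID (fun k => (`|k| <= n)%N)) /=; congr (_ + _).
  rewrite -big_filter; apply: perm_big; apply: uniq_perm.
  - exact: filter_uniq.
  - exact: zr_uniq.
  - by move=> k; rewrite mem_filter -mem_zr; apply: andb_idr; exact: zs.
by rewrite big_filter; apply: eq_bigl => k; rewrite ltnNge.
Qed.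

Lemma sum_tail c n e s : uniq s -> {subset zr n <= s} ->
  tail (fun k => normc (c k)) n e ->
  normc (\sum_(k <- s) c k - \sum_(k <- zr n) c k) <= e.
Proof.
move=> us zs h; rewrite (sum_zr_split _ us zs) addrAC subrr add0r.
apply: le_trans (normc_sum _ _ _) (h _ _ _); first exact: filter_uniq.
by move=> k; rewrite mem_filter => /andP[].
Qed.

Lemma zr_subset m n : (m <= n)%N -> {subset zr m <= zr n}.
Proof. by move=> mn k; rewrite !mem_zr => /leq_trans; apply. Qed.

Lemma sumb_ccvg c B : sumb (fun k => normc (c k)) B ->
  exists l, ccvg (fun n => \sum_(k <- zr n) c k) l.
Proof.
move=> cB; apply: ccvg_cauchy => e e0.
have e20 : 0 < e / 2 by rewrite divr_gt0.
have [n hn] := sumb_tail (fun k => normc_ge0 (c k)) cB e20.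
exists n => p q np nq.
have hp := sum_tail (zr_uniq p) (zr_subset np) hn.
have hq := sum_tail (zr_uniq q) (zr_subset nq) hn.
rewrite -(subrKA (\sum_(k <- zr n) c k)) (splitr e).
apply: le_trans (normcD _ _) (lerD hp _).
by rewrite normcBC.
Qed.

(* 0 when the symmetric partial sums diverge *)
Definition zsum c : R[i] := xget 0 (fun l => ccvg (fun n => \sum_(k <- zr n) c k) l).

Lemma zsumP c B : sumb (fun k => normc (c k)) B ->
  ccvg (fun n => \sum_(k <- zr n) c k) (zsum c).
Proof. by move=> /sumb_ccvg[l cl]; rewrite /zsum; case: xgetP => [x _ //|/(_ l)]. Qed.

(** The factor 2 comes from comparing both the limit and the sum over [s] with the sum over
    [zr n]. *)
Lemma zsum_tail c B n e s : sumb (fun k => normc (c k)) B ->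
  uniq s -> {subset zr n <= s} -> tail (fun k => normc (c k)) n e ->
  normc (zsum c - \sum_(k <- s) c k) <= 2 * e.
Proof.
move=> cB us ns h.
apply: ccvg_le (zsumP cB); exists n => p np.
have hp := sum_tail (zr_uniq p) (zr_subset np) h.
have hs := sum_tail us ns h.
rewrite -(subrKA (\sum_(k <- zr n) c k)) mulr_natl mulr2n.
by apply: le_trans (normcD _ _) (lerD hp _); rewrite normcBC.
Qed.

Lemma zsum_le c B : sumb (fun k => normc (c k)) B -> normc (zsum c) <= B.
Proof.
move=> cB; rewrite -[zsum c]subr0; apply: ccvg_le (zsumP cB); exists 0%N => p _.
by rewrite subr0; apply: le_trans (normc_sum _ _ _) (cB _ (zr_uniq p)).
Qed.

(** Absolute convergence permits summation along any exhaustion of the integers; it serves for the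
    reindexing j -> k - j, which does not preserve the symmetric intervals. *)
Lemma zsum_exhaust c B (s : nat -> seq int) :
  sumb (fun k => normc (c k)) B -> (forall n, uniq (s n)) ->
  (forall m, \forall n \near \oo, {subset zr m <= s n}) ->
  ccvg (fun n => \sum_(k <- s n) c k) (zsum c).
Proof.
move=> cB us sm; apply/cvgrPdist_le => e e0.
have e20 : 0 < e / 2 by rewrite divr_gt0.
have [m hm] := sumb_tail (fun k => normc_ge0 (c k)) cB e20.
near=> n; rewrite sub0r normrN ger0_norm ?normc_ge0 // normcBC.
apply: le_trans (zsum_tail cB (us n) _ hm) _; first by near: n; exact: sm.
by rewrite mulrC divfK.
Unshelve. all: by end_near. Qed.

End UnconditionalSums.

(** * Absolutely convergent Fourier series and the convolution formula *)

Section FourierSeries.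
Context {R : realType}.
Implicit Types (u v : R -> R[i]) (f g : R -> R) (k : int) (c : int -> R[i]).
Local Notation mu := (@lebesgue_measure R).
Local Notation Iper := (@Iper R).
Local Notation mfun := (measurable_fun (T := measurableTypeR R) Iper).
Local Notation periodic := (@Defs.periodic R _).

Lemma sqr_normcM (z : R[i]) : (normc z ^+ 2)%:C = z * (z^*)%C.
Proof. by rewrite sqr_normcE; case: z => a b; apply: complexP => /=; ring. Qed.

Lemma conjcM (z w : R[i]) : ((z * w)^* = z^* * w^*)%C.
Proof. exact: rmorphM. Qed.

Lemma parseval_trigpoly N c :
  \int[mu]_(x in Iper) (normc (trigpoly N c x) ^+ 2) =
  2 * pi * \sum_(k <- zr N) normc (c k) ^+ 2.
Proof.
have E : cintegral (fun x => (normc (trigpoly N c x) ^+ 2)%:C) =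
    (2 * pi * \sum_(k <- zr N) normc (c k) ^+ 2)%:C.
  (* Only the conjugated factor is expanded; the integrals that remain are Fourier coefficients of
     the other factor. *)
  rewrite (_ : (fun x => _) = fun x => \sum_(k <- zr N)
      (c k)^*%C * (trigpoly N c x * expi (- k) x)); last first.
    apply/funext => x; rewrite sqr_normcM [in X in _ * X]trigpolyE raddf_sum.
    rewrite mulr_sumr; apply: eq_bigr => k _.
    by rewrite -[X in _ * X]/((c k * expi k x)^*%C) conjcM mulrCA -expiJ.
  have ct := csq_cint (csq_trigpoly N c).
  rewrite cintegral_sum => [|k]; last exact/cintZ/cint_expiM.
  rewrite rmorphM rmorph_sum /= mulr_sumr; apply: eq_big_seq => k kN.
  rewrite cintegralZ; last exact: cint_expiM.
  rewrite cintegral_fourier fourier_trigpoly -mem_zr kN sqr_normcM.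
  by rewrite mulrCA [_ * c k]mulrC.
by have /(congr1 (@complex.Re R)) := E.
Qed.

Definition fser c : R -> R[i] := fun x => zsum (fun k => c k * expi k x).

Lemma sumb_expi c B x : sumb (fun k => normc (c k)) B ->
  sumb (fun k => normc (c k * expi k x)) B.
Proof. by apply: sumb_le => k; rewrite normcM normc_expi mulr1. Qed.

Lemma fser_cvg c B x : sumb (fun k => normc (c k)) B ->
  ccvg (fun n => trigpoly n c x) (fser c x).
Proof.
move=> cB; apply: ccvg_ext (zsumP (sumb_expi x cB)) => n.
by rewrite trigpolyE.
Qed.

Lemma fser_le c B x : sumb (fun k => normc (c k)) B -> normc (fser c x) <= B.
Proof. by move=> cB; exact: zsum_le (sumb_expi x cB). Qed.

Lemma trigpoly_le n c B x : sumb (fun k => normc (c k)) B ->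
  normc (trigpoly n c x) <= B.
Proof.
move=> cB; rewrite trigpolyE; apply: le_trans (normc_sum _ _ _) _.
exact: sumb_expi x cB _ (zr_uniq n).
Qed.

Lemma cmeas_cvg (F : nat -> R -> R[i]) u : (forall n, cmeas (F n)) ->
  (forall x, Iper x -> ccvg (F^~ x) (u x)) -> cmeas u.
Proof.
move=> mF Fu; split.
  by apply: (measurable_fun_cvg (fun n => (mF n).1)) => x /Fu /ccvgP[].
by apply: (measurable_fun_cvg (fun n => (mF n).2)) => x /Fu /ccvgP[].
Qed.

Lemma fser_cmeas c B : sumb (fun k => normc (c k)) B -> cmeas (fser c).
Proof.
move=> cB; apply: (@cmeas_cvg (fun n => trigpoly n c)) => [n|x _].
  by case: (csq_trigpoly n c).
exact: fser_cvg cB.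
Qed.

Lemma fser_periodic c : periodic (fser c).
Proof.
by move=> x; rewrite /fser; congr zsum; apply/funext => k; rewrite expi_periodic.
Qed.

Lemma L2per_fser c B : sumb (fun k => normc (c k)) B -> L2per (fser c).
Proof.
move=> cB; apply/L2perP; split; first exact: fser_periodic.
apply: (@eq_csq _ _ (fun x => 1 * fser c x)) => [x|]; first by rewrite mul1r.
apply: (@csqM_bounded _ _ _ B); [exact: csq_cst|exact: fser_cmeas cB|].
by move=> x _; exact: fser_le.
Qed.

Lemma cintegral_fserM c B v : sumb (fun k => normc (c k)) B -> cint v ->
  ccvg (fun n => cintegral (fun x => trigpoly n c x * v x))
       (cintegral (fun x => fser c x * v x)).
Proof.
move=> cB cv.
have [|||||//] := @dominated_cintegral _ (fun n x => trigpoly n c x * v x)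
  (fun x => fser c x * v x) (fun x => B * normc (v x)).
- by move=> n; apply: cmeasM; [case: (csq_trigpoly n c)|exact: cint_meas].
- by apply: cmeasM; [exact: fser_cmeas cB|exact: cint_meas].
- exact/LintZ/cint_normc.
- by move=> n x _; rewrite normcM ler_wpM2r ?normc_ge0 // trigpoly_le.
- by apply: aeW => x _; apply: ccvgM; [exact: fser_cvg cB|exact: ccvg_cst].
Qed.

Lemma trigpolyM_fourier n c v k : cint v ->
  fourier (fun x => trigpoly n c x * v x) k =
  \sum_(j <- zr n) c j * fourier v (k - j).
Proof.
move=> cv; rewrite (_ : (fun x => _) = fun x => \sum_(j <- zr n)
    c j * (v x * expi j x)); last first.
  apply/funext => x; rewrite trigpolyE mulr_suml; apply: eq_bigr => j _.
  by rewrite -mulrA [_ * v x]mulrC.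
rewrite fourier_sum => [|j]; last exact/cintZ/cint_expiM.
apply: eq_bigr => j _; rewrite fourierZ; last exact: cint_expiM.
rewrite /fourier; congr (_ * (_ * cintegral _)); apply/funext => x.
by rewrite -mulrA -expiD; congr (_ * expi _ x); rewrite opprB addrC.
Qed.

(** Partial sums of the series are bounded by [B], so B |v| dominates and an integrable [v]
    suffices. The weak derivative u_x, which is merely L^2, is such a factor later on. *)
Lemma fserM_fourier c B v k : sumb (fun k => normc (c k)) B -> cint v ->
  ccvg (fun n => \sum_(j <- zr n) c j * fourier v (k - j))
       (fourier (fun x => fser c x * v x) k).
Proof.
move=> cB cv; apply: ccvg_ext (fun n => trigpolyM_fourier n c k cv) _.
apply: ccvgZ; have := cintegral_fserM cB (cint_expiM (- k) cv).
rewrite (_ : (fun x => fser c x * _) = (fun x => fser c x * v x * expi (- k) x)).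
  by apply: ccvg_ext => n; congr cintegral; apply/funext => x; rewrite mulrA.
by apply/funext => x; rewrite mulrA.
Qed.

Lemma fser_fourier c B k : sumb (fun k => normc (c k)) B -> fourier (fser c) k = c k.
Proof.
move=> cB; have h := fserM_fourier k cB (csq_cint (csq_expi 0)).
rewrite (_ : (fun x => _) = fser c) in h; last first.
  by apply/funext => x; rewrite expi0 mulr1.
apply: ccvg_unique h _; apply/cvgrPdist_le => e e0; near=> n.
suff -> : \sum_(j <- zr n) c j * fourier (@expi R 0) (k - j) = c k.
  by rewrite subrr normc0 subrr normr0 ltW.
have kn : k \in zr n by rewrite mem_zr; near: n; exact: nbhs_infty_ge.
rewrite (bigD1_seq k) ?zr_uniq //= fourier_expi subrr eqxx mulr1.
rewrite big1 ?addr0 // => j jk; rewrite fourier_expi eq_sym subr_eq0 eq_sym.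
by rewrite (negbTE jk) mulr0.
Unshelve. all: by end_near. Qed.

End FourierSeries.

(** * The Riesz-Fischer theorem *)

Section RieszFischer.
Context {R : realType}.
Implicit Types (u v : R -> R[i]) (f g : R -> R) (k : int) (c : int -> R[i]).
Local Notation mu := (@lebesgue_measure R).
Local Notation Iper := (@Iper R).
Local Notation mfun := (measurable_fun (T := measurableTypeR R) Iper).
Local Notation periodic := (@Defs.periodic R _).

Lemma sqr_normcD (z w : R[i]) :
  normc (z + w) ^+ 2 <= 2 * normc z ^+ 2 + 2 * normc w ^+ 2.
Proof.
have := normcD z w; have := normc_ge0 (z + w).
have := sqr_ge0 (normc z - normc w).
by move: (normc _) (normc _) (normc _) => a b d; nra.
Qed.

(** The weights 2^j grow slowly enough to keep the sum integrable when the squared L^2 increments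
    decay like 4^-j, and fast enough for a finite sum at a point to force convergence there. *)
Definition wsq (S : nat -> R[i]) j : R := 2 ^+ j * normc (S j.+1 - S j) ^+ 2.

Lemma wsq_ge0 S j : 0 <= wsq S j.
Proof. by rewrite /wsq mulr_ge0 ?exprn_ge0 ?normc_ge0. Qed.

(* With x = D_q and y = S_(q+1+m) - S_(q+1), the inequality
   |x + y|^2 <= 2 |x|^2 + 2 |y|^2 reproduces the weights 2^j exactly. *)
Lemma wsq_dist S m q : normc (S (q + m)%N - S q) ^+ 2 <=
  2 / 2 ^+ q * \sum_(0 <= i < m) wsq S (q + i)%N.
Proof.
elim: m q => [|m IH] q.
  by rewrite addn0 subrr normc0 expr0n /= big_geq // mulr0.
rewrite -(subrKA (S q.+1)) addnS -addSn big_nat_recl // addn0.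
apply: le_trans (sqr_normcD _ _) _; have := IH q.+1.
rewrite (eq_bigr (fun i => wsq S (q + i.+1)%N)) => [|i _]; last by rewrite addSnnS.
move: (\sum_(_ <= _ < _) _) => W h.
have q0 : 0 < 2 ^+ q :> R by rewrite exprn_gt0.
have -> : 2 / 2 ^+ q * (wsq S q + W) =
    2 * (2 / 2 ^+ q.+1 * W) + 2 * normc (S q.+1 - S q) ^+ 2.
  by rewrite /wsq (exprS 2 q); field; exact: lt0r_neq0.
by lra.
Qed.

Lemma wsq_le S (g : R) n : (forall m, \sum_(0 <= i < m) wsq S i <= g) ->
  normc (S n) ^+ 2 <= 2 * normc (S 0%N) ^+ 2 + 4 * g.
Proof.
move=> hg; rewrite -(subrK (S 0%N) (S n)); apply: le_trans (sqr_normcD _ _) _.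
have h : normc (S n - S 0%N) ^+ 2 <= 2 * \sum_(0 <= i < n) wsq S i.
  by have := wsq_dist S n 0; rewrite expr0 divr1.
by have := hg n; lra.
Qed.

Lemma wsq_cvg S (g : R) : (forall m, \sum_(0 <= i < m) wsq S i <= g) ->
  exists l, ccvg S l.
Proof.
move=> hg; have g0 : 0 <= g by have := hg 0%N; rewrite big_geq.
apply: ccvg_cauchy => e e0.
have h : (2 * g) * (2^-1) ^+ n @[n --> \oo] --> (2 * g * 0 : R).
  by apply: cvgM; [exact: cvg_cst|apply: cvg_expr; rewrite ger0_norm; lra].
rewrite mulr0 in h.
have : \forall n \near \oo, (2 * g) * (2^-1) ^+ n < e ^+ 2.
  by apply: (cvgr_lt _ h); rewrite exprn_gt0.
case=> n _ hn; exists n.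
have key p q : (n <= q)%N -> (q <= p)%N -> normc (S p - S q) <= e.
  move=> nq qp; rewrite -(@ler_pXn2r _ 2) ?nnegrE ?normc_ge0 ?(ltW e0) //.
  rewrite -(subnKC qp); apply: le_trans (wsq_dist _ _ _) _.
  apply: le_trans (ltW (hn q nq)); rewrite exprVn [2 * g * _]mulrAC.
  rewrite ler_wpM2l ?divr_ge0 ?exprn_ge0 //.
  apply: le_trans (hg (q + (p - q))%N).
  rewrite [leRHS](@big_cat_nat _ _ _ q) ?leq_addr //= -[leLHS]add0r lerD //.
    by apply: sumr_ge0 => i _; exact: wsq_ge0.
  have := big_addn 0 (q + (p - q)) q xpredT (wsq S); rewrite add0n addKn => ->.
  by apply: ler_sum => i _; rewrite addnC.
move=> p q np nq; case: (leqP p q) => pq; last exact/key/ltnW.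
by rewrite normcBC; exact: key.
Qed.

Section FastSequence.
Variables (S : nat -> R -> R[i]) (M : R).
Hypothesis cS : forall j, csq (S j).
Hypothesis pS : forall j, periodic (S j).
Hypothesis dS : forall j,
  \int[mu]_(x in Iper) (normc (S j.+1 x - S j x) ^+ 2) <= M / 4 ^+ j.

Let G x := (\sum_(j <oo) (wsq (S^~ x) j)%:E)%E.

Let G0 x : (0 <= G x)%E.
Proof. by apply: nneseries_ge0 => j _ _; rewrite lee_fin wsq_ge0. Qed.

Let M0 : 0 <= M.
Proof.
have := dS 0; rewrite expr0 divr1; apply: le_trans.
by apply: Rintegral_ge0 => x _; exact: sqr_ge0.
Qed.

Let Lwsq j : Lint (fun x => wsq (S^~ x) j).
Proof. by apply: LintZ; case: (csqB (cS j.+1) (cS j)). Qed.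

Let mG : measurable_fun (T := measurableTypeR R) Iper G.
Proof.
apply: (@ge0_emeasurable_sum _ _ _ _ (fun j x => (wsq (S^~ x) j)%:E) xpredT).
  by move=> j x _ _; rewrite lee_fin wsq_ge0.
by move=> j _; apply/measurable_EFinP; exact: Lint_meas (Lwsq j).
Qed.

Let intG : (\int[mu]_(x in Iper) G x <= (2 * M)%:E)%E.
Proof.
rewrite integral_nneseries; last 3 first.
- exact: measurable_Iper.
- by move=> j; apply/measurable_EFinP; exact: Lint_meas (Lwsq j).
- by move=> j x _; rewrite lee_fin wsq_ge0.
(* 2^j M / 4^j = 2M / 2^(j+1), a geometric series of sum 2M. *)
apply: le_trans (epsilon_trick0 xpredT _); last by rewrite mulr_ge0.
apply: lee_nneseries => [j _ _|j _].
  by apply: integral_ge0 => x _; rewrite lee_fin wsq_ge0.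
rewrite -[leLHS]fineK; last first.
  exact (integrable_fin_num measurable_Iper (Lwsq j)).
rewrite lee_fin -/(Rintegral _ _ _) RintegralZl; last 2 first.
- exact: measurable_Iper.
- by case: (csqB (cS j.+1) (cS j)).
apply: le_trans (ler_wpM2l _ (dS j)) _; first exact: exprn_ge0.
rewrite natrX (_ : (4 : R) = 2 * 2) ?exprMn ?exprS; last by ring.
by rewrite le_eqVlt; apply/orP; left; apply/eqP; field; rewrite lt0r_neq0 ?exprn_gt0.
Qed.

Let iG : mu.-integrable Iper G.
Proof.
apply/integrableP; split=> //.
under eq_integral do rewrite gee0_abs //.
exact: le_lt_trans intG (ltry _).
Qed.

Let LG : Lint (fun x => fine (G x)).
Proof.
apply/integrableP; split.
  by apply/measurable_EFinP; apply: measurableT_comp.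
apply: le_lt_trans (le_lt_trans intG (ltry _)); apply: ge0_le_integral => //.
- exact: measurable_Iper.
- by apply/measurable_EFinP; do 2 apply: measurableT_comp => //.
- by move=> x _; rewrite /= ger0_norm ?fine_ge0 //; case: (G x) (G0 x).
Qed.

Let sumG x m : G x \is a fin_num -> \sum_(0 <= i < m) wsq (S^~ x) i <= fine (G x).
Proof.
move=> Gx; rewrite -lee_fin fineK // -sumEFin.
by apply: nneseries_lim_ge => j _ _; rewrite lee_fin wsq_ge0.
Qed.

Let Gp x : G (x + 2 * pi) = G x.
Proof. by rewrite /G; apply: eq_eseriesr => j _; rewrite /wsq !pS. Qed.

(** [G] is periodic on the whole line, so the case distinction on its finiteness makes [f] exactly
    periodic, not only up to a null set. The value 0 is the default where [G] is infinite. *)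
Let f x : R[i] := if G x \is a fin_num then xget 0 (fun l => ccvg (S^~ x) l) else 0.

Let A : set (measurableTypeR R) := Iper `&` [set x | G x \is a fin_num].

Let mA : measurable A.
Proof. exact: emeasurable_fin_num measurable_Iper mG. Qed.

(** Cutting off where [G] is infinite makes the sequence converge at every point of the period,
    which yields the measurability of [f]. *)
Let S' j x := S j x * (\1_A x)%:C.

Let f_cvg x : G x \is a fin_num -> ccvg (S^~ x) (f x).
Proof.
move=> Gx; rewrite /f Gx; have [l Sl] := wsq_cvg (fun m => sumG m Gx).
by case: xgetP => [y _ //|/(_ l)].
Qed.

Let S'_cvg x : Iper x -> ccvg (S'^~ x) (f x).
Proof.
move=> Ix; rewrite /S' indicE; case: (boolP (G x \is a fin_num)) => Gx.
  rewrite mem_set //; apply: ccvg_ext (f_cvg Gx) => n; by rewrite mulr1.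
rewrite memNset; last by move=> [_] /=; apply/negP.
by rewrite /f (negbTE Gx); apply: ccvg_ext (ccvg_cst 0) => n; rewrite mulr0.
Qed.

Let mS' j : cmeas (S' j).
Proof.
apply: cmeasM; first by case: (cS j).
split; first by apply: measurable_funTS; exact: measurable_indic.
exact: measurable_cst.
Qed.

Let S'_le j x : Iper x ->
  normc (S' j x) ^+ 2 <= 2 * normc (S 0%N x) ^+ 2 + 4 * fine (G x).
Proof.
move=> Ix; rewrite /S' indicE; case: (boolP (G x \is a fin_num)) => Gx.
  by rewrite mem_set // mulr1; exact: wsq_le (fun m => sumG m Gx).
rewrite memNset; last by move=> [_] /=; apply/negP.
rewrite mulr0 normc0 expr0n /=.
by have := fine_ge0 (G0 x); have := sqr_ge0 (normc (S 0%N x)); lra.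
Qed.

Let LG2 : Lint (fun x => 2 * normc (S 0%N x) ^+ 2 + 4 * fine (G x)).
Proof. by apply: LintD; apply: LintZ => //; case: (cS 0). Qed.

(** Convergence is stated against bounded functions: exponentials, to read off coefficients, and
    smooth test functions, to identify weak derivatives. *)
Lemma fast_L2_limit : exists u, L2per u /\ forall v B, cmeas v ->
  (forall x, Iper x -> normc (v x) <= B) ->
  ccvg (fun j => cintegral (fun x => S j x * v x)) (cintegral (fun x => u x * v x)).
Proof.
have mf : cmeas f := cmeas_cvg mS' S'_cvg.
exists f; split.
  apply/L2perP; split.
    move=> x; rewrite /f Gp; case: ifP => // _; congr xget; apply/funext => l.
    by under eq_fun do rewrite pS.
  split=> //; apply: (Lint_dom _ LG2).
    by have m := cmeas_normc mf; exact: mfunM.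
  move=> x Ix; rewrite ger0_norm ?sqr_ge0 //.
  have h := ccvg_normc (S'_cvg Ix).
  by apply: (cvgr_to_le (cvgM h h)); apply: nearW => j; exact: S'_le.
move=> v B mv vB.
have [|||||_] := @dominated_cintegral _ (fun j x => S' j x * v x)
  (fun x => f x * v x)
  (fun x => B * (1 + (2 * normc (S 0%N x) ^+ 2 + 4 * fine (G x)))).
- by move=> j; exact: cmeasM.
- exact: cmeasM.
- by apply: LintZ; apply: LintD => //; exact: Lint_cst.
- move=> j x Ix; rewrite normcM mulrC; apply: ler_pM; rewrite ?normc_ge0 ?vB //.
  apply: le_trans (_ : 1 + normc (S' j x) ^+ 2 <= _); last by rewrite lerD2l S'_le.
  by have := sqr_ge0 (normc (S' j x) - 1); nra.
- by apply: aeW => x Ix; apply: ccvgM; [exact: S'_cvg|exact: ccvg_cst].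
(* [G] is integrable, hence finite almost everywhere, so the cut-off does not change the
   integrals. *)
apply: ccvg_ext => j; apply: eq_ae_cintegral.
- exact: cmeasM.
- by apply: cmeasM => //; case: (cS j).
apply: (ae_imp _ (integrable_ae measurable_Iper iG)) => x Gx Ix.
by rewrite /S' indicE mem_set ?mulr1 //; split=> //; exact: Gx.
Qed.

End FastSequence.

(** The cut-offs [h] are part of the conclusion because the weak derivative is later identified by
    integrating by parts in these very partial sums. *)
Theorem riesz_fischer c B : sumb (fun k => normc (c k) ^+ 2) B ->
  exists u (h : nat -> nat), [/\ L2per u, forall k, fourier u k = c k,
    forall j, (j <= h j)%N &
    forall v B, cmeas v -> (forall x, Iper x -> normc (v x) <= B) ->
    ccvg (fun j => cintegral (fun x => trigpoly (h j) c x * v x))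
         (cintegral (fun x => u x * v x))].
Proof.
move=> cB.
have c0 k : 0 <= normc (c k) ^+ 2 by exact: sqr_ge0.
have /choice[g hg] j : exists n, tail (fun k => normc (c k) ^+ 2) n (4^-1 ^+ j).
  by apply: (sumb_tail c0 cB); rewrite exprn_gt0 // invr_gt0.
(* Cumulative sums make [h] nondecreasing and at least [g], so consecutive partial sums differ by
   modes in the 4^-j tail; the summand j makes every mode eventually included. *)
pose h j := (\sum_(0 <= i < j.+1) g i + j)%N.
have gh j : (g j <= h j)%N.
  by rewrite /h big_nat_recr //=; lia.
have hS j : (h j <= h j.+1)%N.
  by rewrite /h [in leqRHS]big_nat_recr //=; lia.
have hj j : (j <= h j)%N by rewrite /h leq_addl.
have [|||u [Lu uh]] := @fast_L2_limit (fun j => trigpoly (h j) c) (2 * pi).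
- by move=> j; exact: csq_trigpoly.
- by move=> j; exact: trigpoly_periodic.
- move=> j; pose d k := if (`|k| <= h j)%N then 0 else c k.
  have -> : (fun x => normc (trigpoly (h j.+1) c x - trigpoly (h j) c x) ^+ 2) =
      fun x => normc (trigpoly (h j.+1) d x) ^+ 2.
    apply/funext => x; congr (normc _ ^+ 2); rewrite !trigpolyE.
    rewrite (sum_zr_split _ (zr_uniq _) (zr_subset (hS j))) addrAC subrr add0r.
    rewrite [RHS](sum_zr_split _ (zr_uniq _) (zr_subset (hS j))).
    rewrite (_ : \sum_(k <- zr (h j)) d k * expi k x = 0); last first.
      rewrite big_seq big1 // => k.
      by rewrite mem_zr /d => ->; rewrite mul0r.
    rewrite add0r big_seq [RHS]big_seq; apply: eq_bigr => k.
    by rewrite mem_filter ltnNge /d => /andP[/negbTE ->].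
  rewrite parseval_trigpoly ler_wpM2l ?mulr_ge0 ?pi_ge0 //.
  rewrite (sum_zr_split _ (zr_uniq _) (zr_subset (hS j))).
  rewrite (_ : \sum_(k <- zr (h j)) normc (d k) ^+ 2 = 0); last first.
    rewrite big_seq big1 // => k.
    by rewrite mem_zr /d => ->; rewrite normc0 expr0n.
  rewrite add0r big_seq (eq_bigr (fun k => normc (c k) ^+ 2)) => [|k]; last first.
    by rewrite mem_filter ltnNge /d => /andP[/negbTE ->].
  rewrite -big_seq.
  rewrite -exprVn; apply: (tail_leq (gh j) (hg j)); first exact/filter_uniq/zr_uniq.
  by move=> k; rewrite mem_filter => /andP[].
exists u, h; split=> // k.
have h1 x : Iper x -> normc (expi (- k) x) <= 1 by rewrite normc_expi.
have := uh _ 1 (cmeas_expi (- k)) h1.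
move=> /(ccvgZ ((2 * pi)^-1)%:C); move=> h2; apply: ccvg_unique h2 _.
apply/cvgrPdist_le => e e0; near=> j.
have kj : (`|k| <= h j)%N.
  by apply: leq_trans (hj j); near: j; exact: nbhs_infty_ge.
rewrite -/(fourier (trigpoly (h j) c) k) fourier_trigpoly kj.
by rewrite subrr normc0 subrr normr0 ltW.
Unshelve. all: by end_near. Qed.

End RieszFischer.

(** * The spaces H^alpha on the Fourier side *)

Section SequenceSpace.
Context {R : realType}.
Implicit Types (a b : int -> R) (c d e : int -> R[i]) (s : seq int) (A B : R).

(** By induction: from S^2 <= PQ the cross term satisfies 2 S p q <= P q^2 + Q p^2, an
    arithmetic-geometric mean inequality. *)
Lemma cauchy_schwarz (J : Type) (s : seq J) (w x y : J -> R) :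
  (forall j, 0 <= w j) ->
  (\sum_(j <- s) w j * (x j * y j)) ^+ 2 <=
  (\sum_(j <- s) w j * x j ^+ 2) * (\sum_(j <- s) w j * y j ^+ 2).
Proof.
move=> w0; elim: s => [|j s IH]; first by rewrite !big_nil expr0n /= mul0r.
rewrite !big_cons.
have P0 : 0 <= \sum_(j <- s) w j * x j ^+ 2.
  by apply: sumr_ge0 => i _; rewrite mulr_ge0 ?sqr_ge0.
have Q0 : 0 <= \sum_(j <- s) w j * y j ^+ 2.
  by apply: sumr_ge0 => i _; rewrite mulr_ge0 ?sqr_ge0.
move: (\sum_(j <- s) w j * (x j * y j)) IH => S.
move: (\sum_(j <- s) w j * x j ^+ 2) (\sum_(j <- s) w j * y j ^+ 2) P0 Q0.
move=> P Q P0 Q0 IH; move: (w j) (x j) (y j) (w0 j) => v p q v0.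
suff h : 2 * (S * (p * q)) <= P * q ^+ 2 + Q * p ^+ 2.
  rewrite -subr_ge0 in h; rewrite -subr_ge0 in IH.
  rewrite -subr_ge0 (_ : _ - _ = v * (P * q ^+ 2 + Q * p ^+ 2 - 2 * (S * (p * q))) +
    (P * Q - S ^+ 2)); last by ring.
  by rewrite addr_ge0 // mulr_ge0.
have r0 : 0 <= P * q ^+ 2 + Q * p ^+ 2.
  by rewrite addr_ge0 ?(sqr_ge0, mulr_ge0).
apply: le_trans (ler_norm _) _.
rewrite -(@ler_pXn2r _ 2) ?nnegrE ?normr_ge0 // real_normK ?num_real //.
apply: (@le_trans _ _ (4 * (P * Q) * (p * q) ^+ 2)).
  rewrite (_ : (2 * (S * (p * q))) ^+ 2 = 4 * S ^+ 2 * (p * q) ^+ 2); last by ring.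
  by rewrite ler_wpM2r ?sqr_ge0 // ler_wpM2l.
have := sqr_ge0 (P * q ^+ 2 - Q * p ^+ 2).
rewrite -subr_ge0 => h; rewrite -subr_ge0; apply: le_trans h _.
by rewrite le_eqVlt; apply/orP; left; apply/eqP; ring.
Qed.

Lemma cvg_rsum (T J : Type) (F : set_system T) (FF : Filter F) (s : seq J)
    (f : J -> T -> R) (l : J -> R) : (forall j, f j t @[t --> F] --> l j) ->
  \sum_(j <- s) f j t @[t --> F] --> \sum_(j <- s) l j.
Proof.
move=> fl; elim: s => [|j s IH].
  by rewrite big_nil; under eq_fun do rewrite big_nil; exact: cvg_cst.
by rewrite big_cons; under eq_fun do rewrite big_cons; exact: cvgD.
Qed.

Definition wt (alpha : R) (k : int) : R := (1 + `|k%:~R| ^+ 2) `^ alpha.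

(* [c] is the coefficient sequence of a function of H^alpha norm at most [A]. Testing on
   duplicate-free lists of modes keeps all the estimates to finite real sums. *)
Definition Yb alpha c A :=
  0 <= A /\ sumb (fun k => wt alpha k * normc (c k) ^+ 2) (A ^+ 2).

Lemma wt_ge0 alpha k : 0 <= wt alpha k.
Proof. exact: powR_ge0. Qed.

Lemma base_ge1 k : 1 <= 1 + `|k%:~R| ^+ 2 :> R.
Proof. by rewrite lerDl sqr_ge0. Qed.

Lemma wt_ge1 alpha k : 0 <= alpha -> 1 <= wt alpha k.
Proof.
by move=> a0; have := ler_powR (base_ge1 k) a0; rewrite powRr0.
Qed.

Lemma Yb_ext alpha c d A : (forall k, c k = d k) -> Yb alpha c A -> Yb alpha d A.
Proof. by move=> /funext ->. Qed.

Lemma Yb_mono alpha c d A : (forall k, normc (d k) <= normc (c k)) ->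
  Yb alpha c A -> Yb alpha d A.
Proof.
move=> dc [A0 cA]; split=> //; apply: sumb_le cA => k.
by rewrite ler_wpM2l ?wt_ge0 // lerXn2r ?nnegrE ?normc_ge0.
Qed.

Lemma Yb_le alpha c A B : A <= B -> Yb alpha c A -> Yb alpha c B.
Proof.
move=> AB [A0 cA]; split; first exact: le_trans AB.
move=> s us; apply: le_trans (cA s us) _.
by rewrite lerXn2r ?nnegrE // (le_trans A0).
Qed.

Lemma YbD alpha c d A B : Yb alpha c A -> Yb alpha d B ->
  Yb alpha (fun k => c k + d k) (A + B).
Proof.
move=> [A0 cA] [B0 dB]; split; first exact: addr_ge0.
move=> s us; have hc := cA s us; have hd := dB s us.
have w0 := @wt_ge0 alpha.
have cs := cauchy_schwarz s (fun k => normc (c k)) (fun k => normc (d k)) w0.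
apply: (@le_trans _ _ (\sum_(k <- s) wt alpha k * normc (c k) ^+ 2 +
   2 * (\sum_(k <- s) wt alpha k * (normc (c k) * normc (d k))) +
   \sum_(k <- s) wt alpha k * normc (d k) ^+ 2)).
  rewrite mulr_sumr -!big_split /=; apply: ler_sum => k _.
  have xyz := normcD (c k) (d k); have z0 := normc_ge0 (c k + d k).
  have v0 := w0 k.
  move: (normc (c k + d k)) (normc (c k)) (normc (d k)) z0 xyz => z x y z0 xyz.
  have : z ^+ 2 <= (x + y) ^+ 2 by rewrite lerXn2r ?nnegrE // (le_trans z0).
  by move=> /(ler_wpM2l v0); nra.
have : \sum_(k <- s) wt alpha k * (normc (c k) * normc (d k)) <= A * B.
  apply: le_trans (ler_norm _) _.
  rewrite -(@ler_pXn2r _ 2) ?nnegrE ?normr_ge0 ?mulr_ge0 // real_normK ?num_real //.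
  apply: le_trans cs _; rewrite exprMn; apply: ler_pM => //;
    by apply: sumr_ge0 => k _; rewrite mulr_ge0 ?sqr_ge0.
by lra.
Qed.

Lemma YbN alpha c A : Yb alpha c A -> Yb alpha (fun k => - c k) A.
Proof. by apply: Yb_mono => k; rewrite normcN. Qed.

Lemma YbB alpha c d A B : Yb alpha c A -> Yb alpha d B ->
  Yb alpha (fun k => c k - d k) (A + B).
Proof. by move=> cA dB; apply: YbD => //; exact: YbN. Qed.

Lemma YbZ alpha (z : R[i]) c A : Yb alpha c A ->
  Yb alpha (fun k => z * c k) (normc z * A).
Proof.
move=> [A0 cA]; split; first by rewrite mulr_ge0 ?normc_ge0.
move=> s us; rewrite exprMn; apply: le_trans (ler_wpM2l _ (cA s us)).
  by rewrite mulr_sumr; apply: ler_sum => k _; rewrite normcM exprMn mulrCA.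
exact: sqr_ge0.
Qed.

Lemma Yb_coef alpha c A k : 0 <= alpha -> Yb alpha c A -> normc (c k) <= A.
Proof.
move=> a0 [A0 cA]; rewrite -(@ler_pXn2r _ 2) ?nnegrE ?normc_ge0 //.
apply: le_trans (cA [:: k] isT); rewrite big_seq1.
by rewrite ler_peMl ?sqr_ge0 // wt_ge1.
Qed.

(** Fatou's lemma in this setting: each finite sum passes to the limit. Every bound uniform in N is
    transferred to the limit in this way. *)
Lemma Yb_closed alpha (cn : nat -> int -> R[i]) c A :
  (forall k, ccvg (cn^~ k) (c k)) -> (\forall n \near \oo, Yb alpha (cn n) A) ->
  Yb alpha c A.
Proof.
move=> cnc cA.
have A0 : 0 <= A by have [N _ /(_ N (leqnn N))[]] := cA.
split=> // s us.
have h : \sum_(k <- s) wt alpha k * normc (cn n k) ^+ 2 @[n --> \oo] -->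
    \sum_(k <- s) wt alpha k * normc (c k) ^+ 2.
  apply: cvg_rsum => k; apply: cvgM; first exact: cvg_cst.
  by have h := ccvg_normc (cnc k); exact: cvgM.
apply: (cvgr_to_le h); near=> n.
suff [_ /(_ s us)] : Yb alpha (cn n) A by [].
by near: n.
Unshelve. all: by end_near. Qed.

Lemma sum_sub a s t : (forall k, 0 <= a k) -> uniq s -> uniq t ->
  {subset s <= t} -> \sum_(k <- s) a k <= \sum_(k <- t) a k.
Proof.
move=> a0 us ut st; rewrite [leRHS](bigID (mem s)) /= -[leLHS]addr0.
apply: lerD; last exact: sumr_ge0.
rewrite -(big_filter t) le_eqVlt; apply/orP; left; apply/eqP; apply: perm_big.
apply: uniq_perm => //; first exact: filter_uniq.
by move=> k; rewrite mem_filter; apply/esym/andb_idr; exact: st.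
Qed.

Lemma sumb_zr a B : (forall k, 0 <= a k) ->
  (forall n, \sum_(k <- zr n) a k <= B) -> sumb a B.
Proof.
move=> a0 h s us; pose n := (\max_(k <- s) `|k|%N)%N.
apply: le_trans (h n); apply: sum_sub => //; first exact: zr_uniq.
move=> k ks; rewrite mem_zr.
exact: (@leq_bigmax_seq _ _ xpredT (fun i : int => absz i) k ks isT).
Qed.

Lemma perm_zrS n : perm_eq (zr n.+1) (n.+1%:Z :: - n.+1%:Z :: zr n).
Proof.
apply: uniq_perm; first exact: zr_uniq.
  by rewrite cons_uniq in_cons cons_uniq !mem_zr zr_uniq; lia.
by move=> k; rewrite mem_zr in_cons in_cons mem_zr; lia.
Qed.

Lemma sumb_inv_sqr : sumb (fun k => (1 + `|k%:~R| ^+ 2)^-1) (5 : R).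
Proof.
apply: sumb_zr => [k|n].
  by rewrite invr_ge0 (le_trans _ (base_ge1 k)).
(* A telescoping majorant: it equals 1 at n = 0, and the two modes of modulus m + 1 add 2 / (1 +
   (m+1)^2) <= 4/(m+1) - 4/(m+2). *)
apply: (@le_trans _ _ (5 - 4 / n.+1%:R)); last first.
  by rewrite lerBlDr lerDl divr_ge0.
elim: n => [|n IH].
  by rewrite big_map big_seq1 subrr normr0 expr0n /= addr0 invr1; lra.
rewrite (perm_big _ (perm_zrS n)) big_cons big_cons.
move: (\sum_(k <- zr n) _) IH => S IH.
rewrite intrN normrN.
have -> : `|(n.+1%:Z)%:~R : R| = n.+1%:R by rewrite ger0_norm.
have n0 : (0 : R) <= n%:R by [].
rewrite -[n.+2%:R]natr1 -[n.+1%:R]natr1.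
rewrite -[n.+1%:R]natr1 in IH; move: (n%:R : R) n0 IH => m n0 IH.
rewrite /=.
suff : (1 + (m + 1) ^+ 2)^-1 <= 2 / (m + 1) - 2 / (m + 1 + 1) by lra.
have -> : 2 / (m + 1) - 2 / (m + 1 + 1) = ((m + 1) * (m + 1 + 1) / 2)^-1.
  by field; rewrite !lt0r_neq0 //; lra.
by rewrite lef_pV2 ?posrE; nra.
Qed.

(** Sobolev embedding into absolutely convergent series: Cauchy-Schwarz against 1/wt, whose sum is
    at most that of 1/(1 + k^2), thus at most 5 <= 3^2. *)
Lemma Yb_l1 alpha c A : 1 <= alpha -> Yb alpha c A ->
  sumb (fun k => normc (c k)) (3 * A).
Proof.
move=> a1 [A0 cA] s us.
have wp k : 0 < wt alpha k by apply: lt_le_trans (wt_ge1 k _) => //; lra.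
have w0 k := ltW (wp k).
have cs := cauchy_schwarz s (fun k => normc (c k)) (fun k => (wt alpha k)^-1) w0.
have S0 : 0 <= \sum_(k <- s) normc (c k) by apply: sumr_ge0 => k _; exact: normc_ge0.
rewrite -(@ler_pXn2r _ 2) ?nnegrE ?mulr_ge0 //.
have -> : \sum_(k <- s) normc (c k) =
    \sum_(k <- s) wt alpha k * (normc (c k) * (wt alpha k)^-1).
  by apply: eq_bigr => k _; rewrite mulrCA mulfV ?mulr1 // lt0r_neq0.
apply: le_trans cs _; rewrite exprMn mulrC; apply: ler_pM => //.
- by apply: sumr_ge0 => k _; rewrite mulr_ge0 ?sqr_ge0.
- by apply: sumr_ge0 => k _; rewrite mulr_ge0 ?sqr_ge0.
- apply: (@le_trans _ _ 5); last lra.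
  apply: le_trans (sumb_inv_sqr us); apply: ler_sum => k _.
  rewrite expr2 mulrA mulfV ?lt0r_neq0 // mul1r.
  have b0 : 0 < 1 + `|k%:~R| ^+ 2 :> R := lt_le_trans ltr01 (base_ge1 k).
  rewrite lef_pV2 ?posrE // -[leLHS]powRr1 ?(ltW b0) //.
  exact: ler_powR (base_ge1 k) _ _ a1.
- exact: cA.
Qed.

End SequenceSpace.

(** * H^alpha is an algebra *)

Section Convolution.
Context {R : realType}.
Implicit Types (a b : int -> R) (c d e : int -> R[i]) (s t : seq int) (A B P Q alpha : R).

(** 1 + (j+k)^2 is at most 4 times the larger of 1 + j^2 and 1 + k^2, and 4^alpha <= 16 for alpha <=
    2. *)
Lemma wtD alpha (j k : int) : 0 <= alpha <= 2 ->
  wt alpha (j + k) <= 16 * (wt alpha j + wt alpha k).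
Proof.
move=> /andP[a0 a2].
pose f (i : int) : R := 1 + `|i%:~R| ^+ 2.
have f0 i : 0 <= f i by rewrite addr_ge0 ?sqr_ge0.
have fD : f (j + k) <= 2 * (f j + f k).
  rewrite /f !real_normK ?num_real // intrD.
  by have := sqr_ge0 (j%:~R - k%:~R : R); nra.
have p4 : 4 `^ alpha <= 16 :> R.
  apply: le_trans (_ : 4 `^ 2%:R <= _); first by apply: ler_powR => //; lra.
  by rewrite powR_mulrn //; lra.
have key (m : R) : 0 <= m -> f (j + k) <= 4 * m -> wt alpha (j + k) <= 16 * m `^ alpha.
  move=> m0 h; apply: (@le_trans _ _ ((4 * m) `^ alpha)).
    by apply: ge0_ler_powR; rewrite ?nnegrE ?mulr_ge0 //.
  by rewrite powRM // ler_wpM2r ?powR_ge0.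
have [jk|kj] := leP (f j) (f k).
  apply: le_trans (key (f k) (f0 k) _) _; first by lra.
  by rewrite ler_pM2l // lerDr powR_ge0.
apply: le_trans (key (f j) (f0 j) _) _; first by lra.
by rewrite ler_pM2l // lerDl powR_ge0.
Qed.

Lemma sqrt_wtD alpha (j k : int) : 0 <= alpha <= 2 ->
  Num.sqrt (wt alpha (j + k)) <=
  4 * (Num.sqrt (wt alpha j) + Num.sqrt (wt alpha k)).
Proof.
move=> ha; have h := wtD j k ha.
rewrite -(@ler_pXn2r _ 2) ?nnegrE ?mulr_ge0 ?addr_ge0 ?sqrtr_ge0 //.
rewrite sqr_sqrtr ?wt_ge0 //; apply: le_trans h _.
have := sqr_sqrtr (wt_ge0 alpha j); have := sqr_sqrtr (wt_ge0 alpha k).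
have := sqrtr_ge0 (wt alpha j); have := sqrtr_ge0 (wt alpha k).
by move: (Num.sqrt _) (Num.sqrt _) => x y; nra.
Qed.

Lemma sumb_shift a P s k : sumb a P -> uniq s -> \sum_(j <- s) a (j - k) <= P.
Proof.
move=> aP us; rewrite -(big_map (fun j => j - k) xpredT a); apply: aP.
by rewrite map_inj_uniq // => x y /addIr.
Qed.

Lemma sumb_rshift a P s k : sumb a P -> uniq s -> \sum_(j <- s) a (k - j) <= P.
Proof.
move=> aP us; rewrite -(big_map (fun j => k - j) xpredT a); apply: aP.
by rewrite map_inj_uniq // => x y /addrI /oppr_inj.
Qed.

(** Young's inequality for l^1 * l^2, with the inner sum over a finite list: Cauchy-Schwarz with
    weight [a], then exchange of the sums. In [young_sym] the summable factor carries the shifted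
    index. *)
Lemma young a b P Q s t : (forall k, 0 <= a k) -> sumb a P ->
  sumb (fun k => b k ^+ 2) Q -> uniq s -> uniq t ->
  \sum_(k <- s) (\sum_(j <- t) a j * b (k - j)) ^+ 2 <= P ^+ 2 * Q.
Proof.
move=> a0 aP bQ us ut; have P0 := sumb_ge0 aP; have Q0 := sumb_ge0 bQ.
apply: (@le_trans _ _ (\sum_(k <- s) P * \sum_(j <- t) a j * b (k - j) ^+ 2)).
  apply: ler_sum => k _.
  have := cauchy_schwarz t (fun=> 1) (fun j => b (k - j)) a0.
  under eq_bigr do rewrite mul1r; move=> h; apply: le_trans h _.
  apply: ler_wpM2r; first by apply: sumr_ge0 => j _; rewrite mulr_ge0 ?sqr_ge0.
  by under eq_bigr do rewrite expr1n mulr1; exact: aP.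
rewrite -mulr_sumr expr2 -mulrA ler_wpM2l // exchange_big /=.
apply: (@le_trans _ _ (\sum_(j <- t) a j * Q)).
  apply: ler_sum => j _; rewrite -mulr_sumr ler_wpM2l //.
  exact: (sumb_shift (a := fun k => b k ^+ 2)).
by rewrite -mulr_suml ler_wpM2r // aP.
Qed.

Lemma young_sym a b P Q s t : (forall k, 0 <= a k) -> sumb a P ->
  sumb (fun k => b k ^+ 2) Q -> uniq s -> uniq t ->
  \sum_(k <- s) (\sum_(j <- t) b j * a (k - j)) ^+ 2 <= P ^+ 2 * Q.
Proof.
move=> a0 aP bQ us ut; have P0 := sumb_ge0 aP; have Q0 := sumb_ge0 bQ.
apply: (@le_trans _ _ (\sum_(k <- s) P * \sum_(j <- t) a (k - j) * b j ^+ 2)).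
  apply: ler_sum => k _.
  have := @cauchy_schwarz _ _ t (fun j => a (k - j)) (fun=> 1) b (fun j => a0 (k - j)).
  under eq_bigr do rewrite mul1r mulrC; move=> h; apply: le_trans h _.
  apply: ler_wpM2r; first by apply: sumr_ge0 => j _; rewrite mulr_ge0 ?sqr_ge0.
  by under eq_bigr do rewrite expr1n mulr1; exact: sumb_rshift.
rewrite -mulr_sumr expr2 -mulrA ler_wpM2l // exchange_big /=.
apply: (@le_trans _ _ (\sum_(j <- t) P * b j ^+ 2)).
  apply: ler_sum => j _; rewrite -mulr_suml ler_wpM2r ?sqr_ge0 //.
  exact: sumb_shift.
by rewrite -mulr_sumr ler_wpM2l // bQ.
Qed.

(** The square root of the weight is split between the two factors by [sqrt_wtD]; in each half the
    unweighted factor is in l^1 with norm 3A or 3B. The constant is 24^2 = 2 * 32 * 3^2, where 32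
    comes from (4X + 4Y)^2 <= 32 X^2 + 32 Y^2. *)
Lemma Yb_conv alpha c d A B n : 1 <= alpha <= 2 -> Yb alpha c A -> Yb alpha d B ->
  Yb alpha (fun k => \sum_(j <- zr n) c j * d (k - j)) (24 * (A * B)).
Proof.
move=> ha cA dB; have ha1 : 1 <= alpha by lra.
have ha0 : 0 <= alpha <= 2 by lra.
have [A0 cA2] := cA; have [B0 dB2] := dB.
have c1 := Yb_l1 ha1 cA; have d1 := Yb_l1 ha1 dB.
pose rho k := Num.sqrt (wt alpha k : R).
have rho2 k : rho k ^+ 2 = wt alpha k by rewrite /rho sqr_sqrtr ?wt_ge0.
have rho0 k : 0 <= rho k by exact: sqrtr_ge0.
split; first by rewrite !mulr_ge0.
move=> s us.
pose X k := \sum_(j <- zr n) (rho j * normc (c j)) * normc (d (k - j)).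
pose Y k := \sum_(j <- zr n) normc (c j) * (rho (k - j) * normc (d (k - j))).
have hX : \sum_(k <- s) X k ^+ 2 <= (3 * B) ^+ 2 * A ^+ 2.
  apply: (@young_sym (fun k => normc (d k)) (fun k => rho k * normc (c k)) _ _ _ _
    (fun k => normc_ge0 (d k)) d1 _ us (zr_uniq n)).
  by apply: sumb_le cA2 => k; rewrite exprMn rho2.
have hY : \sum_(k <- s) Y k ^+ 2 <= (3 * A) ^+ 2 * B ^+ 2.
  apply: (@young (fun k => normc (c k)) (fun k => rho k * normc (d k)) _ _ _ _
    (fun k => normc_ge0 (c k)) c1 _ us (zr_uniq n)).
  by apply: sumb_le dB2 => k; rewrite exprMn rho2.
apply: (@le_trans _ _ (\sum_(k <- s) (32 * X k ^+ 2 + 32 * Y k ^+ 2))).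
  apply: ler_sum => k _; rewrite -rho2 -exprMn.
  have X0 : 0 <= X k by apply: sumr_ge0 => j _; rewrite !mulr_ge0 ?normc_ge0.
  have Y0 : 0 <= Y k by apply: sumr_ge0 => j _; rewrite !mulr_ge0 ?normc_ge0.
  have : rho k * normc (\sum_(j <- zr n) c j * d (k - j)) <= 4 * X k + 4 * Y k.
    apply: le_trans (ler_wpM2l (rho0 k) (normc_sum _ _ _)) _.
    rewrite !mulr_sumr -big_split /=; apply: ler_sum => j _.
    rewrite normcM; have := sqrt_wtD j (k - j) ha0.
    rewrite (_ : j + (k - j) = k) -/(rho _) -/(rho _) -/(rho _); last by ring.
    have := mulr_ge0 (normc_ge0 (c j)) (normc_ge0 (d (k - j))).
    by move=> /[dup] p0 /ler_wpM2r /[apply]; lra.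
  have : 0 <= rho k * normc (\sum_(j <- zr n) c j * d (k - j)).
    by rewrite mulr_ge0 ?normc_ge0.
  move: (rho k * _) (X k) (Y k) X0 Y0 => z x y x0 y0 z0 zxy.
  have := sqr_ge0 (x - y).
  have : z ^+ 2 <= (4 * x + 4 * y) ^+ 2 by rewrite lerXn2r ?nnegrE // (le_trans z0).
  by nra.
rewrite big_split /= -!mulr_sumr.
rewrite (_ : (24 * (A * B)) ^+ 2 = 32 * ((3 * B) ^+ 2 * A ^+ 2) +
  32 * ((3 * A) ^+ 2 * B ^+ 2)); last by ring.
by apply: lerD; rewrite ler_pM2l.
Qed.

Lemma Yb_fserM alpha c d A B : 1 <= alpha <= 2 -> Yb alpha c A -> Yb alpha d B ->
  Yb alpha (fourier (fun x => fser c x * fser d x)) (24 * (A * B)).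
Proof.
move=> ha cA dB; have ha1 : 1 <= alpha by lra.
have c1 := Yb_l1 ha1 cA; have d1 := Yb_l1 ha1 dB.
have cd := L2per_cint (L2per_fser d1).
apply: (@Yb_closed _ _ (fun n k => \sum_(j <- zr n) c j * d (k - j))).
  move=> k; apply: ccvg_ext (fserM_fourier k c1 cd) => n.
  by apply: eq_bigr => j _; rewrite (fser_fourier _ d1).
by apply: nearW => n; exact: Yb_conv.
Qed.

(** The bridge between the extended-real norm of the statement and the finite sums of the proof; an
    [esum] is a supremum over finite sets. *)
Lemma Hnorm_leP alpha (u : R -> R[i]) A : 0 <= A ->
  (Hnorm alpha u <= A%:E)%E <-> Yb alpha (fourier u) A.
Proof.
move=> A0; rewrite /Hnorm.
set a := (fun k : int => _); set E := \esum_(_ in _) _.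
have E0 : (0 <= E)%E.
  by apply: esum_ge0 => k _; rewrite lee_fin mulr_ge0 ?powR_ge0 ?sqr_ge0.
have -> : (E `^ 2^-1 <= A%:E)%E <-> (E <= (A ^+ 2)%:E)%E.
  case: E E0 => [r| |] //; last first.
    by rewrite poweRyr ?invr_eq0 // !leye_eq.
  rewrite lee_fin => r0; rewrite poweR_EFin !lee_fin powR12_sqrt //.
  by rewrite -{1}(ger0_norm A0) -sqrtr_sqr ler_sqrt ?sqr_ge0.
split=> [EA|[_ h]].
  split=> // s us; rewrite -lee_fin; apply: le_trans EA.
  rewrite -sumEFin; apply: esum_ge; exists [set` s]; first by split=> //; exact: finite_seq.
  by rewrite -fsbig_seq.
apply: ge_ereal_sup => _ [F [finF _] <-].
rewrite fsbig_finite // sumEFin lee_fin; apply: h; exact: finmap.fset_uniq.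
Qed.

End Convolution.

(** * The equation on the Fourier side *)

Section Nonlinearity.
Context {R : realType}.
Variable alpha : R.
Hypothesis halpha : 1 <= alpha <= 2.
Implicit Types (u v : R -> R[i]) (k : int) (c d : int -> R[i]) (A B D : R).
Local Notation Yb := (Yb alpha).

Let alpha1 : 1 <= alpha. Proof. by case/andP: halpha. Qed.
Let alpha0 : 0 <= alpha. Proof. exact: le_trans ler01 alpha1. Qed.

Definition Hb A u := L2per u /\ Yb (fourier u) A.

Lemma Hb_fser A u : Hb A u -> eq_L2 u (fser (fourier u)).
Proof.
move=> [Lu uA]; have u1 := Yb_l1 alpha1 uA.
apply: fourier_inj; [exact: L2per_cint|exact/L2per_cint/(L2per_fser u1)|].
by move=> k; rewrite (fser_fourier _ u1).
Qed.

Lemma Hb_Hper A u : Hb A u -> Hper alpha u.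
Proof.
move=> [Lu uA]; split=> //; have A0 : 0 <= A by case: uA.
by apply: le_lt_trans (ltry A); apply/Hnorm_leP.
Qed.

Lemma Hnorm_ge0 u : (0 <= Hnorm alpha u)%E.
Proof. exact: poweR_ge0. Qed.

Lemma Hper_Hb u : Hper alpha u -> Hb (fine (Hnorm alpha u)) u.
Proof.
move=> [Lu uoo]; split=> //; apply/Hnorm_leP; first exact: fine_ge0 (Hnorm_ge0 u).
by rewrite fineK // ge0_fin_numE ?Hnorm_ge0.
Qed.

Lemma HbD A B u v : Hb A u -> Hb B v -> Hb (A + B) (fun x => u x + v x).
Proof.
move=> [Lu uA] [Lv vB]; split; first exact: L2perD.
by apply: Yb_ext (YbD uA vB) => k; rewrite fourierD //; exact: L2per_cint.
Qed.

Lemma Hb_fserE c A : Yb c A -> Hb A (fser c).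
Proof.
move=> cA; have c1 := Yb_l1 alpha1 cA; split; first exact: L2per_fser c1.
by apply: Yb_ext cA => k; rewrite (fser_fourier _ c1).
Qed.

(** Coefficients depend only on classes modulo null sets, so both factors may be replaced by their
    Fourier series. *)
Lemma Hb_mul A B u v : Hb A u -> Hb B v ->
  Yb (fourier (fun x => u x * v x)) (24 * (A * B)).
Proof.
move=> Hu Hv; have [Lu uA] := Hu; have [Lv vB] := Hv.
have u1 := Yb_l1 alpha1 uA; have v1 := Yb_l1 alpha1 vB.
have [mu' _] := L2per_csq Lu; have [mv _] := L2per_csq Lv.
have mfu := fser_cmeas u1; have mfv := fser_cmeas v1.
apply: Yb_ext (Yb_fserM halpha uA vB) => k; apply: eq_ae_fourier.
- exact: cmeasM.
- exact: cmeasM.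
- by apply: (ae_imp2 _ (Hb_fser Hu) (Hb_fser Hv)) => x hu hv Ix; rewrite hu // hv.
Qed.

(** The symbol -ik / (1 + |k|^alpha) of -(1 + D^alpha)^(-1) d/dx. Its modulus is at most 1 because
    an integer is 0 or at least 1 in modulus, whence |k| <= |k|^alpha. *)
Definition sigma k : R[i] := 0 -i* (k%:~R / (1 + `|k%:~R| `^ alpha)).

Lemma abs_int_le k : `|k%:~R| <= `|k%:~R| `^ alpha :> R.
Proof.
have [->|k0] := eqVneq k 0; first by rewrite normr0 powR_ge0.
have k1 : 1 <= `|k%:~R| :> R.
  by rewrite -intr_norm -[1]/(1%:~R) ler_int; lia.
by apply: le_trans (ler_powR k1 alpha1); rewrite powRr1.
Qed.

Lemma normc_sigma k : normc (sigma k) <= 1.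
Proof.
rewrite normcE /= expr0n /= add0r sqrtr_sqr normrN normrM normfV.
have p0 : 0 <= `|k%:~R| `^ alpha :> R by exact: powR_ge0.
rewrite [`|1 + _|]ger0_norm ?addr_ge0 // ler_pdivrMr ?ltr_wpDr // mul1r.
by apply: le_trans (abs_int_le k) _; rewrite lerDr.
Qed.

(* the right-hand side of the equation solved for the Fourier coefficients of u_t *)
Definition NL u k : R[i] :=
  sigma k * (fourier u k + 2^-1 * fourier (fun x => u x * u x) k).

Lemma Yb_sigma c A : Yb c A -> Yb (fun k => sigma k * c k) A.
Proof.
apply: Yb_mono => k; rewrite normcM ler_piMl ?normc_ge0 //; exact: normc_sigma.
Qed.

Lemma normc_half : normc (2^-1 : R[i]) = 2^-1.
Proof.
have -> : (2^-1 : R[i]) = (2^-1 : R)%:C by rewrite fmorphV rmorph_nat.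
by rewrite normcR ger0_norm.
Qed.

Lemma YbZhalf c A : Yb c A -> Yb (fun k => 2^-1 * c k) (A / 2).
Proof. by move=> /(YbZ (2^-1)); rewrite normc_half mulrC. Qed.

Lemma cint_mul A B u v : Hb A u -> Hb B v -> cint (fun x => u x * v x).
Proof.
by move=> [/L2per_csq cu _] [/L2per_csq cv _]; exact: csqM_cint.
Qed.

Lemma fourier_sqB A B u v k : Hb A u -> Hb B v ->
  fourier (fun x => u x * u x) k - fourier (fun x => v x * v x) k =
  fourier (fun x => (u x - v x) * (u x + v x)) k.
Proof.
move=> Hu Hv; rewrite -fourierB; [|exact: (cint_mul Hu Hu)|exact: (cint_mul Hv Hv)].
by congr (fourier _ k); apply/funext => x; ring.
Qed.

(** From u^2 - v^2 = (u - v)(u + v) and the algebra constant: D + 24 * D * 2A / 2. *)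
Lemma NL_lip A D u v : Hb A u -> Hb A v -> Yb (fun k => fourier u k - fourier v k) D ->
  Yb (fun k => NL u k - NL v k) ((1 + 24 * A) * D).
Proof.
move=> Hu Hv uvD; have [Lu uA] := Hu; have [Lv vA] := Hv.
have Huv : Hb D (fun x => u x - v x).
  split; first exact: L2perB.
  by apply: Yb_ext uvD => k; rewrite fourierB //; exact: L2per_cint.
have := Yb_sigma (YbD uvD (YbZhalf (Hb_mul Huv (HbD Hu Hv)))).
rewrite (_ : D + _ = (1 + 24 * A) * D); last by field.
apply: Yb_ext => k; rewrite -(fourier_sqB k Hu Hv) /NL; ring.
Qed.

Lemma NL_bound A u : Hb A u -> Yb (NL u) ((1 + 24 * A) * A).
Proof.
move=> Hu; have [Lu uA] := Hu; have A0 : 0 <= A by case: uA.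
apply: Yb_le (Yb_sigma (YbD uA (YbZhalf (Hb_mul Hu Hu)))).
by have := mulr_ge0 A0 A0; lra.
Qed.

Definition Qproj n c k : R[i] := if (`|k| <= n)%N then 0 else c k.

Lemma Yb_Qproj n c A : Yb c A -> Yb (Qproj n c) A.
Proof.
apply: Yb_mono => k; rewrite /Qproj; case: ifP => // _.
by rewrite normc0 normc_ge0.
Qed.

Lemma Yb_Qproj_leq m n c A : (m <= n)%N -> Yb (Qproj m c) A -> Yb (Qproj n c) A.
Proof.
move=> mn; apply: Yb_mono => k; rewrite /Qproj.
case: (leqP `|k| n) => kn; first by rewrite normc0 normc_ge0.
by rewrite ifF //; apply/negbTE; rewrite -ltnNge (leq_ltn_trans mn).
Qed.

Lemma Hb_trigpoly n A u : Hb A u -> Hb A (trigpoly n (fourier u)).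
Proof.
move=> [Lu uA]; split; first exact: L2per_trigpoly.
apply: Yb_mono uA => k; rewrite fourier_trigpoly; case: ifP => // _.
by rewrite normc0 normc_ge0.
Qed.

(** With p the truncation of u at n, u^2 and p^2 have the same gap as in the Lipschitz estimate,
    while p^2 has no mode above 2n. The tail of u thus plays the part of a difference of two
    functions. *)
Lemma NL_tail n A D u : Hb A u -> Yb (Qproj n (fourier u)) D ->
  Yb (Qproj n.*2 (NL u)) ((1 + 24 * A) * D).
Proof.
move=> Hu uD; have [Lu uA] := Hu; pose p := trigpoly n (fourier u).
have Hp : Hb A p := Hb_trigpoly n Hu; have [Lp _] := Hp.
have Hup : Hb D (fun x => u x - p x).
  split; first exact: L2perB.
  apply: Yb_ext uD => k; rewrite fourierB; [|exact: L2per_cint..].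
  by rewrite /p fourier_trigpoly /Qproj; case: ifP; rewrite ?subrr ?subr0.
have nn : (n <= n.*2)%N by rewrite -addnn leq_addr.
have := Yb_sigma (YbD (Yb_Qproj_leq nn uD)
  (YbZhalf (Yb_Qproj n.*2 (Hb_mul Hup (HbD Hu Hp))))).
rewrite (_ : D + _ = (1 + 24 * A) * D); last by field.
apply: Yb_ext => k; rewrite /Qproj; case: ifP => kn; first by rewrite mulr0 addr0 mulr0.
rewrite -(fourier_sqB k Hu Hp) [fourier (fun x => p x * p x) k](_ : _ = 0) ?subr0 //.
rewrite trigpolyM_fourier; last exact: L2per_cint.
rewrite big_seq big1 // => j; rewrite mem_zr => jn.
rewrite /p fourier_trigpoly ifF ?mulr0 //; apply/negbTE; move: kn jn; lia.
Qed.

End Nonlinearity.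

(** * Fourier coefficients of the Galerkin scheme and of weak derivatives *)

Section CoefficientEquations.
Context {R : realType}.
Variable alpha : R.
Hypothesis halpha : 1 <= alpha <= 2.
Implicit Types (u v w : R -> R[i]) (k : int) (c d : int -> R[i]) (A B D : R).
Local Notation mu := (@lebesgue_measure R).
Local Notation Iper := (@Iper R).
Local Notation Yb := (Yb alpha).
Local Notation Hb := (Hb alpha).
Local Notation NL := (NL alpha).
Local Notation periodic := (@Defs.periodic R _).

Definition ik k : R[i] := 0 +i* k%:~R.

Lemma symbol_neq0 k : (1 + `|k%:~R| `^ alpha)%:C != 0 :> R[i].
Proof.
by rewrite -(rmorph0 (real_complex R)) (inj_eq (@complexI R)) lt0r_neq0.
Qed.

Lemma sigmaE k : (1 + `|k%:~R| `^ alpha)%:C * sigma alpha k = - ik k.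
Proof.
have p0 : 1 + `|k%:~R| `^ alpha != 0 :> R by rewrite lt0r_neq0.
apply: complexP; rewrite /sigma /ik ?cReM ?cImM /= ?mul0r ?mulr0 ?subr0 ?oppr0 ?addr0 //.
by rewrite mulrN mulrCA mulfV ?mulr1.
Qed.

Lemma solve_symbol k (x y z : R[i]) :
  (1 + `|k%:~R| `^ alpha)%:C * x = - ik k * (y + 2^-1 * z) <->
  x = sigma alpha k * (y + 2^-1 * z).
Proof.
rewrite -sigmaE -mulrA; split=> [|-> //].
exact: (mulfI (symbol_neq0 k)).
Qed.

Lemma expi_trigpoly N k : (`|k| <= N)%N ->
  @expi R k = trigpoly N (fun j => if j == k then 1 else 0).
Proof.
move=> kN; apply/funext => x; rewrite trigpolyE (bigD1_seq k) ?zr_uniq ?mem_zr //=.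
by rewrite eqxx mul1r big1 ?addr0 // => j /negbTE ->; rewrite mul0r.
Qed.

Lemma dx_expi k x : dx (@expi R k) x = ik k * expi k x.
Proof.
rewrite /dx /expi /=.
have [_ h1] := is_derive_cosk k%:~R x; have [_ h2] := is_derive_sink k%:~R x.
rewrite !derive1E h1 h2 /ik; apply: complexP; rewrite ?cReM ?cImM /=; ring.
Qed.

Lemma L2per_expi k : L2per (@expi R k).
Proof. by rewrite (expi_trigpoly (leqnn _)); exact: L2per_trigpoly. Qed.

Lemma inner_expi u (a : R[i]) k : cint u ->
  inner u (fun x => a * expi k x) = a^*%C * ((2 * pi)%:C * fourier u k).
Proof.
move=> cu; rewrite -cintegral_fourier -cintegralZ; last exact: cint_expiM.
by congr cintegral; apply/funext => x; rewrite conjcM mulrCA -expiJ.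
Qed.

Lemma inner_expi1 u k : cint u ->
  inner u (expi k) = (2 * pi)%:C * fourier u k.
Proof.
move=> cu; rewrite -[RHS]mul1r -[X in X * _](@conjc1 R) -inner_expi //.
by congr inner; apply/funext => x; rewrite mul1r.
Qed.

Lemma VN_L2per N u : VN N u -> L2per u.
Proof. by move=> [c ->]; exact: L2per_trigpoly. Qed.

Lemma VN_fourier N u k : VN N u -> (N < `|k|)%N -> fourier u k = 0.
Proof. by move=> [c ->] kN; rewrite fourier_trigpoly leqNgt kN. Qed.

(** The scheme is tested with e^{ikx}, an eigenfunction of D^alpha; the conjugation in the inner
    product turns the ik of the derivative into -ik. *)
Lemma galerkin_coef u0 N (u ut : R -> R -> R[i]) (t : R) k : is_galerkin alpha u0 N u ut -> 0 <= t ->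
  fourier (ut t) k = if (`|k| <= N)%N then NL (u t) k else 0.
Proof.
move=> [_ /(_ t)] + t0 => /(_ t0)[Vu Vut _ eqn].
case: leqP => kN; last exact: VN_fourier Vut kN.
pose Dphi x : R[i] := (`|k%:~R| `^ alpha)%:C * expi k x.
have hD : is_fracLap alpha (expi k) Dphi.
  split; first exact/L2perZ/L2per_expi.
  move=> j; rewrite fourierZ; last exact/L2per_cint/L2per_expi.
  by rewrite fourier_expi; case: eqP => [->|_] //; rewrite !mulr0.
have Vk : VN N (@expi R k) by exists (fun j => if j == k then 1 else 0); exact: expi_trigpoly.
have := eqn _ _ Vk hD.
have Lu := VN_L2per Vu; have Lut := VN_L2per Vut.
have cu := L2per_cint Lu; have cut := L2per_cint Lut.
have cuu : cint (fun x => u t x * u t x).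
  by have s := L2per_csq Lu; exact: csqM_cint.
have ch : cint (fun x => u t x + 2^-1 * u t x ^+ 2).
  apply: (eq_cint (v := fun x => u t x + 2^-1 * (u t x * u t x))) => //.
  by apply: cintD => //; exact: cintZ.
rewrite inner_expi1 // inner_expi // conjc_real.
rewrite (_ : dx (expi k) = fun x => ik k * expi k x); last first.
  by apply/funext => x; exact: dx_expi.
rewrite inner_expi // (_ : fourier (fun x => u t x + 2^-1 * u t x ^+ 2) k =
    fourier (u t) k + 2^-1 * fourier (fun x => u t x * u t x) k); last first.
  by rewrite -fourierZ // -fourierD //; exact: cintZ.
rewrite (_ : (ik k)^*%C = - ik k); last by rewrite /ik; apply: complexP; rewrite /= ?oppr0.
move=> h; apply/solve_symbol.
have p0 : (2 * pi)%:C != 0 :> R[i].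
  by rewrite -(rmorph0 (real_complex R)) (inj_eq (@complexI R)) twopi_neq0.
apply: (mulfI p0); rewrite [RHS]mulrCA -h rmorphD rmorph1; ring.
Qed.

Lemma cint_psi u (psi : R -> R) : cint u -> continuous psi ->
  cint (fun x => u x * (psi x)%:C).
Proof.
move=> cu cpsi.
have [M [Mr hM]] : bounded_set (psi @` Iper).
  apply: compact_bounded; apply: continuous_compact; last exact: segment_compact.
  exact: continuous_subspaceT.
apply: (@cintM_bounded _ _ _ (M + 1)) => //.
  by apply: continuous_cmeas => //= x; exact: cvg_cst.
move=> x Ix; rewrite normcR; apply: hM; [by rewrite ltrDl|by exists x].
Qed.

(** Test functions are real, so the cosine and the sine of frequency -k are used separately and
    combined into the exponential. *)
Lemma weak_dx_fourier u ux k : L2per u -> is_weak_dx u ux ->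
  fourier ux k = ik k * fourier u k.
Proof.
move=> Lu [Lux wd]; have cu := L2per_cint Lu; have cux := L2per_cint Lux.
have Pk := @expi_periodic R (- k).
set r : R := (- k)%:~R.
have cc : continuous (fun x : R => cos (r * x)) := @cts_coskx R r.
have cs : continuous (fun x : R => sin (r * x)) := @cts_sinkx R r.
have dc : derive1 (fun x : R => cos (r * x)) = fun x => - r * sin (r * x).
  by apply/funext => x; rewrite derive1E; have [_ ->] := is_derive_cosk r x.
have ds : derive1 (fun x : R => sin (r * x)) = fun x => r * cos (r * x).
  by apply/funext => x; rewrite derive1E; have [_ ->] := is_derive_sink r x.
have cdc : continuous (fun x : R => - r * sin (r * x)).
  by move=> x; apply: cvgM; [exact: cvg_cst|exact: cs].
have cds : continuous (fun x : R => r * cos (r * x)).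
  by move=> x; apply: cvgM; [exact: cvg_cst|exact: cc].
have h1 := wd (fun x => cos (r * x)) (fun x => congr1 (@complex.Re R) (Pk x))
  (fun x => let: DeriveDef d _ := is_derive_cosk r x in d).
rewrite dc in h1; have {}h1 := h1 cdc.
have h2 := wd (fun x => sin (r * x)) (fun x => congr1 (@complex.Im R) (Pk x))
  (fun x => let: DeriveDef d _ := is_derive_sink r x in d).
rewrite ds in h2; have {}h2 := h2 cds.
have E1 : cintegral (fun x => u x * ((- r * sin (r * x))%:C)) +
    (0 +i* 1) * cintegral (fun x => u x * (r * cos (r * x))%:C) =
    - ik k * cintegral (fun x => u x * expi (- k) x).
  have ca := cint_psi cu cdc; have cb := cint_psi cu cds.
  rewrite -(cintegralZ _ cb) -(cintegralZ _ (cint_expiM _ cu)).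
  rewrite -(cintegralD ca (cintZ _ cb)).
  congr cintegral; apply/funext => x; rewrite /expi -/r /ik (_ : k%:~R = - r :> R).
    by case: (u x) => a b; apply: complexP => /=; ring.
  by rewrite /r intrN opprK.
have E2 : cintegral (fun x => ux x * (cos (r * x))%:C) +
    (0 +i* 1) * cintegral (fun x => ux x * (sin (r * x))%:C) =
    cintegral (fun x => ux x * expi (- k) x).
  have ca := cint_psi cux cc; have cb := cint_psi cux cs.
  rewrite -(cintegralZ _ cb) -(cintegralD ca (cintZ _ cb)).
  congr cintegral; apply/funext => x; rewrite /expi -/r.
  by case: (ux x) => a b; apply: complexP => /=; ring.
rewrite h1 h2 mulrN -opprD E2 mulNr in E1; move/oppr_inj: E1 => E1.
by rewrite /fourier E1 mulrCA.
Qed.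

End CoefficientEquations.

(** * Equivalence of the fBBM equation in L^2 with its coefficient form *)

Section Equation.
Context {R : realType}.
Variable alpha : R.
Hypothesis halpha : 1 <= alpha <= 2.
Implicit Types (u v w : R -> R[i]) (k : int) (c d : int -> R[i]) (A B D : R).
Local Notation mu := (@lebesgue_measure R).
Local Notation Iper := (@Iper R).
Local Notation Yb := (Yb alpha).
Local Notation Hb := (Hb alpha).
Local Notation NL := (NL alpha).
Local Notation periodic := (@Defs.periodic R _).

Let alpha1 : 1 <= alpha. Proof. by case/andP: halpha. Qed.

Lemma ikM k c : normc (ik k * c k) ^+ 2 = `|k%:~R| ^+ 2 * normc (c k) ^+ 2.
Proof. by rewrite normcM exprMn; congr (_ * _); rewrite normcE /= expr0n /= add0r sqrtr_sqr. Qed.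

Lemma wt_ge_base k : 1 + `|k%:~R| ^+ 2 <= wt alpha k :> R.
Proof.
apply: le_trans (ler_powR (base_ge1 k) alpha1).
by rewrite powRr1 // (le_trans ler01 (base_ge1 k)).
Qed.

Lemma Yb_ik c A : Yb c A -> sumb (fun k => normc (ik k * c k) ^+ 2) (A ^+ 2).
Proof.
move=> [_ cA]; apply: sumb_le cA => k; rewrite ikM ler_wpM2r ?sqr_ge0 //.
by apply: le_trans (wt_ge_base k); rewrite lerDr.
Qed.

Lemma Yb_l2 c A : Yb c A -> sumb (fun k => normc (c k) ^+ 2) (A ^+ 2).
Proof.
move=> [_ cA]; apply: sumb_le cA => k; rewrite ler_peMl ?sqr_ge0 //.
by apply: le_trans (wt_ge_base k); exact: base_ge1.
Qed.

Lemma Yb_fracLap c A : Yb c A ->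
  sumb (fun k => normc ((`|k%:~R| `^ alpha)%:C * c k) ^+ 2) (A ^+ 2).
Proof.
move=> [_ cA]; apply: sumb_le cA => k.
rewrite normcM exprMn normcR ler_wpM2r ?sqr_ge0 // real_normK ?num_real //.
have -> : (`|k%:~R| `^ alpha) ^+ 2 = (`|k%:~R| ^+ 2) `^ alpha :> R.
  by rewrite -!powR_mulrn ?powR_ge0 // -!powRrM mulrC.
by apply: ge0_ler_powR; rewrite ?nnegrE ?addr_ge0 ?sqr_ge0 ?lerDr // (le_trans ler01).
Qed.

(* u u_x = (u^2)_x / 2, by symmetrizing the convolution in j <-> k - j *)
Lemma fourier_mul_dx A u ux k : Hb A u -> L2per ux ->
  (forall j, fourier ux j = ik j * fourier u j) ->
  fourier (fun x => u x * ux x) k =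
  2^-1 * (ik k * fourier (fun x => u x * u x) k).
Proof.
move=> Hu Lux uxE; have [Lu uA] := Hu; have u1 := Yb_l1 alpha1 uA.
have cu := L2per_cint Lu; have cux := L2per_cint Lux.
pose c := fourier u; have Lf : L2per (fser c) := L2per_fser u1.
have ae := Hb_fser halpha Hu.
have e1 : fourier (fun x => u x * ux x) k = fourier (fun x => fser c x * ux x) k.
  apply: eq_ae_fourier; [exact/cmeasM/cint_meas/cux/cint_meas/cu| |].
    by apply: cmeasM; [exact: fser_cmeas u1|exact: cint_meas].
  by apply: ae_imp ae => x h Ix; rewrite h.
have e2 : fourier (fun x => u x * u x) k = fourier (fun x => fser c x * u x) k.
  apply: eq_ae_fourier; [exact/cmeasM/cint_meas/cu/cint_meas/cu| |].
    by apply: cmeasM; [exact: fser_cmeas u1|exact: cint_meas].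
  by apply: ae_imp ae => x h Ix; rewrite {1}h.
pose a j := c j * (ik (k - j) * c (k - j)).
(* Both [c] and ik c are square summable because alpha >= 1, so their convolution products are
   absolutely summable. *)
have aS : sumb (fun j => normc (a j)) (A ^+ 2 + A ^+ 2).
  move=> s us; apply: (@le_trans _ _ (\sum_(j <- s) (normc (c j) ^+ 2 +
      normc (ik (k - j) * c (k - j)) ^+ 2))).
    apply: ler_sum => j _; rewrite /a normcM.
    have := sqr_ge0 (normc (c j) - normc (ik (k - j) * c (k - j))).
    have := normc_ge0 (c j); have := normc_ge0 (ik (k - j) * c (k - j)).
    by move: (normc (c j)) (normc (ik (k - j) * _)) => x y; nra.
  rewrite big_split; apply: lerD; first exact: Yb_l2 uA _ us.
  exact: (sumb_rshift k (a := fun j => normc (ik j * c j) ^+ 2) (Yb_ik uA) us).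
have l1 : ccvg (fun n => \sum_(j <- zr n) a j) (fourier (fun x => u x * ux x) k).
  rewrite e1; apply: ccvg_ext (fserM_fourier k u1 cux) => n.
  by apply: eq_bigr => j _; rewrite uxE.
have l2 := zsumP aS; have z1 := ccvg_unique l1 l2.
have l3 : ccvg (fun n => \sum_(j <- zr n) a (k - j)) (zsum a).
  have := @zsum_exhaust _ a _ (fun n => [seq k - j | j <- zr n]) aS.
  move=> h; apply: ccvg_ext (h _ _) => n; first by rewrite big_map.
    by rewrite map_inj_uniq ?zr_uniq // => x y /addrI /oppr_inj.
  near=> m; move=> j jn; apply/mapP; exists (k - j); last by ring.
  rewrite mem_zr in jn; rewrite mem_zr.
  have : (n + `|k| <= m)%N by near: m; exact: nbhs_infty_ge.
  by lia.
have l4 : ccvg (fun n => \sum_(j <- zr n) (a j + a (k - j)))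
    (ik k * fourier (fun x => u x * u x) k).
  rewrite e2; apply: ccvg_ext (ccvgZ (ik k) (fserM_fourier k u1 cu)) => n.
  rewrite mulr_sumr; apply: eq_bigr => j _; rewrite /a -/c.
  rewrite (_ : k - (k - j) = j); last by ring.
  (* Symmetrization: the two symbols add up to ik, which no longer depends on j. *)
  have -> : ik k = ik j + ik (k - j) :> R[i].
    by rewrite /ik intrB; apply: complexP => /=; ring.
  by ring.
have l5 : ccvg (fun n => \sum_(j <- zr n) (a j + a (k - j)))
    (fourier (fun x => u x * ux x) k + fourier (fun x => u x * ux x) k).
  rewrite {2}z1; apply: ccvg_ext (ccvgD l1 l3) => n.
  by rewrite big_split.
by rewrite (ccvg_unique l4 l5) -mulr2n -[X in _ * X]mulr_natl mulrA mulVf ?mul1r.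
Unshelve. all: by end_near. Qed.

Lemma fBBM_coef T u0 (w wt : R -> R -> R[i]) (t : R) k :
  is_fBBM_solution alpha T u0 w wt -> t \in `[0, T] ->
  fourier (wt t) k = NL (w t) k.
Proof.
move=> [C1 _ eqn] tT; have [Hw Hwt _ _] := C1 t tT.
have {}Hw := Hper_Hb Hw; have [Lw _] := Hw; have [Lwt _] := Hwt.
have [ux [Dut [wd [LD fD] ae]]] := eqn t tT.
have fux j := weak_dx_fourier j Lw wd; have [Lux _] := wd.
have s1 := L2per_csq Lw; have s2 := L2per_csq Lux.
have cwt := L2per_cint Lwt; have cux := L2per_cint Lux.
have cD := L2per_cint LD; have cwu := csqM_cint s1 s2.
have : fourier (fun x => wt t x + ux x + w t x * ux x + Dut x) k = fourier (fun=> 0) k.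
  apply: eq_ae_fourier ae; last exact: cmeas_cst.
  by apply: cint_meas; apply: cintD => //; apply: cintD => //; exact: cintD.
rewrite fourierD //; last by apply: cintD => //; exact: cintD.
rewrite fourierD //; last exact: cintD.
rewrite fourierD // fD fux (fourier_mul_dx _ Hw Lux fux).
have -> : fourier (fun=> 0) k = 0 :> R[i].
  rewrite /fourier -[X in _ * X = _](_ : cintegral (fun=> 0) = _).
    by rewrite cintegral0 mulr0.
  by congr cintegral; apply/funext => x; rewrite mul0r.
move=> h; apply/solve_symbol; apply/eqP; rewrite -subr_eq0 -[X in _ == X]h.
by apply/eqP; rewrite rmorphD rmorph1; ring.
Qed.

Lemma derivable_is_derive (psi : R -> R) x : derivable psi x 1 ->
  is_derive x 1 psi (derive1 psi x).
Proof. by move=> d; rewrite derive1E; apply: DeriveDef. Qed.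

Lemma Rint_by_parts (f df psi : R -> R) : (forall x : R, is_derive x 1 f (df x)) ->
  continuous df -> (forall x, derivable psi x 1) -> continuous (derive1 psi) ->
  f pi = f (- pi) -> psi pi = psi (- pi) ->
  \int[mu]_(x in Iper) (f x * derive1 psi x + psi x * df x) = 0.
Proof.
move=> fdf cdf dpsi cdpsi fpi psipi.
have cf := cts_is_derive fdf.
have cpsi := cts_is_derive (fun x => derivable_is_derive (dpsi x)).
have hd (x : R) : is_derive x (1 : R) (f * psi) (f x * derive1 psi x + psi x * df x).
  exact: is_deriveM (fdf x) (derivable_is_derive (dpsi x)).
rewrite (Rintegral_derivative hd); first by rewrite /GRing.mul /= fpi psipi subrr.
move=> x; apply: cvgD; apply: cvgM;
  [exact: cf|exact: cdpsi|exact: cpsi|exact: cdf].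
Qed.

Lemma expi_by_parts (psi : R -> R) k : (forall x, derivable psi x 1) ->
  continuous (derive1 psi) -> psi pi = psi (- pi) ->
  cintegral (fun x => expi k x * (derive1 psi x)%:C) =
  - (ik k * cintegral (fun x => expi k x * (psi x)%:C)).
Proof.
move=> dpsi cdpsi psipi.
have cpsi := cts_is_derive (fun x => derivable_is_derive (dpsi x)).
have ce := csq_cint (@csq_expi R k).
have c1 := cint_psi ce cdpsi; have c2 := cint_psi ce cpsi.
apply/eqP; rewrite -addr_eq0 -(cintegralZ _ c2) -(cintegralD c1 (cintZ _ c2)).
set r : R := k%:~R.
have [e1 e2] := @expi_pi R k.
have cc : continuous (fun x : R => - r * sin (r * x)).
  by move=> x; apply: cvgM; [exact: cvg_cst|exact: cts_sinkx].
have cs : continuous (fun x : R => r * cos (r * x)).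
  by move=> x; apply: cvgM; [exact: cvg_cst|exact: cts_coskx].
have h1 := Rint_by_parts (is_derive_cosk r) cc dpsi cdpsi (esym e1) psipi.
have h2 := Rint_by_parts (is_derive_sink r) cs dpsi cdpsi (esym e2) psipi.
apply/eqP; apply: complexP => /=; [rewrite -[RHS]h1|rewrite -[RHS]h2];
  by apply: eq_Rintegral => x _; rewrite /ik -/r; ring.
Qed.

(** Integration by parts is exact on each partial sum along [h]. The side with psi' converges by
    absolute convergence of the series, the side with psi by the weak convergence from
    [riesz_fischer]. *)
Lemma weak_dx_fser c A : Yb c A ->
  exists ux, is_weak_dx (fser c) ux /\ forall k, fourier ux k = ik k * c k.
Proof.
move=> cA; have c1 := Yb_l1 alpha1 cA.
have [ux [h [Lux fux hj uxc]]] := riesz_fischer (Yb_ik cA).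
exists ux; split=> //; split=> // psi ppsi dpsi cdpsi.
have psipi : psi pi = psi (- pi).
  by rewrite -(ppsi (- pi)); congr psi; ring.
have cpsi := cts_is_derive (fun x => derivable_is_derive (dpsi x)).
have c1psi : cint (fun x : R => 1 * (derive1 psi x)%:C) := cint_psi (cint_cst 1) cdpsi.
have h1 := cintegral_fserM c1 (_ : cint (fun x : R => (derive1 psi x)%:C)).
have {}h1 := h1 (eq_cint (fun x => esym (mul1r _)) c1psi).
have hoo : h n @[n --> \oo] --> \oo.
  apply/cvgnyPge => m; near=> n; apply: leq_trans (hj n).
  by near: n; exact: nbhs_infty_ge.
have {}h1 := ccvg_sub hoo h1.
have [M [Mr hM]] : bounded_set (psi @` Iper).
  apply: compact_bounded; apply: continuous_compact; last exact: segment_compact.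
  exact: continuous_subspaceT.
have mpsi : cmeas (fun x => (psi x)%:C).
  by apply: continuous_cmeas => //= x; exact: cvg_cst.
have psiM x : Iper x -> normc (psi x)%:C <= M + 1.
  by move=> Ix; rewrite normcR; apply: hM; [rewrite ltrDl|exists x].
have h2 := ccvgZ (-1) (uxc _ _ mpsi psiM).
rewrite -mulN1r; apply: ccvg_unique h1 _; apply: ccvg_ext h2 => n /=.
have E (d : int -> R[i]) (f : R -> R) : continuous f ->
    cintegral (fun x => trigpoly (h n) d x * (f x)%:C) =
    \sum_(k <- zr (h n)) d k * cintegral (fun x => expi k x * (f x)%:C).
  move=> cf; rewrite (_ : (fun x => _) = fun x =>
      \sum_(k <- zr (h n)) d k * (expi k x * (f x)%:C)); last first.
    apply/funext => x; rewrite trigpolyE mulr_suml; apply: eq_bigr => k _.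
    by rewrite mulrA.
  have cek k : cint (fun x => expi k x * (f x)%:C).
    by apply: cint_psi => //; exact/csq_cint/csq_expi.
  rewrite cintegral_sum => [|k]; last exact: cintZ.
  by apply: eq_bigr => k _; rewrite cintegralZ.
rewrite !E // mulr_sumr; apply: eq_bigr => k _; rewrite expi_by_parts //; ring.
Unshelve. all: by end_near. Qed.

(** All coefficients of the left-hand side vanish by [solve_symbol]; injectivity of the Fourier
    transform on L^1 is what is needed, as the product u u_x is only known to be integrable. *)
Lemma fBBM_equation c d A B : Yb c A -> Yb d B -> (forall k, d k = NL (fser c) k) ->
  exists ux Dut, [/\ is_weak_dx (fser c) ux, is_fracLap alpha (fser d) Dut &
    eq_L2 (fun x => fser d x + ux x + fser c x * ux x + Dut x) (fun=> 0)].
Proof.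
move=> cA dB dE; have c1 := Yb_l1 alpha1 cA; have d1 := Yb_l1 alpha1 dB.
have [ux [wd fux]] := weak_dx_fser cA; have [Lux _] := wd.
have [Dut [_ [LD fD _ _]]] := riesz_fischer (Yb_fracLap dB).
have Hc := Hb_fserE halpha cA; have [Lc _] := Hc.
have [Ld _] := Hb_fserE halpha dB.
have fd k := fser_fourier k d1.
exists ux, Dut; split=> //; first by split=> // k; rewrite fD fd.
have cwt := L2per_cint Ld; have cux := L2per_cint Lux.
have cD := L2per_cint LD; have cwu := csqM_cint (L2per_csq Lc) (L2per_csq Lux).
apply: fourier_eq0.
  by apply: cintD => //; apply: cintD => //; exact: cintD.
move=> k; rewrite fourierD //; last by apply: cintD => //; exact: cintD.
rewrite fourierD //; last exact: cintD.
rewrite fourierD // fD fux fd.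
rewrite (fourier_mul_dx _ Hc Lux); last by move=> j; rewrite fux (fser_fourier _ c1).
have /solve_symbol := dE k; rewrite rmorphD rmorph1 (fser_fourier _ c1) => h.
move: h; set m := (_ `^ _)%:C; set z := fourier (fun x => fser c x * _) k => h.
rewrite (_ : _ + m * d k = (1 + m) * d k + ik k * (c k + 2^-1 * z)); last by ring.
by rewrite h mulNr addNr.
Qed.

End Equation.

(** * Mean value inequalities *)

Section MeanValue.
Context {R : realType}.
Implicit Types (f df g dg : R -> R) (a : R -> R[i]) (D : set R) (T t l : R).

(** Difference quotients inside [D], matching [has_deriv_in]: one-sided derivatives at the end
    points of an interval. *)
Definition rderiv D f t l :=
  ((s - t)^-1 * (f s - f t) - l) @[s --> within D t^'] --> (0 : R).

Lemma has_deriv_sub D D' a t (z : R[i]) : D' `<=` D ->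
  has_deriv_in D a t z -> has_deriv_in D' a t z.
Proof.
by move=> DD; apply: cvg_trans; apply: cvg_app; exact: within_subset.
Qed.

Lemma has_deriv_ReIm D a t (z : R[i]) : has_deriv_in D a t z ->
  rderiv D (fun s => complex.Re (a s)) t (complex.Re z) /\
  rderiv D (fun s => complex.Im (a s)) t (complex.Im z).
Proof.
move=> h; split; apply/norm_cvg0P;
  apply: (@squeeze_cvgr _ _ _ _ (fun=> 0) _ _ _ 0 (cvg_cst _) h);
  apply: nearW => s; rewrite normr_ge0 /=.
  apply: le_trans (normc_Re _); rewrite le_eqVlt; apply/orP; left; apply/eqP.
  by case: (a s) (a t) z {h} => ? ? [? ?] [? ?] /=; rewrite mul0r subr0.
apply: le_trans (normc_Im _); rewrite le_eqVlt; apply/orP; left; apply/eqP.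
by case: (a s) (a t) z {h} => ? ? [? ?] [? ?] /=; rewrite mul0r addr0.
Qed.

Lemma rderiv_near D f t l e : rderiv D f t l -> 0 < e ->
  \forall s \near t, s != t -> D s -> `|(s - t)^-1 * (f s - f t) - l| <= e.
Proof.
move=> /cvgr0Pnorm_le /[apply].
by rewrite near_withinE /dnbhs near_withinE.
Qed.

Lemma rderiv_is_derive D f t l : nbhs t D -> rderiv D f t l -> is_derive t 1 f l.
Proof.
move=> nD h; apply/is_derive1_caratheodory.
exists (fun z => if z == t then l else (f z - f t) / (z - t)); rewrite eqxx; split=> //.
  move=> z; case: eqP => [->|/eqP]; first by rewrite !subrr mulr0.
  by rewrite -subr_eq0 => /divfK ->.
apply/cvgrPdist_le => e e0; have he := rderiv_near h e0.
near=> s; rewrite eqxx; case: eqVneq => [_|st]; first by rewrite subrr normr0 ltW.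
rewrite distrC mulrC; have /(_ st) : s != t -> D s -> `|(s - t)^-1 * (f s - f t) - l| <= e.
  by near: s.
by apply; near: s.
Unshelve. all: by end_near. Qed.

Lemma rderiv_continuous D f t l : rderiv D f t l -> f s @[s --> within D (nbhs t)] --> f t.
Proof.
move=> h; apply/cvgrPdist_le => e e0; have he := rderiv_near h ltr01.
have d0 : 0 < e / (`|l| + 1) by rewrite divr_gt0 // ltr_wpDl.
rewrite near_withinE; near=> s => Ds.
have [->|st] := eqVneq s t; first by rewrite subrr normr0 ltW.
have hs : `|(s - t)^-1 * (f s - f t) - l| <= 1.
  have : s != t -> D s -> `|(s - t)^-1 * (f s - f t) - l| <= 1 by near: s.
  by apply.
have st0 : s - t != 0 by rewrite subr_eq0.
have -> : f t - f s = - ((s - t) * ((s - t)^-1 * (f s - f t))).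
  by rewrite mulrA mulfV // mul1r opprB.
rewrite normrN normrM.
have h1 : `|(s - t)^-1 * (f s - f t)| <= `|l| + 1.
  rewrite -[X in `|X|](subrK l); apply: le_trans (ler_normD _ _) _.
  by rewrite addrC lerD2l.
have h2 : `|s - t| <= e / (`|l| + 1).
  rewrite distrC; near: s; apply: cvgr_dist_le => //; exact: cvg_id.
apply: le_trans (ler_pM _ _ h2 h1) _ => //.
by rewrite divfK // lt0r_neq0 // ltr_wpDl.
Unshelve. all: by end_near. Qed.

Lemma rderiv_within D f (df : R -> R) : (forall t, D t -> rderiv D f t (df t)) ->
  {within D, continuous f}.
Proof. by move=> h; apply/subspace_continuousP => t /h /rderiv_continuous. Qed.

Lemma nbhs_itv_oo (b e t : R) : b < t < e -> nbhs t (`[b, e]%classic : set R).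
Proof.
move=> /andP[bt te]; near=> s; rewrite /= in_itv /=; apply/andP; split; apply/ltW; near: s.
  exact: lt_nbhsr.
exact: lt_nbhsl.
Unshelve. all: by end_near. Qed.

(** At interior points [rderiv] is an ordinary derivative, so f - g is nonincreasing there;
    one-sided differentiability is needed at the end points only for continuity. *)
Lemma mean_value_le f df g dg (b e : R) : b <= e ->
  (forall t, t \in `[b, e] -> rderiv `[b, e] f t (df t)) ->
  (forall t : R, is_derive t 1 g (dg t)) ->
  (forall t, t \in `[b, e] -> df t <= dg t) ->
  f e - f b <= g e - g b.
Proof.
move=> be fdf gdg dfg.
have hd t : t \in `]b, e[ -> is_derive t 1 (f - g) (df t - dg t).
  move=> tT; have tT' : t \in `[b, e] by apply: subset_itv_oo_cc tT.
  apply: is_deriveB; apply: rderiv_is_derive (fdf t tT').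
  by apply: nbhs_itv_oo; rewrite in_itv in tT.
suff : f e - g e <= f b - g b by lra.
apply: (@ler0_derive1_nincr _ (f - g) b e) => //.
- by move=> t /hd[].
- move=> t tT; rewrite derive1E; have [_ ->] := hd t tT.
  by rewrite subr_le0 dfg //; apply: subset_itv_oo_cc tT.
- move=> t; apply: cvgB; first exact: (rderiv_within fdf).
  have cg := cts_is_derive gdg.
  exact: (continuous_subspaceT cg).
Qed.

Lemma rderivZ D f t l r : rderiv D f t l -> rderiv D (fun s => r * f s) t (r * l).
Proof.
move=> h; rewrite /rderiv -[0](mulr0 r).
rewrite (_ : (fun s => _) = fun s => r * ((s - t)^-1 * (f s - f t) - l)); last first.
  by apply/funext => s; ring.
by apply: cvgM => //; exact: cvg_cst.
Qed.

Lemma rderivD D f g t l m : rderiv D f t l -> rderiv D g t m ->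
  rderiv D (fun s => f s + g s) t (l + m).
Proof.
move=> h h'; rewrite /rderiv -[0](addr0 0).
rewrite (_ : (fun s => _) = fun s => ((s - t)^-1 * (f s - f t) - l) +
  ((s - t)^-1 * (g s - g t) - m)); last by apply/funext => s; ring.
exact: cvgD.
Qed.

Lemma rderiv_cst D r t : rderiv D (fun=> r) t 0.
Proof.
by rewrite /rderiv; under eq_fun do rewrite subrr mulr0 subrr; exact: cvg_cst.
Qed.

Lemma rderiv_sum (J : Type) (s : seq J) D (f : J -> R -> R) t (l : J -> R) :
  (forall j, rderiv D (f j) t (l j)) ->
  rderiv D (fun x => \sum_(j <- s) f j x) t (\sum_(j <- s) l j).
Proof.
move=> h; elim: s => [|j s IH].
  by rewrite big_nil; under eq_fun do rewrite big_nil; exact: rderiv_cst.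
by rewrite big_cons; under eq_fun do rewrite big_cons; exact: rderivD.
Qed.

(* Testing c b - c a against itself reduces the estimate to the scalar mean value
   inequality for finitely many coefficients at a time. *)
Lemma Yb_mean_value alpha (c c' : R -> int -> R[i]) g dg (b e : R) : b <= e ->
  (forall k t, t \in `[b, e] -> has_deriv_in `[b, e] (c^~ k) t (c' t k)) ->
  (forall t : R, is_derive t 1 g (dg t)) ->
  (forall t, t \in `[b, e] -> Yb alpha (c' t) (dg t)) ->
  Yb alpha (fun k => c e k - c b k) (g e - g b).
Proof.
move=> be cc' gdg c'dg.
(* The bounds [dg] are nonnegative as part of [Yb], so [g] increases. *)
have gg : 0 <= g e - g b.
  rewrite -(subrr (0 : R)); apply: (@mean_value_le (fun=> 0) (fun=> 0)) => //.
    by move=> t _; exact: rderiv_cst.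
  by move=> t /c'dg[].
split=> // s us.
pose z k := c e k - c b k; set P := \sum_(k <- s) _.
have P0 : 0 <= P by apply: sumr_ge0 => k _; rewrite mulr_ge0 ?wt_ge0 ?sqr_ge0.
pose ip (w : int -> R[i]) := \sum_(k <- s) wt alpha k *
  (complex.Re (z k) * complex.Re (w k) + complex.Im (z k) * complex.Im (w k)).
have ipP : ip (c e) - ip (c b) = P.
  rewrite /ip /P -sumrB; apply: eq_bigr => k _; rewrite -mulrBr; congr (_ * _).
  by rewrite sqr_normcE /z; case: (c e k) (c b k) => ? ? [? ?] /=; ring.
pose Q := Num.sqrt P; have Q0 : 0 <= Q := sqrtr_ge0 P.
have QQ : Q ^+ 2 = P by rewrite /Q sqr_sqrtr.
have : ip (c e) - ip (c b) <= Q * g e - Q * g b.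
  apply: (@mean_value_le (fun t => ip (c t)) (fun t => ip (c' t))
      (fun t => Q * g t) (fun t => Q * dg t)) => //.
  - move=> t tT; apply: rderiv_sum => k; apply: rderivZ.
    have [hr hi] := has_deriv_ReIm (cc' k t tT).
    by apply: rderivD; exact: rderivZ.
  - move=> t tT; have [dg0 /(_ s us) h] := c'dg t tT.
    apply: le_trans (_ : \sum_(k <- s) wt alpha k * (normc (z k) * normc (c' t k)) <= _).
      apply: ler_sum => k _; rewrite ler_wpM2l ?wt_ge0 //.
      rewrite -(normcJ (z k)) -normcM; apply: le_trans (normc_Re _).
      apply: le_trans (ler_norm _).
      by case: (z k) (c' t k) => ? ? [? ?] /=; lra.
    apply: le_trans (ler_norm _) _.
    rewrite -(@ler_pXn2r _ 2) ?nnegrE ?normr_ge0 ?mulr_ge0 // real_normK ?num_real //.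
    have cs := cauchy_schwarz s (fun k => normc (z k)) (fun k => normc (c' t k))
      (@wt_ge0 R alpha).
    by apply: le_trans cs _; rewrite exprMn QQ ler_wpM2l.
rewrite ipP -QQ -mulrBr => h.
rewrite lerXn2r ?nnegrE //.
have [->|Qn0] := eqVneq Q 0; first by [].
have Qp : 0 < Q by rewrite lt0r Qn0.
by move: h; rewrite expr2 ler_pM2l.
Qed.

End MeanValue.

(** * Galerkin approximations *)

Section DerivativeRules.
Context {R : realType}.
Implicit Types (f g : R -> R) (D : set R) (t l m : R).

Lemma rderivP D f t l : rderiv D f t l <->
  (s - t)^-1 * (f s - f t) @[s --> within D t^'] --> l.
Proof. by rewrite /rderiv; split=> [/subr_cvg0|h]; [|apply/subr_cvg0]. Qed.

Lemma eq_rderiv D f t l m : l = m -> rderiv D f t l -> rderiv D f t m.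
Proof. by move=> ->. Qed.

Lemma rderiv_cvg D f t l : rderiv D f t l -> f s @[s --> within D t^'] --> f t.
Proof.
move=> /rderiv_continuous; apply: cvg_trans; apply: cvg_app.
move=> P hP; have {}hP : \forall s \near t, D s -> P s := hP.
suff : \forall s \near t, s != t -> D s -> P s by [].
by near=> s => _; near: s.
Unshelve. all: by end_near. Qed.

Lemma rderivM D f g t l m : rderiv D f t l -> rderiv D g t m ->
  rderiv D (fun s => f s * g s) t (l * g t + f t * m).
Proof.
move=> hf hg; have cg := rderiv_cvg hg.
move/rderivP : hf => hf; move/rderivP : hg => hg; apply/rderivP.
rewrite (_ : (fun s => _) = fun s => (s - t)^-1 * (f s - f t) * g s +
  f t * ((s - t)^-1 * (g s - g t))); last by apply/funext => s; ring.
by apply: cvgD; apply: cvgM => //; exact: cvg_cst.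
Qed.

Lemma rderivV D f t l : (forall s, 0 < f s) -> rderiv D f t l ->
  rderiv D (fun s => (f s)^-1) t (- l / f t ^+ 2).
Proof.
move=> f0 hf; have cf := rderiv_cvg hf.
move/rderivP : hf => hf; apply/rderivP.
rewrite (_ : (fun s => _) = fun s => - ((s - t)^-1 * (f s - f t)) * ((f s)^-1 * (f t)^-1)).
  rewrite expr2 invfM; apply: cvgM; first exact: cvgN.
  by apply: cvgM; [apply: cvgV => //; rewrite gt_eqF|exact: cvg_cst].
apply/funext => s; have := f0 s; have := f0 t => /lt0r_neq0 h1 /lt0r_neq0 h2.
rewrite -mulrN -mulrA; congr (_ * _); field; exact/andP.
Qed.

End DerivativeRules.

(** * A life span and H^alpha bounds independent of N *)

Section GalerkinEstimates.
Context {R : realType}.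
Variable alpha : R.
Hypothesis halpha : 1 <= alpha <= 2.
Local Notation Yb := (Yb alpha).
Local Notation Hb := (Hb alpha).
Local Notation NL := (NL alpha).
Variables (u0 : R -> R[i]) (r : R).
Hypothesis Hu0 : Hb r u0.
Variables uN uNt : nat -> R -> R -> R[i].
Hypothesis galN : forall N, is_galerkin alpha u0 N (uN N) (uNt N).
Implicit Types (N n : nat) (k : int) (t : R).

(* With E the square of the H^alpha norm of u_N, 1/(1+E) decreases at rate at most 26, so
   E <= 1 + 2r^2 up to the time [Tlife r]; [Lip r] bounds the Lipschitz constant of [NL] on
   the ball of radius [Abd r], and is chosen together with [Tlife r] so that their product is
   at most 1/4. *)
Definition Abd (r : R) : R := 1 + 2 * r ^+ 2.
Definition Lip (r : R) : R := 1 + 24 * Abd r.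
Definition Tlife (r : R) : R := (104 * Abd r)^-1.

Local Notation A := (Abd r).
Local Notation L := (Lip r).
Local Notation T := (Tlife r).

Lemma Abd_ge1 : 1 <= A. Proof. by rewrite lerDl mulr_ge0 ?sqr_ge0. Qed.
Let A1 := Abd_ge1.

Lemma Tlife_gt0 : 0 < T.
Proof. by rewrite invr_gt0; move: A1; lra. Qed.

Lemma Lip_ge0 : 0 <= L. Proof. by rewrite /Lip; move: A1; lra. Qed.

Lemma LipT_le : L * T <= 4^-1.
Proof.
rewrite /Tlife ler_pdivrMr; last by move: A1; lra.
by rewrite /Lip; move: A1; lra.
Qed.

Lemma uN_L2per N t : 0 <= t -> L2per (uN N t).
Proof. by move=> t0; have [_ /(_ t t0)[/VN_L2per]] := galN N. Qed.

Lemma uNt_L2per N t : 0 <= t -> L2per (uNt N t).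
Proof. by move=> t0; have [_ /(_ t t0)[_ /VN_L2per]] := galN N. Qed.

Lemma uN_supp N t (k : int) : 0 <= t -> (N < `|k|)%N -> fourier (uN N t) k = 0.
Proof. by move=> t0; have [_ /(_ t t0)[/VN_fourier h _ _ _]] := galN N; exact: h. Qed.

Lemma uNt_coef N t (k : int) : 0 <= t ->
  fourier (uNt N t) k = if (`|k| <= N)%N then NL (uN N t) k else 0.
Proof. exact: galerkin_coef (galN N). Qed.

Lemma uN_init N (k : int) :
  fourier (uN N 0) k = if (`|k| <= N)%N then fourier u0 k else 0.
Proof. by have [-> _] := galN N; rewrite fourier_trigpoly. Qed.

Lemma uN_deriv N (k : int) t (S : R) : t \in `[0, S] ->
  has_deriv_in `[0, S] (fun s => fourier (uN N s) k) t (fourier (uNt N t) k).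
Proof.
rewrite in_itv /= => /andP[t0 tS]; have [_ /(_ t t0)[_ _ h _]] := galN N.
apply: has_deriv_sub (h k) => s /=; rewrite !in_itv /= => /andP[-> _] //.
Qed.

(** As u_N has no mode above N, this finite sum is the full squared H^alpha norm, and it can be
    differentiated term by term. *)
Definition energy N t := \sum_(k <- zr N) wt alpha k * normc (fourier (uN N t) k) ^+ 2.

Lemma energy_ge0 N t : 0 <= energy N t.
Proof. by apply: sumr_ge0 => k _; rewrite mulr_ge0 ?wt_ge0 ?sqr_ge0. Qed.

Lemma energy_Hb N t : 0 <= t -> Hb (Num.sqrt (energy N t)) (uN N t).
Proof.
move=> t0; split; first exact: uN_L2per.
split; first exact: sqrtr_ge0.
move=> s us; rewrite sqr_sqrtr ?energy_ge0 //.
apply: (@le_trans _ _ (\sum_(k <- [seq k <- s | (`|k| <= N)%N])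
    wt alpha k * normc (fourier (uN N t) k) ^+ 2)).
  rewrite big_filter [leRHS]big_mkcond; apply: ler_sum => k _.
  by case: leqP => // kN; rewrite uN_supp // normc0 expr0n mulr0.
apply: sum_sub.
- by move=> k; rewrite mulr_ge0 ?wt_ge0 ?sqr_ge0.
- exact: filter_uniq.
- exact: zr_uniq.
- by move=> k; rewrite mem_filter mem_zr => /andP[].
Qed.

Definition denergy N t := \sum_(k <- zr N) wt alpha k *
  (2 * (complex.Re (fourier (uN N t) k) * complex.Re (fourier (uNt N t) k) +
        complex.Im (fourier (uN N t) k) * complex.Im (fourier (uNt N t) k))).

Lemma energy_deriv N t (S : R) : t \in `[0, S] ->
  rderiv `[0, S] (energy N) t (denergy N t).
Proof.
move=> tS; rewrite /energy /denergy.
apply: rderiv_sum => k; apply: rderivZ.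
rewrite (_ : (fun s => _) = fun s =>
    complex.Re (fourier (uN N s) k) * complex.Re (fourier (uN N s) k) +
    complex.Im (fourier (uN N s) k) * complex.Im (fourier (uN N s) k)); last first.
  by apply/funext => s; rewrite sqr_normcE.
have [hr hi] := has_deriv_ReIm (uN_deriv N k tS).
have h := rderivD (rderivM hr hr) (rderivM hi hi).
by apply: eq_rderiv h; ring.
Qed.

(** With x the norm, Cauchy-Schwarz and [NL_bound] give 2x^2 + 48x^3, and 2x^3 <= x^2 + x^4 turns
    this into at most 26 (1 + x^2)^2. *)
Lemma denergy_le N t : 0 <= t -> denergy N t <= 26 * (1 + energy N t) ^+ 2.
Proof.
move=> t0; have Hu := energy_Hb N t0; set x := Num.sqrt (energy N t) in Hu.
have x0 : 0 <= x := sqrtr_ge0 _.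
have xE : x ^+ 2 = energy N t by rewrite /x sqr_sqrtr ?energy_ge0.
have [B0 hB] : Yb (fourier (uNt N t)) ((1 + 24 * x) * x).
  apply: Yb_mono (NL_bound halpha Hu) => k; rewrite uNt_coef //.
  by case: ifP => // _; rewrite normc0 normc_ge0.
have h : denergy N t <= 2 * (x * ((1 + 24 * x) * x)).
  apply: (@le_trans _ _ (2 * \sum_(k <- zr N) wt alpha k *
      (normc (fourier (uN N t) k) * normc (fourier (uNt N t) k)))).
    rewrite /denergy mulr_sumr; apply: ler_sum => k _.
    rewrite mulrCA ler_wpM2l // ler_wpM2l ?wt_ge0 //.
    rewrite -(normcJ (fourier (uN N t) k)) -normcM; apply: le_trans (normc_Re _).
    apply: le_trans (ler_norm _).
    by case: (fourier (uN N t) k) (fourier (uNt N t) k) => ? ? [? ?] /=; lra.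
  rewrite ler_pM2l //; apply: le_trans (ler_norm _) _.
  rewrite -(@ler_pXn2r _ 2) ?nnegrE ?normr_ge0 ?(mulr_ge0 x0) // real_normK ?num_real //.
  have cs := cauchy_schwarz (zr N) (fun k => normc (fourier (uN N t) k))
    (fun k => normc (fourier (uNt N t) k)) (@wt_ge0 R alpha).
  apply: le_trans cs _; rewrite exprMn xE ler_wpM2l ?energy_ge0 //.
  exact: hB (zr_uniq N).
apply: le_trans h _; rewrite -xE.
by have := sqr_ge0 (x * (1 - x)); nra.
Qed.

Lemma energy_init N : energy N 0 <= r ^+ 2.
Proof.
have [_ [_ h]] := Hu0; apply: le_trans (h _ (zr_uniq N)).
apply: ler_sum => k _; rewrite uN_init; case: ifP => // _.
by rewrite normc0 expr0n mulr0 mulr_ge0 ?wt_ge0 ?sqr_ge0.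
Qed.

Lemma energy_le N t : t \in `[0, T] -> energy N t <= A.
Proof.
rewrite in_itv /= => /andP[t0 tT].
have E1 s : 0 < 1 + energy N s by rewrite ltr_pwDl ?energy_ge0.
have h : - 1 * (1 + energy N t)^-1 - - 1 * (1 + energy N 0)^-1 <= 26 * t - 26 * 0.
  apply: (@mean_value_le _ (fun s => - 1 * (1 + energy N s)^-1)
    (fun s => - 1 * (- (0 + denergy N s) / (1 + energy N s) ^+ 2))
    (fun s => 26 * s) (fun=> 26)) => //.
  - move=> s st; apply: rderivZ; apply: rderivV => //.
    by apply: rderivD; [exact: rderiv_cst|exact: energy_deriv].
  - by move=> s; exact: is_derive_mulr.
  - move=> s; rewrite in_itv /= => /andP[s0 _].
    rewrite add0r mulN1r mulNr opprK ler_pdivrMr ?exprn_gt0 //.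
    exact: denergy_le.
have h0 : (1 + r ^+ 2)^-1 <= (1 + energy N 0)^-1.
  by rewrite lef_pV2 ?posrE // ?ltr_pwDl ?sqr_ge0 // lerD2l energy_init.
have h1 : 26 * t <= 4^-1 * A^-1.
  (* 26 T = 1/(4A) since 104 = 4 * 26. As A >= 1 + r^2, at most a quarter of 1/(1 + r^2) is lost,
     and keeping half of it already gives E <= 1 + 2 r^2. *)
  apply: (@le_trans _ _ (26 * T)); first by rewrite ler_pM2l.
  by rewrite /Tlife invfM le_eqVlt; apply/orP; left; apply/eqP; field; move: A1; lra.
have r0 := sqr_ge0 r.
have h2 : A^-1 <= (1 + r ^+ 2)^-1.
  by rewrite lef_pV2 ?posrE /Abd; lra.
have h3 : 2^-1 * (1 + r ^+ 2)^-1 <= (1 + energy N t)^-1.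
  have : 0 < (1 + r ^+ 2)^-1 by rewrite invr_gt0; lra.
  by rewrite mulr0 in h; lra.
rewrite -invfM lef_pV2 ?posrE // in h3; last lra.
by rewrite /Abd; lra.
Qed.

(** The norm is at most the square root of A, which is at most A because A >= 1. *)
Lemma uN_Hb N t : t \in `[0, T] -> Hb A (uN N t).
Proof.
move=> tT; have := energy_le N tT; move: tT; rewrite in_itv /= => /andP[t0 _] EA.
have [Lu uE] := energy_Hb N t0; split=> //; apply: Yb_le uE.
rewrite -(@ler_pXn2r _ 2) ?nnegrE ?sqrtr_ge0 //; last by move: A1; lra.
rewrite sqr_sqrtr ?energy_ge0 //; apply: le_trans EA _.
by move: A1 => h; nra.
Qed.

Lemma uNt_Hb N t : t \in `[0, T] -> Hb (L * A) (uNt N t).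
Proof.
move=> tT; have Hu := uN_Hb N tT; move: tT; rewrite in_itv /= => /andP[t0 _].
split; first exact: uNt_L2per.
apply: Yb_mono (NL_bound halpha Hu) => k; rewrite uNt_coef //.
by case: ifP => // _; rewrite normc0 normc_ge0.
Qed.

End GalerkinEstimates.

(** * Uniform tails, the Cauchy property and the limit coefficients *)

Section GalerkinConvergence.
Context {R : realType}.
Variable alpha : R.
Hypothesis halpha : 1 <= alpha <= 2.
Local Notation Yb := (Yb alpha).
Local Notation Hb := (Hb alpha).
Local Notation NL := (NL alpha).
Variables (u0 : R -> R[i]) (r : R).
Hypothesis Hu0 : Hb r u0.
Variables uN uNt : nat -> R -> R -> R[i].
Hypothesis galN : forall N, is_galerkin alpha u0 N (uN N) (uNt N).
Implicit Types (N M n j : nat) (k : int) (t D e : R).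

Local Notation A := (Abd r).
Local Notation L := (Lip r).
Local Notation T := (Tlife r).
Local Notation c := (fun N t k => fourier (uN N t) k).
Local Notation ct := (fun N t k => fourier (uNt N t) k).

Let A1 : 1 <= A := Abd_ge1 r.
Let T0 : 0 < T := Tlife_gt0 r.
Let L0 : 0 <= L := Lip_ge0 r.
Let LT : L * T <= 4^-1 := LipT_le r.

Let mem0T : 0 \in `[0, T]. Proof. by rewrite in_itv /= lexx ltW. Qed.

Lemma Yb_tail (d : int -> R[i]) B e : Yb d B -> 0 < e -> exists n, Yb (Qproj n d) e.
Proof.
move=> [_ dB] e0.
have a0 k : 0 <= wt alpha k * normc (d k) ^+ 2 by rewrite mulr_ge0 ?wt_ge0 ?sqr_ge0.
have [n hn] := sumb_tail a0 dB (exprn_gt0 2 e0).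
exists n; split; first exact: ltW.
move=> s us.
apply: (@le_trans _ _ (\sum_(k <- [seq k <- s | (n < `|k|)%N])
    wt alpha k * normc (d k) ^+ 2)).
  rewrite big_filter [leRHS]big_mkcond; apply: ler_sum => k _.
  by rewrite /Qproj; case: leqP => // _; rewrite normc0 expr0n mulr0.
by apply: hn; [exact: filter_uniq|move=> k; rewrite mem_filter => /andP[]].
Qed.

Lemma has_deriv_Qproj n N k t b e : 0 <= b -> t \in `[b, e] ->
  has_deriv_in `[b, e] (fun s => Qproj n (c N s) k) t (Qproj n (ct N t) k).
Proof.
move=> b0 tbe; rewrite /Qproj; case: ifP => _.
  rewrite /has_deriv_in (_ : (fun s : R => _) = fun=> 0); first exact: cvg_cst.
  by apply/funext => s; rewrite subrr mulr0 subrr normc0.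
have te : t \in `[0, e].
  by move: tbe; rewrite !in_itv /= => /andP[bt ->]; rewrite (le_trans b0).
apply: has_deriv_sub (uN_deriv galN N k te) => s /=; rewrite !in_itv /= => /andP[bs ->].
by rewrite (le_trans b0).
Qed.

Lemma uNt_NL N t k : t \in `[0, T] -> ct N t k = if (`|k| <= N)%N then NL (uN N t) k else 0.
Proof. by rewrite in_itv /= => /andP[t0 _]; exact: (uNt_coef galN). Qed.

Lemma uNt_tail n m D N t : t \in `[0, T] -> Yb (Qproj n (c N t)) D ->
  (n.*2 <= m)%N -> Yb (Qproj m (ct N t)) (L * D).
Proof.
move=> tT h nm; have Hu := uN_Hb halpha Hu0 galN N tT.
apply: Yb_mono (Yb_Qproj_leq nm (NL_tail halpha Hu h)) => k.
rewrite /Qproj; case: ifP => // _; rewrite uNt_NL //.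
by case: ifP => // _; rewrite normc0 normc_ge0.
Qed.

Lemma sub_itv t : t \in `[0, T] -> forall s, s \in `[0, t] -> s \in `[0, T].
Proof.
rewrite in_itv /= => /andP[_ tT] s; rewrite !in_itv /= => /andP[-> st].
exact: le_trans tT.
Qed.

(* Uniform smallness of the tails: on [0, T] with L T <= 1/4, one application of the
   equation to the modes above 2n halves the bound available above n. *)
Lemma uN_tails j : exists n, forall N t, t \in `[0, T] -> Yb (Qproj n (c N t)) (A / 2 ^+ j).
Proof.
elim: j => [|j [n hn]].
  exists 0%N => N t tT; rewrite expr0 divr1; apply: Yb_Qproj.
  by have [] := uN_Hb halpha Hu0 galN N tT.
pose D := A / 2 ^+ j.
have D0 : 0 < D by rewrite divr_gt0 ?exprn_gt0 //; move: A1; lra.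
have [_ u0r] := Hu0; have [|n1 hn1] := Yb_tail u0r (_ : 0 < D / 4); first lra.
(* Above [n1] the datum contributes at most D/4, and above 2n the time derivative at most L D, hence
   L T D <= D/4 over the interval: together D/2. *)
exists (maxn n1 n.*2) => N t tT; set m := maxn n1 n.*2.
have tT' := sub_itv tT; have /andP[t0 tle] : 0 <= t <= T by move: tT; rewrite in_itv.
have h := @Yb_mean_value _ alpha (fun s => Qproj m (c N s)) (fun s => Qproj m (ct N s))
  (fun s => L * D * s) (fun=> L * D) 0 t t0
  (fun k s hs => has_deriv_Qproj m N k (lexx 0) hs) (is_derive_mulr (L * D))
  (fun s hs => uNt_tail (tT' s hs) (hn N s (tT' s hs)) (leq_maxr _ _)).
have hi : Yb (Qproj m (c N 0)) (D / 4).
  apply: Yb_mono (Yb_Qproj_leq (leq_maxl n1 n.*2) hn1) => k.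
  rewrite /Qproj -/m; case: ifP => // _; rewrite (uN_init galN).
  by case: ifP => // _; rewrite normc0 normc_ge0.
have := YbD h hi; rewrite mulr0 subr0 => h2.
apply: Yb_ext (Yb_le _ h2) => [k|]; first by rewrite subrK.
have -> : A / 2 ^+ j.+1 = D / 2 by rewrite exprS invfM mulrCA mulrC.
have : L * t <= 4^-1 by apply: le_trans LT; rewrite ler_wpM2l.
by move=> /(ler_wpM2r (ltW D0)); lra.
Qed.

(** Modes up to [m] lie below both cut-offs, where both time derivatives are given by [NL] and the
    Lipschitz bound applies; above [m] each of them is estimated separately by its tail. *)
Lemma uNt_dist n m D E N M t : t \in `[0, T] ->
  (forall N t, t \in `[0, T] -> Yb (Qproj n (c N t)) E) ->
  Yb (fun k => c N t k - c M t k) D -> (n.*2 <= m)%N -> (m <= N)%N -> (m <= M)%N ->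
  Yb (fun k => ct N t k - ct M t k) (L * D + (L * E + L * E)).
Proof.
move=> tT hE hD nm mN mM.
have HN := uN_Hb halpha Hu0 galN N tT; have HM := uN_Hb halpha Hu0 galN M tT.
have h1 := NL_lip halpha HN HM hD.
pose low k := if (`|k| <= m)%N then NL (uN N t) k - NL (uN M t) k else 0.
have hlow : Yb low (L * D).
  by apply: Yb_mono h1 => k; rewrite /low; case: ifP => // _; rewrite normc0 normc_ge0.
have tN := uNt_tail tT (hE N t tT) nm; have tM := uNt_tail tT (hE M t tT) nm.
apply: Yb_ext (YbD hlow (YbB tN tM)) => k; rewrite /low /Qproj.
case: leqP => km; last by rewrite add0r.
by rewrite subrr addr0 !uNt_NL // (leq_trans km mN) (leq_trans km mM).
Qed.

Lemma has_deriv_inB (S : set R) (f g : R -> R[i]) t (z w : R[i]) :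
  has_deriv_in S f t z -> has_deriv_in S g t w ->
  has_deriv_in S (fun s => f s - g s) t (z - w).
Proof.
move=> hf hg.
have hfg : normc (((s - t)^-1)%:C * (f s - f t) - z) +
    normc (((s - t)^-1)%:C * (g s - g t) - w) @[s --> within S t^'] --> (0 : R).
  by rewrite -[0](addr0 0); exact: cvgD.
apply: (@squeeze_cvgr _ _ _ _ (fun=> 0) _ _ _ 0 (cvg_cst _) hfg).
apply: nearW => s; rewrite normc_ge0 /=.
apply: le_trans (normcB _ _); rewrite le_eqVlt; apply/orP; left; apply/eqP.
by congr normc; ring.
Qed.

Lemma uN_deriv0 N k t s : t \in `[0, T] -> s \in `[0, t] ->
  has_deriv_in `[0, t] (fun s => c N s k) s (ct N s k).
Proof. by move=> tT st; exact: (uN_deriv galN). Qed.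

Lemma uN_cauchy j : exists n, forall N M t, (n <= N)%N -> (n <= M)%N -> t \in `[0, T] ->
  Yb (fun k => c N t k - c M t k) (2 * A / 2 ^+ j).
Proof.
elim: j => [|j [n hn]].
  exists 0%N => N M t _ _ tT; rewrite expr0 divr1 mulr_natl mulr2n.
  by apply: YbB; [have [] := uN_Hb halpha Hu0 galN N tT|
                  have [] := uN_Hb halpha Hu0 galN M tT].
pose D := 2 * A / 2 ^+ j.
have D0 : 0 < D by rewrite divr_gt0 ?exprn_gt0 //; move: A1; lra.
(* The shift by 2 makes the tails D/8. Then L T (D + D/4) + D/8 <= 5D/16 + 2D/16, which is below
   D/2. *)
have [n2 hn2] := uN_tails j.+2.
have ED : A / 2 ^+ j.+2 = D / 8.
  by rewrite /D !exprS; field; rewrite lt0r_neq0 ?exprn_gt0.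
rewrite ED in hn2.
have [_ u0r] := Hu0; have [|n1 hn1] := Yb_tail u0r (_ : 0 < D / 8); first lra.
exists (maxn n (maxn n1 n2.*2)) => N M t; set m := maxn n1 n2.*2.
rewrite !geq_max => /and3P[nN n1N n2N] /and3P[nM n1M n2M] tT.
have mN : (m <= N)%N by rewrite geq_max n1N.
have mM : (m <= M)%N by rewrite geq_max n1M.
have tT' := sub_itv tT; have /andP[t0 tle] : 0 <= t <= T by move: tT; rewrite in_itv.
pose K := L * D + (L * (D / 8) + L * (D / 8)).
have h := @Yb_mean_value _ alpha (fun s k => c N s k - c M s k)
  (fun s k => ct N s k - ct M s k)
  (fun s => K * s) (fun=> K) 0 t t0
  (fun k s hs => has_deriv_inB (uN_deriv0 N k tT hs) (uN_deriv0 M k tT hs))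
  (is_derive_mulr K)
  (fun s hs => uNt_dist (tT' s hs) hn2 (hn N M s nN nM (tT' s hs)) (leq_maxr _ _) mN mM).
have hi : Yb (fun k => c N 0 k - c M 0 k) (D / 8).
  apply: Yb_mono hn1 => k; rewrite !(uN_init galN) /Qproj.
  case: (leqP `|k| n1) => kn.
    by rewrite (leq_trans kn n1N) (leq_trans kn n1M) subrr.
  by case: ifP => _; case: ifP => _;
    rewrite ?subrr ?subr0 ?sub0r ?normcN ?normc0 ?normc_ge0.
have := YbD h hi; rewrite mulr0 subr0 => h2.
apply: Yb_ext (Yb_le _ h2) => [k|]; first by rewrite subrK.
have -> : 2 * A / 2 ^+ j.+1 = D / 2.
  by rewrite /D exprS; field; rewrite lt0r_neq0 ?exprn_gt0.
have : L * t <= 4^-1 by apply: le_trans LT; rewrite ler_wpM2l.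
by move=> /(ler_wpM2r (ltW D0)); rewrite /K; lra.
Qed.

Lemma uN_uNt_cauchy j : exists n, forall N M t, (n <= N)%N -> (n <= M)%N -> t \in `[0, T] ->
  Yb (fun k => c N t k - c M t k) (2 * A / 2 ^+ j) /\
  Yb (fun k => ct N t k - ct M t k) (4 * (L * A) / 2 ^+ j).
Proof.
have [n1 h1] := uN_cauchy j; have [n2 h2] := uN_tails j.
exists (maxn n1 n2.*2) => N M t.
rewrite !geq_max => /andP[n1N n2N] /andP[n1M n2M] tT.
have hD := h1 N M t n1N n1M tT; split=> //.
apply: Yb_le (uNt_dist tT h2 hD (leqnn _) n2N n2M).
by rewrite le_eqVlt; apply/orP; left; apply/eqP; ring.
Qed.

Definition clim (a : nat -> R[i]) : R[i] := xget 0 (fun l => ccvg a l).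

Lemma climP (a : nat -> R[i]) : (exists l, ccvg a l) -> ccvg a (clim a).
Proof. by move=> [l al]; rewrite /clim; case: xgetP => [x _ //|/(_ l)]. Qed.

Lemma small_pow2 (B e : R) : 0 < e -> exists j, B / 2 ^+ j <= e.
Proof.
move=> e0; have h : B * (2^-1) ^+ n @[n --> \oo] --> (B * 0 : R).
  by apply: cvgM; [exact: cvg_cst|apply: cvg_expr; rewrite ger0_norm; lra].
rewrite mulr0 in h; have [n _ hn] := cvgr_le _ h _ e0.
by exists n; rewrite -exprVn; exact: hn n (leqnn n).
Qed.

Definition cinf t k := clim (fun N => c N t k).
Definition dinf t k := clim (fun N => ct N t k).

Let alpha0 : 0 <= alpha. Proof. by case/andP: halpha => h _; exact: le_trans h. Qed.

Lemma cinfP t k : t \in `[0, T] -> ccvg (fun N => c N t k) (cinf t k).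
Proof.
move=> tT; apply: climP; apply: ccvg_cauchy => e e0.
have [j hj] := small_pow2 (2 * A) e0; have [n hn] := uN_uNt_cauchy j.
exists n => p q np nq; have [h _] := hn p q t np nq tT.
exact: le_trans (Yb_coef k alpha0 h) hj.
Qed.

Lemma dinfP t k : t \in `[0, T] -> ccvg (fun N => ct N t k) (dinf t k).
Proof.
move=> tT; apply: climP; apply: ccvg_cauchy => e e0.
have [j hj] := small_pow2 (4 * (L * A)) e0; have [n hn] := uN_uNt_cauchy j.
exists n => p q np nq; have [_ h] := hn p q t np nq tT.
exact: le_trans (Yb_coef k alpha0 h) hj.
Qed.

Lemma uN_cvg j : exists n, forall N t, (n <= N)%N -> t \in `[0, T] ->
  Yb (fun k => c N t k - cinf t k) (2 * A / 2 ^+ j) /\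
  Yb (fun k => ct N t k - dinf t k) (4 * (L * A) / 2 ^+ j).
Proof.
have [n hn] := uN_uNt_cauchy j; exists n => N t nN tT; split.
  apply: (@Yb_closed _ _ (fun M k => c N t k - c M t k)).
    by move=> k; apply: ccvgB (ccvg_cst _) (cinfP k tT).
  by near=> M; have [] := hn N M t nN _ tT; first by near: M; exact: nbhs_infty_ge.
apply: (@Yb_closed _ _ (fun M k => ct N t k - ct M t k)).
  by move=> k; apply: ccvgB (ccvg_cst _) (dinfP k tT).
by near=> M; have [] := hn N M t nN _ tT; first by near: M; exact: nbhs_infty_ge.
Unshelve. all: by end_near. Qed.

Lemma cinf_Yb t : t \in `[0, T] -> Yb (cinf t) A.
Proof.
move=> tT; apply: (@Yb_closed _ _ (fun N => c N t)) => [k|]; first exact: cinfP.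
by apply: nearW => N; have [] := uN_Hb halpha Hu0 galN N tT.
Qed.

Lemma dinf_Yb t : t \in `[0, T] -> Yb (dinf t) (L * A).
Proof.
move=> tT; apply: (@Yb_closed _ _ (fun N => ct N t)) => [k|]; first exact: dinfP.
by apply: nearW => N; have [] := uNt_Hb halpha Hu0 galN N tT.
Qed.

(** Once N >= |k| the Galerkin equation for mode k is untruncated, and the Lipschitz bound of [NL]
    carries it to the limit. *)
Lemma dinfE t k : t \in `[0, T] -> dinf t k = NL (fser (cinf t)) k.
Proof.
move=> tT; apply: ccvg_unique (dinfP k tT) _.
have Hc := Hb_fserE halpha (cinf_Yb tT); have [_ cY] := cinf_Yb tT.
have ha1 : 1 <= alpha by case/andP: halpha.
have c1 := Yb_l1 ha1 (cinf_Yb tT).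
apply/cvgr0Pnorm_le => e e0.
have [j hj] := small_pow2 (L * (2 * A)) e0; have [n hn] := uN_cvg j.
near=> N; rewrite ger0_norm ?normc_ge0 //.
rewrite uNt_NL // ifT; last by near: N; exact: nbhs_infty_ge.
have [|h _] := hn N t _ tT; first by near: N; exact: nbhs_infty_ge.
have h' : Yb (fun k => fourier (uN N t) k - fourier (fser (cinf t)) k) (2 * A / 2 ^+ j).
  by apply: Yb_ext h => i; rewrite (fser_fourier _ c1).
have := NL_lip halpha (uN_Hb halpha Hu0 galN N tT) Hc h'.
move=> /(Yb_coef k alpha0) /le_trans; apply; apply: le_trans hj.
by rewrite mulrA.
Unshelve. all: by end_near. Qed.

Lemma cinf0 k : cinf 0 k = fourier u0 k.
Proof.
apply: ccvg_unique (cinfP k mem0T) _; apply/cvgr0Pnorm_le => e e0; near=> N.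
rewrite (uN_init galN) ifT; last by near: N; exact: nbhs_infty_ge.
by rewrite subrr normc0 normr0 ltW.
Unshelve. all: by end_near. Qed.

End GalerkinConvergence.

(** * Continuous differentiability in time and convergence in C^1 *)

Section ContinuousDifferentiability.
Context {R : realType}.
Variable alpha : R.
Hypothesis halpha : 1 <= alpha <= 2.
Local Notation Yb := (Yb alpha).
Local Notation Hb := (Hb alpha).
Local Notation NL := (NL alpha).

Lemma cvge_to0 (X : Type) (F : set_system X) (FF : Filter F) (f : X -> \bar R) :
  (forall x, (0 <= f x)%E) ->
  (forall e : R, 0 < e -> \forall x \near F, (f x <= e%:E)%E) ->
  f x @[x --> F] --> 0%E.
Proof.
move=> f0 fe; apply/fine_cvgP; split.
  near=> x; rewrite ge0_fin_numE //.
  by apply: le_lt_trans (ltry 1); near: x; exact: fe.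
apply/cvgr0Pnorm_le => e e0; near=> x.
rewrite /= ger0_norm ?fine_ge0 // -lee_fin fineK; first by near: x; exact: fe.
rewrite ge0_fin_numE //; apply: le_lt_trans (ltry e); near: x; exact: fe.
Unshelve. all: by end_near. Qed.

Lemma near_within_dnbhs (S : set R) (t : R) (P : R -> Prop) :
  (\forall s \near t, s != t -> S s -> P s) -> \forall s \near within S t^', P s.
Proof. by move=> h; rewrite near_withinE /dnbhs near_withinE. Qed.

Lemma has_deriv_linear (S : set R) (t t0 : R) (z : R[i]) :
  has_deriv_in S (fun s => (s - t0)%:C * z) t z.
Proof.
apply/cvgr0Pnorm_le => e e0; apply: near_within_dnbhs; near=> s => st _.
rewrite (_ : _ - z = 0) ?normc0 ?normr0 ?ltW //.
rewrite -mulrBl -rmorphB (_ : s - t0 - (t - t0) = s - t); last by ring.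
by rewrite mulrA -rmorphM mulVf ?subr_eq0 // rmorph1 mul1r subrr.
Unshelve. all: by end_near. Qed.

Lemma Hb_Hnorm_le (w : R -> R[i]) B : Hb B w -> (Hnorm alpha w <= B%:E)%E.
Proof. by move=> [_ h]; apply/Hnorm_leP => //; case: h. Qed.

(** A quantitative criterion whose hypotheses are [Yb] bounds, hence stable under coefficientwise
    limits, unlike differentiability itself. *)
Lemma C1Hper_of_bounds T (v vt : R -> R -> R[i]) B K : 0 <= K ->
  (forall t, t \in `[0, T] -> Hb B (v t)) ->
  (forall t, t \in `[0, T] -> Hb B (vt t)) ->
  (forall s t, s \in `[0, T] -> t \in `[0, T] -> Yb (fun k => fourier (v s) k -
    fourier (v t) k - (s - t)%:C * fourier (vt t) k) (K * `|s - t| * `|s - t|)) ->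
  (forall s t, s \in `[0, T] -> t \in `[0, T] ->
    Yb (fun k => fourier (vt s) k - fourier (vt t) k) (K * `|s - t|)) ->
  C1Hper alpha T v vt.
Proof.
move=> K0 Hv Hvt h1 h2 t tT.
have Hn w := Hnorm_ge0 alpha w.
have small e : 0 < e -> \forall s \near t, K * `|s - t| <= e.
  move=> e0; have d0 : 0 < e / (K + 1) by rewrite divr_gt0 // ltr_wpDl.
  have hd : \forall s \near t, `|t - s| <= e / (K + 1).
    by apply: (@cvgr_dist_le _ _ _ (nbhs t) _ id t) => //; exact: cvg_id.
  near=> s; apply: (@le_trans _ _ ((K + 1) * (e / (K + 1)))).
    by rewrite distrC; apply: ler_pM => //; rewrite lerDl.
  by rewrite mulrC divfK // lt0r_neq0 // ltr_wpDl.
have L v' B' : Hb B' v' -> L2per v' by case.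
split; [exact: Hb_Hper (Hv t tT)|exact: Hb_Hper (Hvt t tT)| |].
- apply: cvge_to0 => // e e0; apply: near_within_dnbhs; near=> s => st sT.
  have Ls := L _ _ (Hv s sT); have Lt := L _ _ (Hv t tT); have Lvt := L _ _ (Hvt t tT).
  have st0 : s - t != 0 by rewrite subr_eq0.
  apply: le_trans (Hb_Hnorm_le (B := K * `|s - t|) _) _; last first.
    by rewrite lee_fin; near: s; exact: small.
  split; first by apply: L2perB => //; apply: L2perZ; exact: L2perB.
  apply: Yb_ext (Yb_le _ (YbZ ((s - t)^-1)%:C (h1 s t sT tT))) => [k|].
    rewrite fourierB; [|exact/L2per_cint/L2perZ/L2perB|exact: L2per_cint].
    rewrite fourierZ; last exact/L2per_cint/L2perB.
    rewrite fourierB; [|exact: L2per_cint..].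
    by rewrite mulrBr mulrA -rmorphM mulVf // rmorph1 mul1r.
  by rewrite normcR normfV mulrCA mulVf ?normr_eq0 // mulr1.
- apply: cvge_to0 => // e e0; rewrite near_withinE; near=> s => sT.
  have Ls := L _ _ (Hvt s sT); have Lt := L _ _ (Hvt t tT).
  apply: le_trans (Hb_Hnorm_le (B := K * `|s - t|) _) _; last first.
    by rewrite lee_fin; near: s; exact: small.
  split; first exact: L2perB.
  by apply: Yb_ext (h2 s t sT tT) => k; rewrite fourierB //; exact: L2per_cint.
Unshelve. all: by end_near. Qed.

Variables (u0 : R -> R[i]) (r : R).
Hypothesis Hu0 : Hb r u0.
Variables uN uNt : nat -> R -> R -> R[i].
Hypothesis galN : forall N, is_galerkin alpha u0 N (uN N) (uNt N).
Implicit Types (N M n j : nat) (k : int) (s t D e : R).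

Local Notation A := (Abd r).
Local Notation L := (Lip r).
Local Notation T := (Tlife r).
Local Notation c := (fun N t k => fourier (uN N t) k).
Local Notation ct := (fun N t k => fourier (uNt N t) k).
Local Notation cinf := (cinf uN).
Local Notation dinf := (dinf uNt).

Let A1 : 1 <= A := Abd_ge1 r.
Let T0 : 0 < T := Tlife_gt0 r.
Let L0 : 0 <= L := Lip_ge0 r.
Let alpha1 : 1 <= alpha. Proof. by case/andP: halpha. Qed.
Let alpha0 : 0 <= alpha. Proof. exact: le_trans alpha1. Qed.

Lemma itv_sub b e : b \in `[0, T] -> e \in `[0, T] ->
  forall s, s \in `[b, e] -> s \in `[0, T].
Proof.
rewrite !in_itv /= => /andP[b0 _] /andP[_ eT] s; rewrite !in_itv /= => /andP[bs se].
by rewrite (le_trans b0 bs) (le_trans se eT).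
Qed.

Lemma uN_deriv_sub N k b e t : b \in `[0, T] -> e \in `[0, T] -> t \in `[b, e] ->
  has_deriv_in `[b, e] (fun s => c N s k) t (ct N t k).
Proof.
move=> bT eT tbe; have tT := itv_sub bT eT tbe.
by apply: has_deriv_sub (uN_deriv galN N k tT) => s; exact: itv_sub.
Qed.

Lemma uN_lip_le N s t : s \in `[0, T] -> t \in `[0, T] -> t <= s ->
  Yb (fun k => c N s k - c N t k) (L * A * (s - t)).
Proof.
move=> sT tT ts; rewrite mulrBr.
apply: (@Yb_mean_value _ alpha (c N) (ct N) (fun x => L * A * x) (fun=> L * A) t s ts).
- by move=> k x xts; exact: uN_deriv_sub.
- by move=> x; exact: is_derive_mulr.
- by move=> x /(itv_sub tT sT) xT; have [] := uNt_Hb halpha Hu0 galN N xT.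
Qed.

Lemma uN_lip N s t : s \in `[0, T] -> t \in `[0, T] ->
  Yb (fun k => c N s k - c N t k) (L * A * `|s - t|).
Proof.
move=> sT tT; have [st|ts] := leP s t.
  rewrite ler0_norm ?subr_le0 // opprB.
  by apply: Yb_ext (YbN (uN_lip_le N tT sT st)) => k; rewrite opprB.
by rewrite gtr0_norm ?subr_gt0 //; exact: uN_lip_le (ltW ts).
Qed.

Lemma uNt_lip N s t : s \in `[0, T] -> t \in `[0, T] ->
  Yb (fun k => ct N s k - ct N t k) (L * (L * A) * `|s - t|).
Proof.
move=> sT tT; have Hs := uN_Hb halpha Hu0 galN N sT; have Ht := uN_Hb halpha Hu0 galN N tT.
have := NL_lip halpha Hs Ht (uN_lip N sT tT); rewrite mulrA => h.
have s0 : 0 <= s by move: sT; rewrite in_itv => /andP[].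
have t0 : 0 <= t by move: tT; rewrite in_itv => /andP[].
apply: Yb_mono h => k; rewrite !(uNt_coef galN) //.
by case: ifP => // _; rewrite subrr normc0 normc_ge0.
Qed.

Lemma uN_taylor N s t : s \in `[0, T] -> t \in `[0, T] ->
  Yb (fun k => c N s k - c N t k - (s - t)%:C * ct N t k)
     (L * (L * A) * `|s - t| * `|s - t|).
Proof.
move=> sT tT; set K := L * (L * A).
have K0 : 0 <= K by rewrite !mulr_ge0 //; move: A1; lra.
(* The mean value inequality for c(x) - (x - t) c_t(t), whose derivative c_t(x) - c_t(t) is at most
   K (e - b). The point t is the right or the left end of [b, e], according to the order of s and
   t. *)
have key b e : b \in `[0, T] -> e \in `[0, T] -> b <= e ->
    (forall x, x \in `[b, e] -> `|x - t| <= e - b) ->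
    Yb (fun k => (c N e k - (e - t)%:C * ct N t k) - (c N b k - (b - t)%:C * ct N t k))
      (K * (e - b) * (e - b)).
  move=> bT eT be hx; rewrite (mulrBr (K * (e - b)) e b).
  apply: (@Yb_mean_value _ alpha (fun x k => c N x k - (x - t)%:C * ct N t k)
    (fun x k => ct N x k - ct N t k) (fun x => K * (e - b) * x)
    (fun=> K * (e - b)) b e be).
  - move=> k x xbe; apply: has_deriv_inB; first exact: uN_deriv_sub.
    exact: has_deriv_linear.
  - by move=> x; exact: is_derive_mulr.
  - move=> x xbe; apply: Yb_le (uNt_lip N (itv_sub bT eT xbe) tT).
    by rewrite ler_wpM2l // hx.
have [st|ts] := leP s t.
  rewrite ler0_norm ?subr_le0 // opprB.
  have h x : x \in `[s, t] -> `|x - t| <= t - s.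
    by rewrite in_itv /= => /andP[sx xt]; rewrite ler0_norm ?subr_le0 // opprB lerB.
  apply: Yb_ext (YbN (key s t sT tT st h)) => k.
  by rewrite subrr mul0r subr0; ring.
rewrite gtr0_norm ?subr_gt0 //.
have h x : x \in `[t, s] -> `|x - t| <= s - t.
  by rewrite in_itv /= => /andP[tx xs]; rewrite ger0_norm ?subr_ge0 // lerB.
apply: Yb_ext (key t s tT sT (ltW ts) h) => k.
by rewrite subrr mul0r subr0; ring.
Qed.

Lemma uN_C1Hper N : C1Hper alpha T (uN N) (uNt N).
Proof.
have L1 : 1 <= L by rewrite /Lip; move: A1; lra.
apply: (@C1Hper_of_bounds _ _ _ (L * A) (L * (L * A))).
- by rewrite !mulr_ge0 //; move: A1; lra.
- move=> t tT; have [Lu uA] := uN_Hb halpha Hu0 galN N tT; split=> //.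
  by apply: Yb_le uA; rewrite ler_peMl //; move: A1; lra.
- by move=> t tT; exact: (uNt_Hb halpha Hu0 galN).
- exact: uN_taylor.
- exact: uNt_lip.
Qed.

Local Notation u := (fun t => fser (cinf t)).
Local Notation ut := (fun t => fser (dinf t)).

Lemma u_coef t k : t \in `[0, T] -> fourier (u t) k = cinf t k.
Proof.
by move=> tT; rewrite (fser_fourier _ (Yb_l1 alpha1 (cinf_Yb halpha Hu0 galN tT))).
Qed.

Lemma ut_coef t k : t \in `[0, T] -> fourier (ut t) k = dinf t k.
Proof.
by move=> tT; rewrite (fser_fourier _ (Yb_l1 alpha1 (dinf_Yb halpha Hu0 galN tT))).
Qed.

Lemma u_Hb t : t \in `[0, T] -> Hb A (u t).
Proof. by move=> tT; exact: (Hb_fserE halpha (cinf_Yb halpha Hu0 galN tT)). Qed.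

Lemma ut_Hb t : t \in `[0, T] -> Hb (L * A) (ut t).
Proof. by move=> tT; exact: (Hb_fserE halpha (dinf_Yb halpha Hu0 galN tT)). Qed.

(** The Taylor and Lipschitz bounds of u_N have constants independent of N, so they pass to the
    limit; limits and derivatives are never exchanged. *)
Lemma u_C1Hper : C1Hper alpha T u ut.
Proof.
have L1 : 1 <= L by rewrite /Lip; move: A1; lra.
have cP t k := cinfP halpha Hu0 galN k (t := t).
have dP t k := dinfP halpha Hu0 galN k (t := t).
apply: (@C1Hper_of_bounds _ _ _ (L * A) (L * (L * A))).
- by rewrite !mulr_ge0 //; move: A1; lra.
- move=> t tT; have [Lu uA] := u_Hb tT; split=> //.
  by apply: Yb_le uA; rewrite ler_peMl //; move: A1; lra.
- by move=> t tT; exact: ut_Hb.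
- move=> s t sT tT.
  apply: (@Yb_ext _ _ (fun k => cinf s k - cinf t k - (s - t)%:C * dinf t k)).
    move=> k; apply: esym; congr (_ - _ - _ * _);
      [exact: u_coef sT|exact: u_coef tT|exact: ut_coef tT].
  apply: (@Yb_closed _ _ (fun N k => c N s k - c N t k - (s - t)%:C * ct N t k)).
    by move=> k; apply: ccvgB; [apply: ccvgB; exact: cP|apply: ccvgZ; exact: dP].
  by apply: nearW => N; exact: uN_taylor.
- move=> s t sT tT.
  apply: (@Yb_ext _ _ (fun k => dinf s k - dinf t k)).
    by move=> k; apply: esym; congr (_ - _); [exact: ut_coef sT|exact: ut_coef tT].
  apply: (@Yb_closed _ _ (fun N k => ct N s k - ct N t k)).
    by move=> k; apply: ccvgB; exact: dP.
  by apply: nearW => N; exact: uNt_lip.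
Qed.

Lemma uN_cvg_C1Hper : cvg_C1Hper alpha T uN uNt u ut.
Proof.
split; [exact: uN_C1Hper|exact: u_C1Hper|].
apply: cvge_to0.
  (* Nonnegativity of a supremum requires a member of the set, the supremum of the empty set being
     -oo; the time 0 provides one. *)
  move=> N; rewrite /C1norm; apply: adde_ge0.
    apply: le_trans (Hnorm_ge0 alpha (fun x => uN N 0 x - u 0 x)) _.
    by apply: ereal_sup_ubound; exists 0 => //; rewrite /= in_itv /= lexx ltW.
  apply: le_trans (Hnorm_ge0 alpha (fun x => uNt N 0 x - ut 0 x)) _.
  by apply: ereal_sup_ubound; exists 0 => //; rewrite /= in_itv /= lexx ltW.
move=> e e0; have [j hj] := small_pow2 (2 * A + 4 * (L * A)) e0.
have [n hn] := uN_cvg halpha Hu0 galN j.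
exists n => // N /= nN.
have LN t : t \in `[0, T] -> L2per (uN N t) by move=> /(uN_Hb halpha Hu0 galN N)[].
have LNt t : t \in `[0, T] -> L2per (uNt N t) by move=> /(uNt_Hb halpha Hu0 galN N)[].
apply: (@le_trans _ _ ((2 * A / 2 ^+ j)%:E + (4 * (L * A) / 2 ^+ j)%:E)%E); last first.
  by rewrite -EFinD lee_fin -mulrDl.
apply: leeD; apply: ge_ereal_sup => _ [t tT <-]; have [h1 h2] := hn N t nN tT.
  apply: Hb_Hnorm_le; have [Lu _] := u_Hb tT; split; first by apply: L2perB => //; exact: LN.
  apply: Yb_ext h1 => k; rewrite fourierB ?u_coef //; apply: L2per_cint => //; exact: LN.
apply: Hb_Hnorm_le; have [Lu _] := ut_Hb tT; split; first by apply: L2perB => //; exact: LNt.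
apply: Yb_ext h2 => k; rewrite fourierB ?ut_coef //; apply: L2per_cint => //; exact: LNt.
Qed.

Lemma u_solution : is_fBBM_solution alpha T u0 u ut.
Proof.
have mem0 : 0 \in `[0, T] by rewrite in_itv /= lexx ltW.
split; first exact: u_C1Hper.
- have [Lu _] := u_Hb mem0; have [Lu0 _] := Hu0.
  apply: fourier_inj; [exact: L2per_cint|exact: L2per_cint|].
  by move=> k; rewrite u_coef // (cinf0 halpha Hu0 galN).
- move=> t tT; apply: (fBBM_equation halpha (cinf_Yb halpha Hu0 galN tT)
    (dinf_Yb halpha Hu0 galN tT)) => k.
  exact: (dinfE halpha Hu0 galN).
Qed.

End ContinuousDifferentiability.

(** * Uniqueness *)

Section Uniqueness.
Context {R : realType}.
Variable alpha : R.
Hypothesis halpha : 1 <= alpha <= 2.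
Local Notation Yb := (Yb alpha).
Local Notation Hb := (Hb alpha).
Local Notation NL := (NL alpha).
Implicit Types (T : R) (v w vt wt : R -> R -> R[i]).

Let alpha1 : 1 <= alpha. Proof. by case/andP: halpha. Qed.
Let alpha0 : 0 <= alpha. Proof. exact: le_trans alpha1. Qed.

Lemma near_of_within_dnbhs (S : set R) (t : R) (P : R -> Prop) :
  (\forall s \near within S t^', P s) -> \forall s \near t, s != t -> S s -> P s.
Proof. by rewrite near_withinE /dnbhs near_withinE. Qed.

Lemma near_Hnorm_le (F : set_system R) {FF : Filter F} (f : R -> R -> R[i]) (e : R) :
  Hnorm alpha (f s) @[s --> F] --> 0%E -> 0 < e ->
  \forall s \near F, Yb (fourier (f s)) e.
Proof.
move=> /fine_cvgP[fin h] e0; have he : \forall s \near F, `|fine (Hnorm alpha (f s))| <= e.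
  exact: (cvgr0Pnorm_le _).1 h e e0.
near=> s; apply/Hnorm_leP; first exact: ltW.
rewrite -[leLHS]fineK; last by near: s.
rewrite lee_fin; apply: le_trans (ler_norm _) _.
by near: s.
Unshelve. all: by end_near. Qed.

(** A single coefficient is bounded by the H^alpha norm, so convergence of the difference quotients
    in H^alpha implies it mode by mode. *)
Lemma C1Hper_has_deriv T v vt (t : R) k : C1Hper alpha T v vt -> t \in `[0, T] ->
  has_deriv_in `[0, T] (fun s => fourier (v s) k) t (fourier (vt t) k).
Proof.
move=> C1 tT; have [[Lt _] [Lvt _] h _] := C1 t tT.
apply/cvgr0Pnorm_le => e e0; have he := near_of_within_dnbhs (near_Hnorm_le h e0).
apply: near_within_dnbhs; near=> s => st sT.
have hY : Yb (fourier (fun x => ((s - t)^-1)%:C * (v s x - v t x) - vt t x)) e.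
  have : s != t -> s \in `[0, T] ->
    Yb (fourier (fun x => ((s - t)^-1)%:C * (v s x - v t x) - vt t x)) e.
    by near: s; exact: he.
  by apply.
have [[Ls _] _ _ _] := C1 s sT.
rewrite ger0_norm ?normc_ge0 //; have := Yb_coef k alpha0 hY.
rewrite fourierB; [|exact/L2per_cint/L2perZ/L2perB|exact: L2per_cint].
rewrite fourierZ; last exact/L2per_cint/L2perB.
by rewrite fourierB //; exact: L2per_cint.
Unshelve. all: by end_near. Qed.

Lemma Hb_dist (B e : R) (v w : R -> R[i]) : Hb B v -> L2per w ->
  Yb (fun k => fourier w k - fourier v k) e -> Hb (B + e) w.
Proof.
move=> [Lv vB] Lw vw; split=> //.
by apply: Yb_ext (YbD vB vw) => k; rewrite addrC subrK.
Qed.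

(** An arbitrary solution has no a priori bound, and the Lipschitz estimate needs a ball containing
    it at all times. The norm is continuous in t, as difference quotients near t are within 1 of the
    derivative, and [0, T] is compact. *)
Lemma C1Hper_bounded T v vt : C1Hper alpha T v vt ->
  exists B, 0 <= B /\ forall t, t \in `[0, T] -> Hb B (v t).
Proof.
move=> C1; pose h t := fine (Hnorm alpha (v t)).
have Hv t : t \in `[0, T] -> Hb (h t) (v t).
  by move=> tT; have [/Hper_Hb] := C1 t tT.
have h0 t : 0 <= h t by rewrite fine_ge0 // Hnorm_ge0.
have hle t B : t \in `[0, T] -> Hb B (v t) -> h t <= B.
  move=> tT /Hb_Hnorm_le hB; rewrite -lee_fin fineK //.
  by rewrite ge0_fin_numE ?Hnorm_ge0 // (le_lt_trans hB) ?ltry.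
have ch : {within `[0, T], continuous h}.
  apply/subspace_continuousP => t /= tT.
  have [[Lt _] [Lvt _] hd _] := C1 t tT.
  have he := near_of_within_dnbhs (near_Hnorm_le hd ltr01).
  have [B0 vtB] : Hb (fine (Hnorm alpha (vt t))) (vt t).
    by have [_ /Hper_Hb] := C1 t tT.
  set B := fine _ in vtB; have {}B0 : 0 <= B by case: vtB.
  apply/cvgrPdist_le => e e0.
  have hd' : \forall s \near t, `|t - s| <= e / (1 + B).
    apply: (@cvgr_dist_le _ _ _ (nbhs t) _ id t); first exact: cvg_id.
    by rewrite divr_gt0 // ltr_pwDl.
  rewrite near_withinE; near=> s => sT.
  have [->|st] := eqVneq s t; first by rewrite subrr normr0 ltW.
  have [[Ls _] _ _ _] := C1 s sT.
  have hY : Yb (fourier (fun x => ((s - t)^-1)%:C * (v s x - v t x) - vt t x)) 1.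
    have : s != t -> s \in `[0, T] ->
      Yb (fourier (fun x => ((s - t)^-1)%:C * (v s x - v t x) - vt t x)) 1.
      by near: s; exact: he.
    by apply.
  have dY : Yb (fun k => fourier (v s) k - fourier (v t) k) e.
    apply: Yb_ext (Yb_le _ (YbZ (s - t)%:C (YbD hY vtB))) => [k|].
      rewrite fourierB; [|exact/L2per_cint/L2perZ/L2perB|exact: L2per_cint].
      rewrite fourierZ; last exact/L2per_cint/L2perB.
      rewrite fourierB; [|exact: L2per_cint..].
      by rewrite subrK mulrA -rmorphM mulfV ?subr_eq0 // rmorph1 mul1r.
    rewrite normcR distrC mulrC.
    apply: (@le_trans _ _ ((1 + B) * (e / (1 + B)))).
      by apply: ler_wpM2l; [rewrite addr_ge0|near: s].
    by rewrite mulrC divfK // lt0r_neq0 // ltr_pwDl.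
  have dY' : Yb (fun k => fourier (v t) k - fourier (v s) k) e.
    by apply: Yb_ext (YbN dY) => k; rewrite opprB.
  have h1 := hle s _ sT (Hb_dist (Hv t tT) Ls dY).
  have h2 := hle t _ tT (Hb_dist (Hv s sT) Lt dY').
  by rewrite ler_distl lerBlDr h1 h2.
have [M [Mr hM]] : bounded_set (h @` `[0, T]).
  apply: compact_bounded; apply: continuous_compact => //; exact: segment_compact.
exists (Num.max 0 (M + 1)); split; first by rewrite le_max lexx.
move=> t tT; have [Lv vB] := Hv t tT; split=> //; apply: Yb_le vB.
apply: le_trans (ler_norm _) _; apply: le_trans (hM (M + 1) _ _ _) _.
- by rewrite ltrDl.
- by exists t.
- by rewrite le_max lexx orbT.
Unshelve. all: by end_near. Qed.

(* Picard iteration in the weighted norm sup_t e^{-2Lt} ||d(t)||, which the integral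
   equation contracts by 1/2. *)
Lemma coef_unique T v vt w wt : C1Hper alpha T v vt -> C1Hper alpha T w wt ->
  (forall t k, t \in `[0, T] -> fourier (vt t) k = NL (v t) k) ->
  (forall t k, t \in `[0, T] -> fourier (wt t) k = NL (w t) k) ->
  (forall k, fourier (v 0) k = fourier (w 0) k) ->
  forall t k, t \in `[0, T] -> fourier (v t) k = fourier (w t) k.
Proof.
move=> Cv Cw vE wE vw0.
have [Bv [Bv0 hv]] := C1Hper_bounded Cv; have [Bw [Bw0 hw]] := C1Hper_bounded Cw.
pose B := Bv + Bw.
have Hv t : t \in `[0, T] -> Hb B (v t).
  by move=> /hv[Lv vB]; split=> //; apply: Yb_le vB; rewrite lerDl.
have Hw t : t \in `[0, T] -> Hb B (w t).
  by move=> /hw[Lv vB]; split=> //; apply: Yb_le vB; rewrite lerDr.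
have B0 : 0 <= B by rewrite addr_ge0.
pose L := 1 + 24 * B; have L1 : 1 <= L by rewrite lerDl mulr_ge0.
pose W (t : R) := expR (2 * L * t).
have W1 t : 0 <= t -> 1 <= W t.
  by move=> t0; rewrite -expR0 ler_expR !mulr_ge0 //; lra.
have dW (q t : R) : is_derive t 1 (fun s => q * W s) (q * (W t * (2 * L))).
  have H : is_derive t 1 (q \*: (expR \o (fun s => 2 * L * s))) (q *: (W t * (2 * L))).
    apply: is_deriveZ; apply: is_derive1_comp; exact: is_derive_mulr.
  exact H.
have sub t : t \in `[0, T] -> forall s, s \in `[0, t] -> s \in `[0, T].
  rewrite in_itv /= => /andP[_ tT] s; rewrite !in_itv /= => /andP[-> st].
  exact: le_trans tT.
have key j t : t \in `[0, T] ->
    Yb (fun k => fourier (v t) k - fourier (w t) k) (2 * B / 2 ^+ j * W t).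
  elim: j t => [|j IH] t tT.
    have [_ vB] := Hv t tT; have [_ wB] := Hw t tT.
    apply: Yb_le (YbB vB wB); rewrite expr0 divr1 mulr_natl mulr2n.
    rewrite ler_peMr ?addr_ge0 //; apply: W1.
    by move: tT; rewrite in_itv => /andP[].
  have t0 : 0 <= t by move: tT; rewrite in_itv => /andP[].
  set D := 2 * B / 2 ^+ j in IH.
  have D0 : 0 <= D by rewrite divr_ge0 ?exprn_ge0 ?mulr_ge0.
  (* Since W' = 2 L W, the function (D/2) W is a primitive of the Lipschitz bound L D W; this is the
     source of the factor 1/2. *)
  have h := @Yb_mean_value _ alpha (fun s k => fourier (v s) k - fourier (w s) k)
    (fun s k => fourier (vt s) k - fourier (wt s) k)
    (fun s => D / 2 * W s) (fun s => D / 2 * (W s * (2 * L))) 0 t t0.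
  have {}h := h _ (dW _) _.
  apply: Yb_ext (Yb_le _ (h _ _)) => [k| |k s st|s st].
  - by rewrite vw0 subrr subr0.
  - rewrite /D exprS; have -> : 2 * B / (2 * 2 ^+ j) = D / 2.
      by rewrite /D; field; rewrite lt0r_neq0 ?exprn_gt0.
    by rewrite lerBlDr lerDl; apply: mulr_ge0; [exact: divr_ge0|exact: expR_ge0].
  - apply: has_deriv_inB.
      by apply: has_deriv_sub (C1Hper_has_deriv k Cv (sub t tT s st)) => x; exact: sub.
    by apply: has_deriv_sub (C1Hper_has_deriv k Cw (sub t tT s st)) => x; exact: sub.
  - have sT := sub t tT s st.
    have := NL_lip halpha (Hv s sT) (Hw s sT) (IH s sT).
    rewrite -/L (_ : L * (D * W s) = D / 2 * (W s * (2 * L))); last by field.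
    by apply: Yb_ext => k; rewrite vE // wE.
move=> t k tT; apply/eqP; rewrite -subr_eq0; apply/eqP; apply: normc_eq0.
apply/eqP; rewrite eq_le normc_ge0 andbT; apply/ler_addgt0Pr => e e0; rewrite add0r.
have [j hj] := small_pow2 (2 * B * W t) e0.
apply: le_trans (Yb_coef k alpha0 (key j t tT)) _.
by rewrite mulrAC.
Qed.

Lemma fBBM_unique T u0 v vt w wt : 0 <= T -> cint u0 ->
  is_fBBM_solution alpha T u0 v vt -> is_fBBM_solution alpha T u0 w wt ->
  forall t, t \in `[0, T] -> eq_L2 (w t) (v t).
Proof.
move=> T0 cu0 sv sw t tT; have [Cv v0 _] := sv; have [Cw w0 _] := sw.
have m0 : 0 \in `[0, T] by rewrite in_itv /= lexx.
have Lv s : s \in `[0, T] -> L2per (v s) by move=> /Cv[[]].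
have Lw s : s \in `[0, T] -> L2per (w s) by move=> /Cw[[]].
apply: fourier_inj; [exact/L2per_cint/Lw|exact/L2per_cint/Lv|] => k.
apply: (coef_unique Cw Cv) => //.
- by move=> s i; exact: (fBBM_coef halpha i sw).
- by move=> s i; exact: (fBBM_coef halpha i sv).
- have mv := cint_meas (L2per_cint (Lv 0 m0)); have mw := cint_meas (L2per_cint (Lw 0 m0)).
  have mu0 := cint_meas cu0 => i.
  by rewrite (eq_ae_fourier i mw mu0 w0) (eq_ae_fourier i mv mu0 v0).
Qed.

(** By Parseval the squared L^2 norm carries a factor 2 pi, which is at most 9 = 3^2. *)
Lemma VN_L2norm_le N (f : R -> R[i]) B : VN N f -> Yb (fourier f) B ->
  (L2norm f <= (3 * B)%:E)%E.
Proof.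
move=> [c ->] fB; have [B0 _] := fB.
apply: L2norm_le; [exact: csq_trigpoly|by rewrite mulr_ge0|].
rewrite parseval_trigpoly exprMn.
apply: ler_pM; rewrite ?mulr_ge0 ?pi_ge0 //; first by apply: sumr_ge0 => k _; exact: sqr_ge0.
  have /andP[_] := pihalf_02 R; lra.
apply: le_trans (Yb_l2 halpha fB (zr_uniq N)).
rewrite big_seq [leRHS]big_seq; apply: ler_sum => k.
by rewrite mem_zr fourier_trigpoly => ->.
Qed.

End Uniqueness.

Theorem lemma3p3 (R : realType) (alpha : R) (halpha : 1 <= alpha <= 2) :
  exists C : R -> R, (forall r, 0 < C r) /\
  forall u0 : R -> R, Hper alpha (fun x => (u0 x)%:C) ->
  exists T : R, 0 < T /\
  forall uN uNt : nat -> R -> R -> R[i],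
  (forall N, is_galerkin alpha (fun x => (u0 x)%:C) N (uN N) (uNt N)) ->
  let C0 := C (fine (Hnorm alpha (fun x => (u0 x)%:C))) in
  (forall (N : nat) (t : R), t \in `[0, T] ->
     [/\ (L2norm (uN N t) <= C0%:E)%E,
         (Hnorm alpha (uN N t) <= C0%:E)%E &
         (Hnorm alpha (uNt N t) <= C0%:E)%E]) /\
  exists u ut : R -> R -> R[i],
  [/\ is_fBBM_solution alpha T (fun x => (u0 x)%:C) u ut,
      forall w wt : R -> R -> R[i],
        is_fBBM_solution alpha T (fun x => (u0 x)%:C) w wt ->
        forall t : R, t \in `[0, T] -> eq_L2 (w t) (u t) &
      cvg_C1Hper alpha T uN uNt u ut].
Proof.
(* L A bounds the time derivative and, as L >= 1, also the bound A of u_N; the 3 absorbs the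
   normalization of the L^2 norm. *)
exists (fun r => 3 * (Lip r * Abd r)).
have A1 r : 1 <= Abd r :> R := Abd_ge1 r.
have L1 r : 1 <= Lip r :> R by rewrite /Lip; have := A1 r; lra.
split=> [r|u0 Hu0].
  by rewrite !mulr_gt0 //; [exact: lt_le_trans (L1 r)|exact: lt_le_trans (A1 r)].
set r := fine (Hnorm alpha (fun x => (u0 x)%:C)).
have {}Hu0 : Hb alpha r (fun x => (u0 x)%:C) := Hper_Hb Hu0.
exists (Tlife r); split; first exact: Tlife_gt0.
move=> uN uNt galN C0.
have A0 : 0 <= Abd r := le_trans ler01 (A1 r).
have LA0 : 0 <= Lip r * Abd r by rewrite mulr_ge0 // (le_trans ler01 (L1 r)).
have ALA : Abd r <= Lip r * Abd r by rewrite ler_peMl.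
have LAC : Lip r * Abd r <= C0 by rewrite ler_peMl //; lra.
split.
  move=> N t tT.
  have HuN := uN_Hb halpha Hu0 galN N tT.
  have HuNt := uNt_Hb halpha Hu0 galN N tT.
  have [_ /(_ t)] := galN N.
  have t0 : 0 <= t by move: tT; rewrite in_itv => /andP[].
  move=> /(_ t0)[VuN _ _ _]; split.
  - have [_ uNA] := HuN; apply: le_trans (VN_L2norm_le halpha VuN uNA) _.
    by rewrite lee_fin ler_pM2l.
  - by apply: le_trans (Hb_Hnorm_le HuN) _; rewrite lee_fin (le_trans ALA).
  - by apply: le_trans (Hb_Hnorm_le HuNt) _; rewrite lee_fin.
exists (fun t => fser (cinf uN t)), (fun t => fser (dinf uNt t)).
have sol := u_solution halpha Hu0 galN.
split=> //; last exact: (uN_cvg_C1Hper halpha Hu0 galN).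
move=> w wt; apply: (fBBM_unique halpha _ _ sol); first exact: ltW (Tlife_gt0 r).
by have [/L2per_cint] := Hu0.
Qed.
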